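(* Let $\mathcal{A}$ be a real $n_1\times n_2\times n_3$ tensor, let $k\ge1$ be an integer (the target truncation term), let $p\ge2$ be an integer (the oversampling parameter), let $\mathbf{q}=(q_1,\dots,q_{n_3})$ be a vector of nonnegative integers (the iteration counts), and let $\mathcal{W}$ be an $n_2\times(k+p)\times n_3$ Gaussian random tensor. For each $i$ let $\hat\sigma_1^{(i)}\ge\hat\sigma_2^{(i)}\ge\cdots$ be the singular values of the $i$-th Fourier-domain frontal slice $\hat{\mathcal{A}}^{(i)}$, and assume that $\hat\sigma_k^{(i)}>0$ and that the singular value gap $\tau_k^{(i)}:=\hat\sigma_{k+1}^{(i)}/\hat\sigma_k^{(i)}$ satisfies $\tau_k^{(i)}<1$. If $\mathcal{Q}$ is obtained from the slicewise randomized subspace iteration in the Fourier domain with iteration counts $\mathbf{q}$ and starting tensor $\mathcal{W}$, then $$\mathbb{E}\,\|\mathcal{A}-\mathcal{Q}\ast\mathcal{Q}^{\rm T}\ast\mathcal{A}\|_{\rm F}\;\le\;\left(\frac{1}{n_3}\sum_{i=1}^{n_3}\left(1+\frac{k}{p-1}\big(\tau_k^{(i)}\big)^{4q_i}\right)\left(\sum_{j=k+1}^{\min\{n_1,n_2\}}\big(\hat\sigma_j^{(i)}\big)^2\right)\right)^{1/2}.$$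
   Context: For a third-order tensor $\mathcal{A}$ of size $n_1\times n_2\times n_3$, $\mathcal{A}^{(i)}=\mathcal{A}(:,:,i)$ is its $i$-th frontal slice, and $\|\mathcal{A}\|_{\rm F}$ is the square root of the sum of the squared absolute values of all entries. $\hat{\mathcal{A}}$ denotes the tensor obtained by applying the (unnormalized) discrete Fourier transform of length $n_3$ to every tube $\mathcal{A}(i,j,:)$, and $\hat{\mathcal{A}}^{(i)}$ its $i$-th frontal slice. By convention $\hat\sigma_j^{(i)}=0$ for $j>\min\{n_1,n_2\}$. t-product: for $\mathcal{A}$ of size $n_1\times n_2\times n_3$ and $\mathcal{B}$ of size $n_2\times n_4\times n_3$, $\mathcal{C}=\mathcal{A}\ast\mathcal{B}$ is the $n_1\times n_4\times n_3$ tensor with tubes $\mathcal{C}(i,j,:)=\sum_{l=1}^{n_2}\mathcal{A}(i,l,:)\circ\mathcal{B}(l,j,:)$, where $\circ$ is circular convolution; equivalently $\hat{\mathcal{C}}^{(i)}=\hat{\mathcal{A}}^{(i)}\hat{\mathcal{B}}^{(i)}$ for all $i$. Transpose: for real $\mathcal{A}$, $\mathcal{A}^{\rm T}$ is the $n_2\times n_1\times n_3$ tensor obtained by transposing each frontal slice and then reversing the order of the transposed slices $2,\dots,n_3$; equivalently, its Fourier slices are the conjugate transposes $(\hat{\mathcal{A}}^{(i)})^{\rm H}$. The Fourier-slice description is taken as the definition of $\mathcal{Q}^{\rm T}$ in general, so that $\mathcal{Q}\ast\mathcal{Q}^{\rm T}\ast\mathcal{A}$ has Fourier slices $\hat{\mathcal{Q}}^{(i)}(\hat{\mathcal{Q}}^{(i)})^{\rm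 H}\hat{\mathcal{A}}^{(i)}$. Gaussian random tensor: the entries of the first frontal slice $\mathcal{W}^{(1)}$ are independent standard normal random variables and all other frontal slices are zero; hence every $\hat{\mathcal{W}}^{(i)}$ equals $\mathcal{W}^{(1)}$. Slicewise randomized subspace iteration: for each $i=1,\dots,n_3$, compute a thin QR factorization of $\hat{\mathcal{A}}^{(i)}\hat{\mathcal{W}}^{(i)}$, with orthonormal factor $\hat{\mathcal{Q}}_0^{(i)}$; for $j=1,\dots,q_i$, let $\hat{\mathcal{G}}_j^{(i)}$ be the orthonormal factor of a thin QR factorization of $(\hat{\mathcal{A}}^{(i)})^{\rm H}\hat{\mathcal{Q}}_{j-1}^{(i)}$ and let $\hat{\mathcal{Q}}_j^{(i)}$ be the orthonormal factor of a thin QR factorization of $\hat{\mathcal{A}}^{(i)}\hat{\mathcal{G}}_j^{(i)}$. Set $\hat{\mathcal{Q}}^{(i)}=\hat{\mathcal{Q}}_{q_i}^{(i)}$, and let $\mathcal{Q}$ be the inverse discrete Fourier transform along the third dimension of the tensor with frontal slices $\hat{\mathcal{Q}}^{(i)}$. *)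

(* Defs.v *)
From HB Require Import structures.
From mathcomp Require Import all_boot all_order all_algebra spectral.
From mathcomp Require Import complex.
From mathcomp Require Import all_classical all_reals all_analysis.

Set Implicit Arguments.
Unset Strict Implicit.
Unset Printing Implicit Defensive.

Import Order.TTheory GRing.Theory Num.Theory.
Local Open Scope classical_set_scope.
Local Open Scope ring_scope.
Local Open Scope complex_scope.
Local Open Scope sesquilinear_scope.

(* A third-order tensor is the finite family of its frontal slices: A t i j is
   the entry in position (i, j, t). Slices are numbered from 0, so the first
   slice is the one with t = 0 and the DFT has exponent t * i. *)
Notation tensor K n1 n2 n3 := {ffun 'I_n3 -> 'M[K]_(n1, n2)}.

Section Tensors.
Context {R : realType}.
Local Notation C := (R[i]).

Definition tensorC n1 n2 n3 (A : tensor R n1 n2 n3) : tensor C n1 n2 n3 :=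
  [ffun t => map_mx (real_complex R) (A t)].

Definition frobenius n1 n2 n3 (A : tensor C n1 n2 n3) : R :=
  Num.sqrt (\sum_t \sum_i \sum_j ComplexField.Normc.normc (A t i j) ^+ 2).

(* exp(- 2 pi i / n) *)
Definition dft_root (n : nat) : C :=
  cos (2 * pi / n%:R) -i* sin (2 * pi / n%:R).

Definition dft n1 n2 n3 (A : tensor C n1 n2 n3) : tensor C n1 n2 n3 :=
  [ffun i : 'I_n3 => \sum_(t < n3) dft_root n3 ^+ (i * t) *: A t].

Definition idft n1 n2 n3 (A : tensor C n1 n2 n3) : tensor C n1 n2 n3 :=
  [ffun t : 'I_n3 =>
     n3%:R^-1 *: \sum_(i < n3) dft_root n3 ^- (i * t) *: A i].

(* Circular convolution of the tubes, written slicewise. *)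
Definition tprod n1 n2 n4 n3 (A : tensor C n1 n2 n3) (B : tensor C n2 n4 n3) :
    tensor C n1 n4 n3 :=
  [ffun t : 'I_n3 =>
     \sum_(u < n3) \sum_(v < n3 | ((u + v) %% n3 == t)%N) A u *m B v].

Definition ttr n1 n2 n3 (A : tensor C n1 n2 n3) : tensor C n2 n1 n3 :=
  idft [ffun i => (dft A i)^t*].

(* s j is the j-th largest singular value, counted from j = 1 (s 0 is unused),
   with the convention s j = 0 beyond min(m, n). *)
Definition singular_values m n (M : 'M[C]_(m, n)) (s : nat -> R) : Prop :=
  [/\ forall j, 0 <= s j,
      forall i j, (0 < i <= j)%N -> s j <= s i,
      forall j, (minn m n < j)%N -> s j = 0
    & exists U : 'M[C]_m, exists V : 'M[C]_n,
      [/\ U \is unitarymx, V \is unitarymx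
        & M = U *m (\matrix_(i < m, j < n)
                      (if i == j :> nat then (s i.+1)%:C else 0)) *m V^t*]].

(* Q is the orthonormal factor of a thin QR factorization of M. It is
   unique only up to phases, and not even its range is determined when M is
   rank deficient, hence a relation. *)
Definition thin_qr m n (M : 'M[C]_(m, n)) (Q : 'M[C]_(m, minn m n)) : Prop :=
  Q^t* *m Q = 1%:M /\
  exists Rf : 'M[C]_(minn m n, n),
    (forall (i : 'I_(minn m n)) (j : 'I_n), (j < i)%N -> Rf i j = 0) /\
    M = Q *m Rf.

(* subspace_iter M N q Q : Q is a possible orthonormal factor after q
   iterations on M from the starting matrix N. It has l columns as soon as
   l <= min(m, n); the index r accounts for the smaller factors otherwise. *)
Inductive subspace_iter m n l (M : 'M[C]_(m, n)) (N : 'M[C]_(n, l)) :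
    nat -> forall r, 'M[C]_(m, r) -> Prop :=
| SubspaceIter0 (Q : 'M[C]_(m, minn m l)) :
    thin_qr (M *m N) Q -> subspace_iter M N 0 Q
| SubspaceIterS (j r : nat) (Q : 'M[C]_(m, r)) (G : 'M[C]_(n, minn n r))
    (Q' : 'M[C]_(m, minn m (minn n r))) :
    subspace_iter M N j Q -> thin_qr (M^t* *m Q) G -> thin_qr (M *m G) Q' ->
    subspace_iter M N j.+1 Q'.

(* The final factors of the slices are assembled into one n1 x l x n3 tensor.
   Qi *m pid_mx r is Qi itself if r = l; if r < l (which only happens when
   min(n1, n2) < l) it is Qi followed by l - r zero columns, which leaves
   Qi *m Qi^t* unchanged. *)
Definition tensor_subspace_iter n1 n2 l n3 (A : tensor C n1 n2 n3)
    (W : tensor C n2 l n3) (q : 'I_n3 -> nat) (Q : tensor C n1 l n3) : Prop :=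
  exists2 Qh : tensor C n1 l n3,
    forall i, exists r, exists2 Qi : 'M[C]_(n1, r),
      subspace_iter (dft A i) (dft W i) (q i) Qi &
      Qh i = Qi *m pid_mx r
  & Q = idft Qh.

End Tensors.

Section Gaussian.
Context {d : measure_display} {T : measurableType d} {R : realType}.
Variable P : probability T R.

Definition mutually_independent (I : finType) (X : I -> T -> R) : Prop :=
  forall (J : {set I}) (B : I -> set R), (forall i, measurable (B i)) ->
    P (\bigcap_(i in [set` J]) X i @^-1` B i) =
    (\prod_(i in J) P (X i @^-1` B i))%E.

Definition std_normal (X : T -> R) : Prop :=
  measurable_fun [set: T] X /\
  forall B : set R, measurable B -> P (X @^-1` B) = normal_prob 0 1 B.

Definition gaussian_tensor n l n3 (W : T -> tensor R n l n3) : Prop :=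
  forall t : 'I_n3,
    if t == 0%N :> nat then
      (forall i j, std_normal (fun w => W w t i j)) /\
      mutually_independent (fun (ij : 'I_n * 'I_l) w => W w t ij.1 ij.2)
    else forall w, W w t = 0.

End Gaussian.

(* Main.v *)
Require Import Defs.
From HB Require Import structures.
From mathcomp Require Import all_boot all_order all_algebra spectral.
From mathcomp Require Import complex.
From mathcomp Require Import all_classical all_reals all_analysis.
From mathcomp Require Import measurable_realfun perm ring lra.

Set Implicit Arguments.
Unset Strict Implicit.
Unset Printing Implicit Defensive.

Import Order.TTheory GRing.Theory Num.Theory.
Import numFieldNormedType.Exports.
Local Open Scope classical_set_scope.
Local Open Scope ring_scope.
Local Open Scope complex_scope.
Local Open Scope sesquilinear_scope.

(** A slice M of the Fourier-domain tensor is complex while the Gaussian matrix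
    W is real, so rotational invariance of W under the singular vectors of M is
    not available. Instead, with K = (W^* H W + delta)^-1 and Xi = 1 - W K W^* H,
    the error on a slice with k leading right singular vectors V1 is bounded by
    tail - tr H2 + tr (H Xi), where H = lambda V1 V1^* + H2, lambda is large,
    and H2 is the damped tail of M^* M.

    The mean of the ridge residual tr (H Xi) is controlled by Gaussian
    integration by parts applied to the field Xi^* H2 W. This yields
    (p - delta tr K) tr (H Xi) <= (k + p - 1) tr H2 + tr (Xi^* H2 conj Xi) in
    mean. The last term, which real data would turn into tr (Xi^* H2 Xi), mixes
    H2 and its conjugate. It is absorbed by taking H2 to be a perturbation of a
    near maximizer G of the mean residual among the admissible H2 of trace at
    most 1, in the direction of the compression of conj G to the complement of
    V1: near optimality of G bounds the conjugate term by the residual itself.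
    As delta -> 0 and lambda -> oo the mean residual is at most
    (k + p - 1) / (p - 1) tr H2, hence the factor 1 + k / (p - 1). *)

(** * Traces, squared norms and positive semidefinite matrices *)

(** As a function of [H] the ridge residual [rtr (resid H d W)] is a minimum over [Y] of costs that
    are linear in [H], hence concave. The coefficients of one weight therefore bound the residual of
    any other, and comparing a perturbed weight with a near maximizer bounds the quadratic form in
    the direction of the perturbation. This is the access to the conjugate term, which arises
    because [W] moves in real directions only, so that differentiating [W^*] produces transposes.
    The supremum is taken over a trace ball with [lam] and [d] fixed, so every error must be uniform
    there: hence the order of choices, [e] before [lam] before [d], and the multiple of [P2] in the
    competitor, which keeps [H] above a fixed multiple of the identity. With [d > 0] all functions
    of [W] are smooth and of polynomial growth, even where [W] is rank deficient. [Q] is merely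
    related to [W] and may fail to be measurable, so the slice errors are dominated pointwise by
    measurable functions of [W] before any integral is estimated. *)

Local Notation cplx R := (Num.ClosedField.sort (complex_complex__canonical__Num_ClosedField R)).

(* Locked: unification would otherwise unfold traces to compare them. *)
HB.lock Definition rtr (R : rcfType) n (A : 'M[cplx R]_n) : R := complex.Re (\tr A).
HB.lock Definition fsq (R : rcfType) m n (A : 'M[cplx R]_(m, n)) : R := rtr (A^t* *m A).
HB.lock Definition qf (R : rcfType) m n (H : 'M[cplx R]_m) (X : 'M[cplx R]_(m, n)) : R :=
  rtr (X^t* *m H *m X).

Section Adjoint.
Variable R : rcfType.
Local Notation C := (Num.ClosedField.sort (complex_complex__canonical__Num_ClosedField R)).
Local Notation Re := complex.Re.
Local Notation Im := complex.Im.

Lemma conjCE (z : C) : z^*%R = conjc z. Proof. by []. Qed.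

Lemma adjmxM m n p (A : 'M[C]_(m, n)) (B : 'M[C]_(n, p)) :
  (A *m B)^t* = B^t* *m A^t*.
Proof. by rewrite trmx_mul map_mxM. Qed.

Lemma adjmxD m n (A B : 'M[C]_(m, n)) : (A + B)^t* = A^t* + B^t*.
Proof. by rewrite linearD /= map_mxD. Qed.

Lemma adjmxB m n (A B : 'M[C]_(m, n)) : (A - B)^t* = A^t* - B^t*.
Proof. by rewrite linearB /= map_mxB. Qed.

Lemma adjmxN m n (A : 'M[C]_(m, n)) : (- A)^t* = - A^t*.
Proof. by rewrite linearN /= map_mxN. Qed.

Lemma adjmxZ m n (a : C) (A : 'M[C]_(m, n)) : (a *: A)^t* = a^*%R *: A^t*.
Proof. by rewrite linearZ /= map_mxZ. Qed.

Lemma adjmxZr m n (a : R) (A : 'M[C]_(m, n)) : (a%:C *: A)^t* = a%:C *: A^t*.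
Proof. by rewrite adjmxZ; congr (_ *: _); rewrite conjCE conjc_real. Qed.

Lemma adjmx1 n : (1%:M : 'M[C]_n)^t* = 1%:M.
Proof. by rewrite trmx1 map_mx1. Qed.

Lemma rtrE n (A : 'M[C]_n) : rtr A = Re (\tr A).
Proof. by rewrite rtr.unlock. Qed.

Lemma fsqC m n (A : 'M[C]_(m, n)) : fsq A = rtr (A^t* *m A).
Proof. by rewrite fsq.unlock. Qed.

Lemma qfE m n (H : 'M[C]_m) (X : 'M[C]_(m, n)) : qf H X = rtr (X^t* *m H *m X).
Proof. by rewrite qf.unlock. Qed.

Lemma rtrD n (A B : 'M[C]_n) : rtr (A + B) = rtr A + rtr B.
Proof. by rewrite !rtrE mxtraceD; case: (\tr A) (\tr B) => [a b] [c d]. Qed.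

Lemma rtrN n (A : 'M[C]_n) : rtr (- A) = - rtr A.
Proof. by rewrite !rtrE (_ : \tr (- A) = - \tr A) ?raddfN //; case: (\tr A). Qed.

Lemma rtrB n (A B : 'M[C]_n) : rtr (A - B) = rtr A - rtr B.
Proof. by rewrite rtrD rtrN. Qed.

Lemma rtrZ n a (A : 'M[C]_n) : rtr (a%:C *: A) = a * rtr A.
Proof. by rewrite !rtrE mxtraceZ; case: (\tr A) => [b c] /=; rewrite mul0r subr0. Qed.

Lemma rtr_mulC m n (A : 'M[C]_(m, n)) (B : 'M[C]_(n, m)) :
  rtr (A *m B) = rtr (B *m A).
Proof. by rewrite !rtrE mxtrace_mulC. Qed.

Lemma rtr_adj n (A : 'M[C]_n) : rtr (A^t*) = rtr A.
Proof.
rewrite !rtrE; have -> : \tr (A^t*) = (\tr A)^*%R.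
  by rewrite /mxtrace rmorph_sum; apply: eq_bigr => i _; rewrite !mxE.
by rewrite conjCE; case: (\tr A).
Qed.

Lemma rtr1 n : rtr (1%:M : 'M[C]_n) = n%:R.
Proof. by rewrite !rtrE mxtrace1 -(rmorph_nat (real_complex R)). Qed.

Lemma fsq1 n : fsq (1%:M : 'M[C]_n) = n%:R.
Proof. by rewrite !fsqC adjmx1 mulmx1 rtr1. Qed.

Lemma fsqE m n (A : 'M[C]_(m, n)) :
  fsq A = \sum_i \sum_j ((Re (A i j)) ^+ 2 + (Im (A i j)) ^+ 2).
Proof.
rewrite !fsqC !rtrE /mxtrace (raddf_sum (@complex.Re R : Rcomplex R -> R)) exchange_big /=.
apply: eq_bigr => j _; rewrite mxE (raddf_sum (@complex.Re R : Rcomplex R -> R)) /=.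
apply: eq_bigr => i _; rewrite !mxE conjCE; case: (A i j) => a b /=.
by rewrite mulNr opprK -!expr2.
Qed.

Lemma fsq_ge0 m n (A : 'M[C]_(m, n)) : 0 <= fsq A.
Proof.
by rewrite fsqE; do 2![apply: sumr_ge0 => ? _]; rewrite addr_ge0 // sqr_ge0.
Qed.

Lemma fsq_adj m n (A : 'M[C]_(m, n)) : fsq (A^t*) = fsq A.
Proof. by rewrite !fsqC trmxCK rtr_mulC. Qed.

Lemma fsq_conj m n (A : 'M[C]_(m, n)) : fsq (map_mx Num.conj A) = fsq A.
Proof.
rewrite !fsqE; apply: eq_bigr => i _; apply: eq_bigr => j _.
by rewrite !mxE conjCE; case: (A i j) => a b /=; rewrite sqrrN.
Qed.

Lemma fsqN m n (A : 'M[C]_(m, n)) : fsq (- A) = fsq A.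
Proof. by rewrite !fsqC adjmxN mulNmx mulmxN opprK. Qed.

Lemma fsqZ m n a (A : 'M[C]_(m, n)) : fsq (a%:C *: A) = a ^+ 2 * fsq A.
Proof.
by rewrite !fsqC adjmxZr -scalemxAl -scalemxAr scalerA -rmorphM rtrZ expr2.
Qed.

Lemma fsqD m n (A B : 'M[C]_(m, n)) :
  fsq (A + B) = fsq A + fsq B + 2 * rtr (A^t* *m B).
Proof.
rewrite !fsqC adjmxD mulmxDl !mulmxDr !rtrD.
have -> : rtr (B^t* *m A) = rtr (A^t* *m B) by rewrite -rtr_adj adjmxM trmxCK.
by ring.
Qed.

Lemma fsqB m n (A B : 'M[C]_(m, n)) :
  fsq (A - B) = fsq A + fsq B - 2 * rtr (A^t* *m B).
Proof. by rewrite fsqD fsqN mulmxN rtrN mulrN. Qed.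

(** Young's inequality: the squared norm of [sqrt a A - B / sqrt a] is nonnegative. It replaces
    Cauchy-Schwarz wherever a trace is to be absorbed into its own square. *)
Lemma rtr_AMGM m n (a : R) (A B : 'M[C]_(m, n)) : 0 < a ->
  2 * rtr (A^t* *m B) <= a * fsq A + a^-1 * fsq B.
Proof.
move=> a0; have := fsq_ge0 ((Num.sqrt a)%:C *: A - (Num.sqrt a)^-1%:C *: B).
rewrite fsqB !fsqZ adjmxZr -scalemxAl -scalemxAr scalerA -rmorphM rtrZ.
have sn0 : Num.sqrt a != 0 by rewrite sqrtr_eq0 -ltNge.
by rewrite mulfV // mul1r exprVn (sqr_sqrtr (ltW a0)) subr_ge0.
Qed.

Lemma fsqDS m n (a : R) (A B : 'M[C]_(m, n)) : 0 < a ->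
  fsq (A + B) <= (1 + a) * fsq A + (1 + a^-1) * fsq B.
Proof. by move=> a0; rewrite fsqD; have := rtr_AMGM A B a0; lra. Qed.

Lemma sqrCS (I : finType) (f g : I -> R) :
  (\sum_i f i * g i) ^+ 2 <= (\sum_i f i ^+ 2) * (\sum_i g i ^+ 2).
Proof.
have F0 : 0 <= \sum_i f i ^+ 2 by apply: sumr_ge0 => *; rewrite sqr_ge0.
have G0 : 0 <= \sum_i g i ^+ 2 by apply: sumr_ge0 => *; rewrite sqr_ge0.
set F := \sum_i f i ^+ 2 in F0 *; set G := \sum_i g i ^+ 2 in G0 *.
set S := \sum_i _.
have key t : 0 <= F + t ^+ 2 * G - t * 2 * S.
  have -> : F + t ^+ 2 * G - t * 2 * S = \sum_i (f i - t * g i) ^+ 2.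
    rewrite /F /G /S !mulr_sumr -big_split -sumrB /=.
    by apply: eq_bigr => i _; ring.
  by apply: sumr_ge0 => *; rewrite sqr_ge0.
have [G00|Gn0] := eqVneq G 0.
  have g0 i : g i = 0.
    apply/eqP; rewrite -sqrf_eq0.
    by have /psumr_eq0P -> // : \sum_i g i ^+ 2 = 0 by []; move=> *; rewrite sqr_ge0.
  by rewrite /S big1 ?expr0n ?mulr_ge0 // => i _; rewrite g0 mulr0.
have Gp : 0 < G by rewrite lt_def Gn0.
have := key (S / G).
have -> : F + (S / G) ^+ 2 * G - S / G * 2 * S = (F * G - S ^+ 2) / G by field.
by rewrite pmulr_lge0 ?invr_gt0 // subr_ge0.
Qed.

Lemma fsqM m n p (A : 'M[C]_(m, n)) (B : 'M[C]_(n, p)) :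
  fsq (A *m B) <= fsq A * fsq B.
Proof.
rewrite (fsqE (A *m B)) (fsqE A) -[fsq B]fsq_adj (fsqE (B^t*)) mulr_suml.
apply: ler_sum => i _; rewrite mulr_sumr; apply: ler_sum => k _.
pose r j := Re (A i j); pose s j := Im (A i j).
pose u j := Re (B j k); pose v j := Im (B j k).
have -> : Re ((A *m B) i k) = \sum_j r j * u j - \sum_j s j * v j.
  rewrite mxE (raddf_sum (@complex.Re R : Rcomplex R -> R)) -sumrB.
  by apply: eq_bigr => j _; rewrite /r /s /u /v; case: (A i j) (B j k) => ? ? [].
have -> : Im ((A *m B) i k) = \sum_j r j * v j + \sum_j s j * u j.
  rewrite mxE (raddf_sum (@complex.Im R : Rcomplex R -> R)) -big_split.
  by apply: eq_bigr => j _; rewrite /r /s /u /v; case: (A i j) (B j k) => ? ? [].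
have -> : \sum_j (Re (A i j) ^+ 2 + Im (A i j) ^+ 2) =
          \sum_j r j ^+ 2 + \sum_j s j ^+ 2 by rewrite -big_split.
have -> : \sum_j (Re (B^t* k j) ^+ 2 + Im (B^t* k j) ^+ 2) =
          \sum_j u j ^+ 2 + \sum_j v j ^+ 2.
  rewrite -big_split; apply: eq_bigr => j _; rewrite !mxE conjCE /u /v.
  by case: (B j k) => a b /=; rewrite sqrrN.
(* Cauchy-Schwarz for the real pairs (r, s), (u, -v) and (r, s), (v, u) *)
pose f (x : 'I_n + 'I_n) := match x with inl j => r j | inr j => s j end.
pose g (x : 'I_n + 'I_n) := match x with inl j => u j | inr j => - v j end.
pose h (x : 'I_n + 'I_n) := match x with inl j => v j | inr j => u j end.
pose w (t : R) := fun x => g x + t * h x.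
have E1 : \sum_j r j * u j - \sum_j s j * v j = \sum_x f x * g x.
  by rewrite big_sumType /= -sumrN; congr (_ + _); apply: eq_bigr => j _; rewrite mulrN.
have E2 : \sum_j r j * v j + \sum_j s j * u j = \sum_x f x * h x.
  by rewrite big_sumType.
have E3 : \sum_j r j ^+ 2 + \sum_j s j ^+ 2 = \sum_x f x ^+ 2 by rewrite big_sumType.
have E4 : \sum_j u j ^+ 2 + \sum_j v j ^+ 2 = \sum_x g x ^+ 2.
  by rewrite big_sumType /=; congr (_ + _); apply: eq_bigr => j _; rewrite sqrrN.
have E5 : \sum_x h x ^+ 2 = \sum_x g x ^+ 2 by rewrite -E4 big_sumType addrC.
have E6 : \sum_x g x * h x = 0.
  rewrite big_sumType /= -big_split big1 //= => j _; ring.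
rewrite E1 E2 E3 E4.
set a := \sum_x f x * g x; set b := \sum_x f x * h x.
(* [g] and [h] are orthogonal and of equal norm, so Cauchy-Schwarz for [f] against [a g + b h] reads
   [(a^2 + b^2)^2 <= |f|^2 (a^2 + b^2) |g|^2]. Dividing by [a^2 + b^2] gives the complex inequality
   with constant 1. *)
pose q x := a * g x + b * h x.
have := sqrCS f q.
have -> : \sum_x f x * q x = a ^+ 2 + b ^+ 2.
  rewrite (eq_bigr (fun x => a * (f x * g x) + b * (f x * h x))); last first.
    by move=> x _; rewrite /q; ring.
  by rewrite big_split /= -!mulr_sumr -/a -/b !expr2.
have -> : \sum_x q x ^+ 2 = (a ^+ 2 + b ^+ 2) * \sum_x g x ^+ 2.
  rewrite (eq_bigr (fun x => a ^+ 2 * g x ^+ 2 + b ^+ 2 * h x ^+ 2 + 2 * a * b * (g x * h x))).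
    by rewrite !big_split /= -!mulr_sumr E6 E5; ring.
  by move=> x _; rewrite /q; ring.
have ab0 : 0 <= a ^+ 2 + b ^+ 2 by rewrite addr_ge0 // sqr_ge0.
have [->|abn] := eqVneq (a ^+ 2 + b ^+ 2) 0.
  by move=> _; rewrite mulr_ge0 //; apply: sumr_ge0 => *; rewrite sqr_ge0.
have abp : 0 < a ^+ 2 + b ^+ 2 by rewrite lt_def abn.
by rewrite expr2 mulrCA ler_pM2l.
Qed.

(* [psd H] records a factorization H = B^* B, so that quadratic forms of H
   are squared Frobenius norms. *)
Definition psd n (H : 'M[C]_n) := exists m (B : 'M[C]_(m, n)), H = B^t* *m B.

Lemma qf_fsq m n p (B : 'M[C]_(m, n)) (X : 'M[C]_(n, p)) :
  qf (B^t* *m B) X = fsq (B *m X).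
Proof. by rewrite !qfE !fsqC adjmxM !mulmxA. Qed.

Lemma qf_ge0 n p (H : 'M[C]_n) (X : 'M[C]_(n, p)) : psd H -> 0 <= qf H X.
Proof. by move=> [m [B ->]]; rewrite qf_fsq fsq_ge0. Qed.

Lemma qfD m n (H G : 'M[C]_m) (X : 'M[C]_(m, n)) : qf (H + G) X = qf H X + qf G X.
Proof. by rewrite !qfE mulmxDr mulmxDl rtrD. Qed.

Lemma qfZ m n a (H : 'M[C]_m) (X : 'M[C]_(m, n)) : qf (a%:C *: H) X = a * qf H X.
Proof. by rewrite !qfE -scalemxAr -scalemxAl rtrZ. Qed.

Lemma qf1 m n (X : 'M[C]_(m, n)) : qf 1%:M X = fsq X.
Proof. by rewrite qfE fsqC mulmx1. Qed.

Lemma psd_adj n (H : 'M[C]_n) : psd H -> H^t* = H.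
Proof. by move=> [m [B ->]]; rewrite adjmxM trmxCK. Qed.

Lemma psd_fsq m n (B : 'M[C]_(m, n)) : psd (B^t* *m B).
Proof. by exists m, B. Qed.

Lemma psdD n (H G : 'M[C]_n) : psd H -> psd G -> psd (H + G).
Proof.
move=> [m [B ->]] [p [D ->]]; exists (m + p)%N, (col_mx B D).
by rewrite tr_col_mx map_row_mx mul_row_col.
Qed.

Lemma psdZ n a (H : 'M[C]_n) : 0 <= a -> psd H -> psd (a%:C *: H).
Proof.
move=> a0 [m [B ->]]; exists m, ((Num.sqrt a)%:C *: B).
by rewrite adjmxZr -scalemxAl -scalemxAr scalerA -rmorphM /= -expr2 sqr_sqrtr.
Qed.

Lemma psd_congr m n (H : 'M[C]_m) (X : 'M[C]_(m, n)) : psd H -> psd (X^t* *m H *m X).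
Proof. by move=> [p [B ->]]; exists p, (B *m X); rewrite adjmxM !mulmxA. Qed.

Lemma psd_conj n (H : 'M[C]_n) : psd H -> psd (map_mx Num.conj H).
Proof.
move=> [m [B ->]]; exists m, (map_mx Num.conj B).
by rewrite map_mxM -map_trmx.
Qed.

Lemma psd0 n : psd (0 : 'M[C]_n).
Proof. by exists 0%N, 0; rewrite mulmx0. Qed.

Lemma psd1 n : psd (1%:M : 'M[C]_n).
Proof. by exists n, 1%:M; rewrite adjmx1 mulmx1. Qed.

Lemma psd_rtr_ge0 n (H : 'M[C]_n) : psd H -> 0 <= rtr H.
Proof. by move=> [m [B ->]]; rewrite -fsqC; exact: fsq_ge0. Qed.

Lemma rtr_conj n (H : 'M[C]_n) : rtr (map_mx Num.conj H) = rtr H.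
Proof. by rewrite -[LHS]rtr_adj -map_trmx -map_mx_comp map_mx_id ?rtrE ?mxtrace_tr // => z; rewrite /= conjCK. Qed.

Lemma qf_le_rtr m n (H : 'M[C]_m) (X : 'M[C]_(m, n)) :
  psd H -> qf H X <= rtr H * fsq X.
Proof. by move=> [p [B ->]]; rewrite qf_fsq -fsqC; exact: fsqM. Qed.

Lemma quad_expand (K : numClosedFieldType) m p (A : 'M[K]_m) (X Z : 'M[K]_(m, p)) :
  A^t* = A -> (X + Z)^t* *m A *m (X + Z) =
  X^t* *m A *m X + Z^t* *m (A *m X) + (Z^t* *m (A *m X))^t* + Z^t* *m A *m Z.
Proof.
move=> Ah; rewrite !trmx_mul !map_mxM trmxCK Ah.
have -> : (X + Z)^t* = X^t* + Z^t* by rewrite linearD /= map_mxD.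
rewrite !mulmxDl !mulmxDr !mulmxA !addrA; congr (_ + _).
by rewrite addrAC.
Qed.

Lemma rtrD4 n (A B D : 'M[C]_n) : rtr (A + B + B^t* + D) = rtr A + rtr D + 2 * rtr B.
Proof. by rewrite !rtrD rtr_adj; ring. Qed.

Lemma qfDvec m p (A : 'M[C]_m) (X Z : 'M[C]_(m, p)) : A^t* = A ->
  qf A (X + Z) = qf A X + qf A Z + 2 * rtr (Z^t* *m (A *m X)).
Proof. by move=> Ah; rewrite qfE quad_expand // rtrD4 !qfE. Qed.

Lemma qf_congr m n p (A : 'M[C]_m) (B : 'M[C]_(m, n)) (X : 'M[C]_(n, p)) :
  qf (B^t* *m A *m B) X = qf A (B *m X).
Proof. by rewrite !qfE adjmxM !mulmxA. Qed.

Lemma qf_sandwich m n p (A : 'M[C]_m) (B : 'M[C]_(n, m)) (X : 'M[C]_(n, p)) :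
  qf (B *m A *m B^t* ) X = qf A (B^t* *m X).
Proof. by rewrite -qf_congr trmxCK. Qed.

Lemma rtr0 n : rtr (0 : 'M[C]_n) = 0.
Proof. by rewrite !rtrE mxtrace0. Qed.

End Adjoint.

(** * Ridge regression *)

Section Ridge.
Variable R : rcfType.
Local Notation C := (Num.ClosedField.sort (complex_complex__canonical__Num_ClosedField R)).
Local Notation Re := complex.Re.

Lemma fsq_eq0 m n (A : 'M[C]_(m, n)) : fsq A = 0 -> A = 0.
Proof.
move=> /eqP; rewrite fsqE => A0; apply/matrixP => i j; rewrite mxE.
have ge0 i' j' : 0 <= Re (A i' j') ^+ 2 + complex.Im (A i' j') ^+ 2.
  by rewrite addr_ge0 // sqr_ge0.
move: A0; rewrite psumr_eq0; last by move=> i' _; apply: sumr_ge0.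
move=> /allP /(_ i (mem_index_enum _)) /implyP /(_ isT).
rewrite psumr_eq0 // => /allP /(_ j (mem_index_enum _)) /implyP /(_ isT).
rewrite paddr_eq0 ?sqr_ge0 // !sqrf_eq0; case: (A i j) => a b /= /andP [/eqP -> /eqP ->].
by [].
Qed.

(** A kernel vector has [G]-energy plus [d] times its squared norm equal to zero, and both terms are
    nonnegative. *)
Lemma ridge_unit n (G : 'M[C]_n) (d : R) : psd G -> 0 < d ->
  G + d%:C%:M \in unitmx.
Proof.
move=> Gp d0; rewrite -row_free_unit -kermx_eq0.
set V := kermx _; have VG : V *m (G + d%:C%:M) = 0 by exact: mulmx_ker.
suff : fsq (V^t*) = 0 by rewrite fsq_adj => /fsq_eq0 ->.
have : qf G (V^t*) + d * fsq (V^t*) = 0.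
  by rewrite -qf1 -qfZ -qfD scalemx1 !qfE trmxCK VG mul0mx rtr0.
have := qf_ge0 (V^t*) Gp; have := fsq_ge0 (V^t*) => f0 q0 /eqP.
rewrite paddr_eq0 ?mulr_ge0 ?(ltW d0) // => /andP [_].
by rewrite mulf_eq0 gt_eqF //= => /eqP.
Qed.

Variables (n l : nat) (H : 'M[C]_n) (d : R) (W : 'M[C]_(n, l)).
Hypotheses (Hp : psd H) (d0 : 0 < d).

(** Ridge regression of the identity on the columns of [W], in the seminorm given by [H]: [coefm] is
    the minimizer of the [cost] defined below, [defect] is the part that is not fitted, and
    [resid = H - H W K W^* H] is a regularized Schur complement. *)
Definition gramd := W^t* *m H *m W + d%:C%:M.
Definition ridge := invmx gramd.
Definition coefm := ridge *m W^t* *m H.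
Definition defect := 1%:M - W *m coefm.
Definition resid := H *m defect.

Lemma gramd_unit : gramd \in unitmx.
Proof. by apply: ridge_unit => //; exact: psd_congr. Qed.

Lemma gramdK : gramd *m ridge = 1%:M.
Proof. exact: mulmxV gramd_unit. Qed.

Lemma Kgramd : ridge *m gramd = 1%:M.
Proof. exact: mulVmx gramd_unit. Qed.

Lemma gramd_adj : gramd^t* = gramd.
Proof.
rewrite /gramd adjmxD !adjmxM trmxCK (psd_adj Hp) -scalemx1 adjmxZr adjmx1.
by rewrite mulmxA.
Qed.

Lemma ridge_adj : ridge^t* = ridge.
Proof.
have : ridge^t* *m gramd = 1%:M.
  by rewrite -{1}gramd_adj -adjmxM gramdK adjmx1.
move=> E; rewrite -[LHS]mulmx1 -gramdK mulmxA E mul1mx //.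
Qed.

Lemma gramd_coefm : gramd *m coefm = W^t* *m H.
Proof. by rewrite /coefm !mulmxA gramdK mul1mx. Qed.

(** These are the normal equations of the ridge problem; for [d = 0] they would say that the
    residual is orthogonal to the columns of [W]. *)
Lemma adjW_resid : W^t* *m resid = d%:C *: coefm.
Proof.
rewrite /resid mulmxA /defect mulmxBr mulmx1 mulmxA -{1}gramd_coefm.
by rewrite /gramd mulmxDl -scalemx1 -scalemxAl mul1mx addrC addKr.
Qed.

Lemma defect_W : defect *m W = d%:C *: (W *m ridge).
Proof.
rewrite /defect mulmxBl mul1mx /coefm -!mulmxA.
have -> : ridge *m (W^t* *m (H *m W)) = 1%:M - d%:C *: ridge.
  rewrite -Kgramd /gramd mulmxDr -scalemx1 -scalemxAr mulmx1.
  by rewrite !mulmxA addrK.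
by rewrite mulmxBr mulmx1 opprB addrC subrK scalemxAr.
Qed.

(** Expand the left factor [defect^*]: its cross term is [coefm^* W^* resid], which the normal
    equations turn into [d coefm^* coefm]. Positivity of the residual and its reading as a minimal
    cost both come from here. *)
Lemma resid_cost : resid = defect^t* *m H *m defect + d%:C *: (coefm^t* *m coefm).
Proof.
rewrite -[defect^t* *m H *m _]mulmxA -/resid /defect adjmxB adjmx1 mulmxBl mul1mx.
by rewrite adjmxM -mulmxA adjW_resid -scalemxAr subrK.
Qed.

Lemma resid_psd : psd resid.
Proof.
rewrite resid_cost; apply: psdD; first exact: psd_congr.
by apply: psdZ; [exact: ltW|exact: psd_fsq].
Qed.

Definition cost (A : 'M[C]_n) (Y : 'M[C]_(l, n)) : R :=
  qf A (1%:M - W *m Y) + d * fsq Y.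

Lemma rtr_resid : rtr resid = cost H coefm.
Proof. by rewrite {1}resid_cost rtrD rtrZ /cost qfE fsqC. Qed.

(** Around [coefm] the cost has no linear term, since the cross terms of its two squares cancel by
    [adjW_resid]; what remains is a sum of squares. *)
Lemma cost_min Y : rtr resid <= cost H Y.
Proof.
rewrite rtr_resid; set Z := Y - coefm.
have YE : Y = coefm + Z by rewrite addrC subrK.
have E0 : qf H (1%:M - W *m Y) =
    qf H defect + qf H (- (W *m Z)) + 2 * rtr ((- (W *m Z))^t* *m (H *m defect)).
  have -> : 1%:M - W *m Y = defect - W *m Z by rewrite YE mulmxDr opprD addrA.
  exact: qfDvec (psd_adj Hp).
have -> : cost H coefm = qf H defect + d * fsq coefm by [].
rewrite /cost E0.
have -> : fsq Y = fsq coefm + fsq Z + 2 * rtr (coefm^t* *m Z) by rewrite YE fsqD.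
have E1 : (- (W *m Z))^t* *m (H *m defect) = - (d%:C *: (Z^t* *m coefm)).
  by rewrite adjmxN mulNmx adjmxM -mulmxA adjW_resid -scalemxAr.
have -> : rtr ((- (W *m Z))^t* *m (H *m defect)) = - (d * rtr (Z^t* *m coefm)).
  by apply: (etrans (congr1 (@rtr _ _) E1)); rewrite rtrN rtrZ.
have -> : rtr (Z^t* *m coefm) = rtr (coefm^t* *m Z).
  by apply: etrans (esym (rtr_adj _)) _; rewrite adjmxM trmxCK.
have := qf_ge0 (- (W *m Z)) Hp; have := mulr_ge0 (ltW d0) (fsq_ge0 Z).
clear; move: (fsq Z) (fsq coefm) (rtr _) => a b c.
move: (qf H _) => e; move: (qf H _) => f; nra.
Qed.

Lemma rtr_resid_le : rtr resid <= rtr H.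
Proof.
apply: le_trans (cost_min 0) _.
by rewrite /cost mulmx0 subr0 !qfE adjmx1 mul1mx mulmx1 fsqC mulmx0 rtr0 mulr0 addr0.
Qed.

(** From [K gramd K = K] follows [d |K|^2 <= tr K], while Young's inequality gives
    [2 tr K <= l / d + d |K|^2]. The bound is uniform in [W], so everything built from the ridge
    inverse grows polynomially. *)
Lemma fsq_ridge : fsq ridge <= l%:R / d ^+ 2.
Proof.
have E : rtr (ridge^t* *m gramd *m ridge) = rtr ridge.
  by rewrite -mulmxA gramdK mulmx1 rtr_adj.
have E2 : qf (W^t* *m H *m W) ridge + d * fsq ridge = rtr ridge.
  by rewrite -E -qf1 -qfZ -qfD !qfE scalemx1.
have := qf_ge0 ridge (psd_congr W Hp).
have di0 : 0 < d^-1 by rewrite invr_gt0.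
have := rtr_AMGM (1%:M : 'M[C]_l) ridge di0.
rewrite adjmx1 mul1mx invrK fsq1 => h1 h2.
have h3 : d * fsq ridge <= d^-1 * l%:R by lra.
by rewrite expr2 invfM mulrA mulrAC ler_pdivlMr // mulrC [l%:R / d]mulrC.
Qed.

Lemma ridge_psd : psd ridge.
Proof.
have -> : ridge = ridge^t* *m (gramd *m ridge) by rewrite gramdK mulmx1 ridge_adj.
rewrite /gramd mulmxDl mulmxDr -scalemx1 -scalemxAl mul1mx -scalemxAr [X in X + _]mulmxA.
apply: psdD; first by apply: psd_congr; exact: psd_congr.
by apply: psdZ; [exact: ltW|exact: psd_fsq].
Qed.

End Ridge.

(** * Trace bounds for the ridge inverse and the residual *)

Section Bounds.
Variable R : rcfType.
Local Notation C := (Num.ClosedField.sort (complex_complex__canonical__Num_ClosedField R)).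

(** [N K N^*] is a [k] by [k] matrix with eigenvalues at most 1. Concretely, [Z = K N^*] satisfies
    [|N Z|^2 <= tr (N Z)] and [2 tr (N Z) <= k + |N Z|^2]. *)
Lemma rtr_ridge_rank k l (N : 'M[C]_(k, l)) (G K : 'M[C]_l) :
  psd G -> K^t* = K -> (N^t* *m N + G) *m K = 1%:M ->
  rtr (K *m (N^t* *m N)) <= k%:R.
Proof.
move=> Gp Kh GK.
rewrite mulmxA rtr_mulC; set Z := K *m N^t*.
have E : qf (N^t* *m N + G) Z = rtr (N *m Z).
  have GZ : (N^t* *m N + G) *m Z = N^t* by rewrite /Z mulmxA GK mul1mx.
  by rewrite !qfE -mulmxA GZ /Z adjmxM trmxCK Kh mulmxA.
have := qf_ge0 Z Gp; have := rtr_AMGM (1%:M : 'M[C]_k) (N *m Z) ltr01.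
rewrite adjmx1 mul1mx invr1 !mul1r -E qfD qf_fsq fsq1.
by move: (fsq (N *m Z)) (qf G Z) => a b; lra.
Qed.

(** With [A = B^* B], Young's inequality applies to [B X] and [B conj X]; conjugating the norm of
    the latter moves the bar onto [A]. The price is a form of [conj A] at [X], over which [A] itself
    gives no control. *)
Lemma rtr_bilinear_le n p (A : 'M[C]_n) (X : 'M[C]_(n, p)) : psd A ->
  2 * rtr (X^t* *m A *m map_mx Num.conj X) <= qf A X + qf (map_mx Num.conj A) X.
Proof.
move=> [m [B ->]].
have -> : map_mx Num.conj (B^t* *m B) = (map_mx Num.conj B)^t* *m map_mx Num.conj B.
  by rewrite map_mxM -map_trmx.
rewrite !qf_fsq.
have -> : fsq (map_mx Num.conj B *m X) = fsq (B *m map_mx Num.conj X).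
  rewrite -fsq_conj map_mxM; congr (fsq (_ *m _)).
  by rewrite -map_mx_comp map_mx_id // => z; rewrite /= conjCK.
have := rtr_AMGM (B *m X) (B *m map_mx Num.conj X) ltr01.
by rewrite invr1 !mul1r adjmxM !mulmxA.
Qed.

Variables (n l : nat) (W : 'M[C]_(n, l)) (d : R).
Hypothesis d0 : 0 < d.

(** The trace of [K gramd] is [l]. The head [lam V1 V1^*] takes at most [k] of it, by rank and
    whatever the size of [lam], and the ridge term takes [d tr K]; the tail [H2] gets the rest. *)
Lemma rtr_ridge_tail k (V1 : 'M[C]_(n, k)) (H2 : 'M[C]_n) (lam : R) :
  0 <= lam -> psd H2 -> let H := lam%:C *: (V1 *m V1^t*) + H2 in
  (l%:R - k%:R - d * rtr (ridge H d W) <= rtr (ridge H d W *m (W^t* *m H2 *m W)) : Prop).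
Proof.
move=> l0 Hp H.
have Hpsd : psd H.
  by apply: psdD => //; apply: psdZ => //; exists k, (V1^t*); rewrite trmxCK.
pose N := (Num.sqrt lam)%:C *: (V1^t* *m W).
have EN : N^t* *m N = W^t* *m (lam%:C *: (V1 *m V1^t*)) *m W.
  rewrite /N adjmxZr -scalemxAl -scalemxAr scalerA -rmorphM -expr2 sqr_sqrtr //.
  by rewrite adjmxM trmxCK -scalemxAr -scalemxAl !mulmxA.
have EG : gramd H d W = N^t* *m N + (W^t* *m H2 *m W + d%:C%:M).
  by rewrite /gramd /H EN mulmxDr mulmxDl addrA.
have GP : psd (W^t* *m H2 *m W + d%:C%:M).
  apply: psdD; first exact: psd_congr.
  by rewrite -scalemx1; apply: psdZ; [exact: ltW|exact: psd1].
have := @rtr_ridge_rank k l N _ (ridge H d W) GP (ridge_adj W Hpsd d0).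
rewrite -EG gramdK // => /(_ erefl) h; clearbody N.
have : rtr (ridge H d W *m gramd H d W) = l%:R by rewrite Kgramd // rtr1.
rewrite EG mulmxDr rtrD mulmxDr rtrD -scalemx1 -scalemxAr mulmx1 rtrZ => h2.
by move: h h2; move: (rtr _) (rtr _) (rtr _) => a b c; lra.
Qed.

(** The bound does not involve [d], so [d tr K] vanishes with [d] at every [W] of full column rank.
    It combines [b |W K|^2 <= tr K] with Young's inequality for [tr K = tr (Z0 W K)]. *)
Lemma rtr_ridge_left_inv (H' : 'M[C]_n) (b : R) (Z0 : 'M[C]_(l, n)) :
  0 < b -> psd H' -> Z0 *m W = 1%:M ->
  rtr (ridge (b%:C%:M + H') d W) <= fsq Z0 / b.
Proof.
move=> b0 Hp ZW; set H := _ + H'.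
have Hpsd : psd H.
  by apply: psdD => //; rewrite -scalemx1; apply: psdZ; [exact: ltW|exact: psd1].
set K := ridge H d W; set X := Z0^t*; set U := K *m (W^t* *m X).
have WX : W^t* *m X = 1%:M by rewrite /X -adjmxM ZW adjmx1.
have UE : U = K by rewrite /U WX mulmx1.
have E : qf (gramd H d W) U = rtr (X^t* *m (W *m U)).
  have GU : gramd H d W *m U = W^t* *m X by rewrite /U mulmxA gramdK // mul1mx.
  by rewrite !qfE -mulmxA GU -rtr_adj !adjmxM !trmxCK !mulmxA.
have E2 : rtr K = rtr (X^t* *m (W *m U)).
  by rewrite -[LHS]rtr_adj UE mulmxA /X trmxCK ZW mul1mx rtr_adj.
have E3 : qf (gramd H d W) U = b * fsq (W *m U) + qf H' (W *m U) + d * fsq U.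
  rewrite /gramd qfD qf_congr -(scalemx1 _ d%:C) (qfZ d) (qf1 U).
  by rewrite /H qfD -scalemx1 qfZ qf1.
have := qf_ge0 (W *m U) Hp; have := mulr_ge0 (ltW d0) (fsq_ge0 U).
have bi0 : 0 < b^-1 by rewrite invr_gt0.
have := rtr_AMGM X (W *m U) bi0.
rewrite invrK fsq_adj -E2 [fsq Z0 / b]mulrC; move: E; rewrite E3 -E2.
by move: (rtr K) (fsq _) (fsq _) (fsq _) (qf _ _) => a1 a2 a3 a4 a5; lra.
Qed.

(** [Y] is a competitor in [cost_min] whose fit is exact, so only the penalty is left. *)
Lemma rtr_resid_right_inv (H : 'M[C]_n) (Y : 'M[C]_(l, n)) :
  psd H -> W *m Y = 1%:M -> rtr (resid H d W) <= d * fsq Y.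
Proof.
move=> Hp WY; apply: le_trans (cost_min W Hp d0 Y) _.
by rewrite /cost WY subrr !qfE mulmx0 rtr0 add0r.
Qed.

(** By cyclicity of the trace [P1 H2 = 0] removes the [lam] part of [H], and the amount subtracted
    from [tr H2] becomes [tr (H2 W K W^* H2) >= 0]. *)
Lemma rtr_tail_defect (P1 H2 : 'M[C]_n) (lam : R) :
  psd P1 -> psd H2 -> 0 <= lam -> P1 *m H2 = 0 ->
  rtr (H2 *m defect (lam%:C *: P1 + H2) d W) <= rtr H2.
Proof.
move=> Pp Hp l0 PH; set H := _ + _.
have Hpsd : psd H by apply: psdD => //; exact: psdZ.
rewrite /defect mulmxBr mulmx1 rtrB /coefm lerBlDr lerDl.
rewrite {2}/H mulmxDr !mulmxDr rtrD -!scalemxAr rtrZ.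
have -> : rtr (H2 *m (W *m (ridge H d W *m W^t* *m P1))) = 0.
  by rewrite !mulmxA rtr_mulC !mulmxA PH !mul0mx rtr0.
rewrite mulr0 add0r.
have -> : H2 *m (W *m (ridge H d W *m W^t* *m H2)) =
          (W^t* *m H2)^t* *m ridge H d W *m (W^t* *m H2).
  by rewrite adjmxM trmxCK (psd_adj Hp) !mulmxA.
exact/psd_rtr_ge0/psd_congr/ridge_psd.
Qed.

End Bounds.

(** * Divergence of the Stein field *)

Section Divergence.
Variable K : numClosedFieldType.
Local Notation cj := (map_mx Num.conj).

Lemma mul_delta_entry a b c e (P : 'M[K]_(a, b)) (Q : 'M[K]_(c, e)) i j x y :
  (P *m delta_mx i j *m Q) x y = P x i * Q j y.
Proof.
rewrite mxE (bigD1 j) //= big1 ?addr0 => [|k kj].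
  rewrite mxE (bigD1 i) //= big1 ?addr0 ?mxE ?eqxx ?mulr1 // => k ki.
  by rewrite mxE (negbTE ki) mulr0.
by rewrite mxE big1 ?mul0r // => m _; rewrite mxE (negbTE kj) andbF mulr0.
Qed.

Lemma sum_mul_delta n l (P : 'M[K]_n) (Q : 'M[K]_l) :
  \sum_i \sum_j (P *m delta_mx i j *m Q) i j = \tr P * \tr Q.
Proof.
rewrite /mxtrace mulr_suml; apply: eq_bigr => i _; rewrite mulr_sumr.
by apply: eq_bigr => j _; rewrite mul_delta_entry.
Qed.

(** As [W] is real, differentiating [W^*] along [delta_mx i j] gives [delta_mx j i]. The sum then
    yields a transpose rather than an adjoint, which is the source of the conjugate term in the
    divergence. *)
Lemma sum_mul_deltaT n l (P Q : 'M[K]_(n, l)) :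
  \sum_i \sum_j (P *m delta_mx j i *m Q) i j = \tr (P^T *m Q).
Proof.
rewrite exchange_big; apply: eq_bigr => j _; rewrite mxE.
by apply: eq_bigr => i _; rewrite mul_delta_entry mxE.
Qed.

(** The left side is the raw product rule for [1 - W K W^* H] in the direction [E], with [G] in the
    role of [K]; the right side regroups it around [Xi]. *)
Lemma defect_derivative n l (W E : 'M[K]_(n, l)) (H : 'M[K]_n) (G : 'M[K]_l) :
  let Y := G *m W^t* *m H in let Xi := 1%:M - W *m Y in
  - (E *m Y + W *m ((- (G *m (E^t* *m H *m W + W^t* *m H *m E) *m G) *m W^t* +
                    G *m E^t* ) *m H)) =
  - (Xi *m E *m Y) - W *m G *m E^t* *m (H *m Xi).
Proof.
move=> Y Xi.
have YE : G *m W^t* *m H = Y by [].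
rewrite [in LHS](mulmxDl _ _ H) mulNmx mulNmx -[in LHS](mulmxA _ (W^t* ) H).
have -> : G *m (E^t* *m H *m W + W^t* *m H *m E) *m G *m (W^t* *m H) =
          G *m E^t* *m H *m W *m Y + Y *m E *m Y.
  by rewrite -YE mulmxDr !mulmxDl !mulmxA.
clearbody Y; clear YE.
rewrite /Xi !mulmxBl !mulmxBr !mul1mx !mulmxDr !mulmxN !mulmx1 !mulmxA !mulmxDr !mulmxA.
rewrite !opprB !opprD !opprK.
set a := E *m Y; set b := W *m Y *m E *m Y; set c := W *m G *m _ *m H.
rewrite (addrC _ b) -[b + _ - c]addrA [LHS]addrA; congr (_ + _); exact: addrC.
Qed.

Lemma adj_defect_derivative n l (W E : 'M[K]_(n, l)) (D Rm : 'M[K]_n) (Y : 'M[K]_(l, n)) (G : 'M[K]_l) :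
  Rm^t* = Rm -> G^t* = G ->
  (- (D *m E *m Y) - W *m G *m E^t* *m Rm)^t* =
  - (Y^t* *m E^t* *m D^t* ) - Rm *m E *m (G *m W^t* ).
Proof.
move=> hR hG; rewrite linearB linearN /= map_mxB map_mxN !trmx_mul !map_mxM.
by rewrite hR hG trmxCK !mulmxA.
Qed.

Lemma mulmx_scale_shift n l (c : K) (X : 'M[K]_(l, n)) (D A : 'M[K]_n) (G : 'M[K]_l) (W : 'M[K]_(n, l)) :
  X *m D = c *: (G *m X) -> X *m (D *m A *m W) = c *: (G *m (X *m A *m W)).
Proof. by move=> h; rewrite !mulmxA h -!scalemxAl. Qed.

Lemma unitary_defect n (V a e X : 'M[K]_n) : V^t* *m V = 1%:M ->
  V^t* *m (1%:M - V *m a *m V^t* *m (1%:M - X) *m (V *m e *m V^t* )) =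
  (1%:M - a *m (1%:M - V^t* *m X *m V) *m e) *m V^t*.
Proof.
move=> Vu; rewrite mulmxBr mulmx1 mulmxBl mul1mx; congr (_ - _).
have -> : 1%:M - V^t* *m X *m V = V^t* *m (1%:M - X) *m V.
  by rewrite mulmxBr mulmxBl mulmx1 Vu.
by rewrite !mulmxA Vu mul1mx.
Qed.

Lemma sandwich_step n l (V D E : 'M[K]_n) (N : 'M[K]_(n, l)) : V^t* *m V = 1%:M ->
  (V *m D *m V^t* ) *m (V *m E *m V^t* *m N) = V *m (D *m E) *m V^t* *m N.
Proof. by move=> Vu; rewrite !mulmxA -(mulmxA (V *m D)) Vu mulmx1. Qed.

Lemma scale_sandwichD m n (c : K) (V : 'M[K]_(m, n)) (D E : 'M[K]_n) (V' : 'M[K]_(n, m)) :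
  c *: (V *m D *m V') + V *m E *m V' = V *m (c *: D + E) *m V'.
Proof. by rewrite mulmxDr mulmxDl -scalemxAr -scalemxAl. Qed.

(** The summand is the derivative of the field [Xi^* A W]. Differentiating [W] gives
    [l tr (Xi^* A)]. Differentiating [Xi^*] gives a product of two traces and a transposed term, in
    which [conj (W Y) = 1 - conj Xi] costs one [tr (Xi^* A)] and creates the conjugate term. *)
Lemma divergence_trace n l (W Y' : 'M[K]_(n, l)) (Y : 'M[K]_(l, n)) (A Rm : 'M[K]_n) (G : 'M[K]_l) :
  cj W = W -> Y' = Y^t* -> let Xi := 1%:M - W *m Y in
  \sum_i \sum_j
    ((- (Y' *m delta_mx j i *m Xi^t* ) - Rm *m delta_mx i j *m (G *m W^t* )) *m A *m W +
     Xi^t* *m A *m delta_mx i j) i j =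
  l%:R * \tr (Xi^t* *m A) - \tr (Xi^t* *m A) + \tr (Xi^t* *m A *m cj Xi)
  - \tr Rm * \tr (G *m (W^t* *m A *m W)).
Proof.
move=> Wr -> Xi.
have E i j : ((- (Y^t* *m delta_mx j i *m Xi^t* ) - Rm *m delta_mx i j *m (G *m W^t* )) *m A *m W +
     Xi^t* *m A *m delta_mx i j) i j =
  - (Y^t* *m delta_mx j i *m (Xi^t* *m A *m W)) i j
  - (Rm *m delta_mx i j *m (G *m (W^t* *m A *m W))) i j
  + (Xi^t* *m A *m delta_mx i j *m (1%:M : 'M[K]_l)) i j.
  rewrite mulmx1 mulmxBl mulmxBl !mulNmx !mulmxA.
  rewrite [LHS]mxE; congr (_ + _); rewrite [LHS]mxE; congr (_ + _); exact: mxE.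
under eq_bigr => i _ do [under eq_bigr => j _ do rewrite E; rewrite big_split /= big_split /= !sumrN].
rewrite big_split /= big_split /= !sumrN sum_mul_deltaT !sum_mul_delta mxtrace1.
have -> : \tr ((Y^t* )^T *m (Xi^t* *m A *m W)) = \tr (Xi^t* *m A) - \tr (Xi^t* *m A *m cj Xi).
  have -> : (Y^t* )^T = cj Y by rewrite map_trmx trmxK.
  rewrite mxtrace_mulC -(mulmxA _ W) (_ : W *m cj Y = cj (W *m Y)); last by rewrite map_mxM Wr.
  have -> : W *m Y = 1%:M - Xi by rewrite /Xi opprB addrC subrK.
  by rewrite map_mxB map_mx1 mulmxBr mulmx1 raddfB.
by rewrite [_ * l%:R]mulrC; ring.
Qed.

End Divergence.

(** * Differentiation along real directions *)

Section RegularFunctions.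
Variable R : realType.
Local Notation C := (Num.ClosedField.sort (complex_complex__canonical__Num_ClosedField R)).
Local Notation Re := (@complex.Re R).
Local Notation Im := (@complex.Im R).

Lemma cReD (x y : C) : Re (x + y) = Re x + Re y.
Proof. by case: x y => [a b] [c e]. Qed.
Lemma cImD (x y : C) : Im (x + y) = Im x + Im y.
Proof. by case: x y => [a b] [c e]. Qed.
Lemma cReN (x : C) : Re (- x) = - Re x.
Proof. by case: x. Qed.
Lemma cImN (x : C) : Im (- x) = - Im x.
Proof. by case: x. Qed.
Lemma cReM (x y : C) : Re (x * y) = Re x * Re y - Im x * Im y.
Proof. by case: x y => [a b] [c e]. Qed.
Lemma cImM (x y : C) : Im (x * y) = Re x * Im y + Im x * Re y.
Proof. by case: x y => [a b] [c e]. Qed.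
Lemma cReV (x : C) : Re x^-1 = Re x / (Re x ^+ 2 + Im x ^+ 2).
Proof. by case: x. Qed.
Lemma cImV (x : C) : Im x^-1 = - Im x / (Re x ^+ 2 + Im x ^+ 2).
Proof. by case: x => a b /=; rewrite mulNr. Qed.
Lemma cReJ (x : C) : Re (x^*%R) = Re x.
Proof. by rewrite conjCE; case: x. Qed.
Lemma cImJ (x : C) : Im (x^*%R) = - Im x.
Proof. by rewrite conjCE; case: x. Qed.

Lemma normsq_gt0 (x : C) : x != 0 -> 0 < Re x ^+ 2 + Im x ^+ 2.
Proof.
move=> x0; rewrite lt_def addr_ge0 ?sqr_ge0 // andbT.
apply: contra x0; rewrite paddr_eq0 ?sqr_ge0 // !sqrf_eq0.
by case: x => a b /= /andP [/eqP -> /eqP ->].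
Qed.

Lemma ceqP (x y : C) : Re x = Re y -> Im x = Im y -> x = y.
Proof. by case: x y => [a b] [c e] /= -> ->. Qed.

Variables n l : nat.
Local Notation V := 'M[R]_(n, l).
Implicit Types (f g : V -> C) (M E : V).

(** The functions involved contain conjugations and are not holomorphic, so real and imaginary parts
    are differentiated separately along a real line. *)
Definition is_cder f M E (z : C) :=
  is_derive (0 : R) (1 : R) (fun x : R => Re (f (M + x *: E))) (Re z) /\
  is_derive (0 : R) (1 : R) (fun x : R => Im (f (M + x *: E))) (Im z).

Lemma is_cder_unique f M E z z' : is_cder f M E z -> is_cder f M E z' -> z = z'.
Proof.
by move=> [h1 h2] [h3 h4]; apply: ceqP; [case: h1 h3|case: h2 h4] => _ <- [_ <-].
Qed.

Lemma is_cder_cst c M E : is_cder (fun=> c) M E 0.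
Proof. by split; exact: is_derive_cst. Qed.

Lemma is_cderD f g M E z w : is_cder f M E z -> is_cder g M E w ->
  is_cder (fun M => f M + g M) M E (z + w).
Proof.
move=> [h1 h2] [h3 h4]; split.
- under eq_fun do rewrite cReD; rewrite cReD; exact: is_deriveD.
- under eq_fun do rewrite cImD; rewrite cImD; exact: is_deriveD.
Qed.

Lemma is_cderN f M E z : is_cder f M E z -> is_cder (fun M => - f M) M E (- z).
Proof.
move=> [h1 h2]; split.
- under eq_fun do rewrite cReN; rewrite cReN; exact: is_deriveN.
- under eq_fun do rewrite cImN; rewrite cImN; exact: is_deriveN.
Qed.

Lemma is_cder_conj f M E z : is_cder f M E z ->
  is_cder (fun M => (f M)^*%R) M E (z^*%R).
Proof.
move=> [h1 h2]; split.
- by under eq_fun do rewrite cReJ; rewrite cReJ.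
- under eq_fun do rewrite cImJ; rewrite cImJ; exact: is_deriveN.
Qed.

Lemma is_cderM f g M E z w : is_cder f M E z -> is_cder g M E w ->
  is_cder (fun M => f M * g M) M E (z * g M + f M * w).
Proof.
move=> [h1 h2] [h3 h4]; have E0 : M + 0 *: E = M by rewrite scale0r addr0.
split.
- under eq_fun do rewrite cReM.
  apply: (is_derive_eq (is_deriveB (is_deriveM h1 h3) (is_deriveM h2 h4))).
  by rewrite /= E0 cReD !cReM /GRing.scale /=; ring.
- under eq_fun do rewrite cImM.
  apply: (is_derive_eq (is_deriveD (is_deriveM h1 h4) (is_deriveM h2 h3))).
  by rewrite /= E0 cImD !cImM /GRing.scale /=; ring.
Qed.

Definition cderivable f := forall M E, exists z, is_cder f M E z.

(** Existence of a derivative suffices: the value for an inverse matrix is recovered in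
    [is_mder_inv]. *)
Lemma cderivableV f : cderivable f -> (forall M, f M != 0) ->
  cderivable (fun M => (f M)^-1).
Proof.
move=> df f0 M E; have [z [h1 h2]] := df M E.
pose N x := Re (f (M + x *: E)) ^+ 2 + Im (f (M + x *: E)) ^+ 2.
have N0 x : N x != 0 by rewrite gt_eqF // normsq_gt0.
have d1 : derivable (fun x : R => Re (f (M + x *: E))) 0 1 by case: h1.
have d2 : derivable (fun x : R => Im (f (M + x *: E))) 0 1 by case: h2.
have dN : derivable N (0 : R) (1 : R).
  have -> : N = (fun x : R => Re (f (M + x *: E))) * (fun x : R => Re (f (M + x *: E))) +
                (fun x : R => Im (f (M + x *: E))) * (fun x : R => Im (f (M + x *: E))).
    by apply/funext => x; rewrite /N !expr2.
  exact: derivableD (derivableM d1 d1) (derivableM d2 d2).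
have dV : derivable (fun x => (N x)^-1) (0 : R) (1 : R) by exact: (derivableV (N0 0) dN).
have r1 : derivable (fun x : R => Re ((f (M + x *: E))^-1)) 0 1.
  under eq_fun do rewrite cReV.
  exact: (derivableM d1 dV).
have r2 : derivable (fun x : R => Im ((f (M + x *: E))^-1)) 0 1.
  under eq_fun do rewrite cImV.
  exact: (derivableM (derivableN d2) dV).
exists ('D_1 (fun x : R => Re ((f (M + x *: E))^-1)) 0 +i*
        'D_1 (fun x : R => Im ((f (M + x *: E))^-1)) 0).
by split; exact: derivableP.
Qed.

(* Measurability of f along every measurable random matrix, which avoids
   choosing a sigma-algebra on matrices. *)
Definition umeas (f : V -> R) := forall d (T : measurableType d) (W : T -> V),
  (forall i j, measurable_fun [set: T] (fun t => W t i j)) ->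
  measurable_fun [set: T] (f \o W).

Definition cmeas f := umeas (Re \o f) /\ umeas (Im \o f).

Definition reg f := cmeas f /\ cderivable f.

Lemma umeas_cst (c : R) : umeas (fun=> c).
Proof. by move=> d T W _; exact: measurable_cst. Qed.
Lemma umeasD (f g : V -> R) : umeas f -> umeas g -> umeas (fun M => f M + g M).
Proof. by move=> mf mg d T W mW; apply: measurable_funD; [exact: mf|exact: mg]. Qed.
Lemma umeasN (f : V -> R) : umeas f -> umeas (fun M => - f M).
Proof. by move=> mf d T W mW; apply: measurableT_comp => //; exact: mf. Qed.
Lemma umeasM (f g : V -> R) : umeas f -> umeas g -> umeas (fun M => f M * g M).
Proof. by move=> mf mg d T W mW; apply: measurable_funM; [exact: mf|exact: mg]. Qed.
Lemma umeasV (f : V -> R) : umeas f -> (forall M, 0 < f M) -> umeas (fun M => (f M)^-1).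
Proof.
move=> mf f0 d T W mW.
have -> : (fun M => (f M)^-1) \o W = (fun x : R => x `^ (-1)) \o (f \o W).
  by apply/funext => t /=; rewrite powR_inv1 // ltW.
by apply: measurableT_comp; [exact: measurable_powR|exact: mf].
Qed.
Lemma eq_umeas (f g : V -> R) : f =1 g -> umeas f -> umeas g.
Proof. by move=> /funext ->. Qed.

Lemma reg_cst c : reg (fun=> c).
Proof.
split; first by split; exact: umeas_cst.
by move=> M E; exists 0; exact: is_cder_cst.
Qed.

Lemma regD f g : reg f -> reg g -> reg (fun M => f M + g M).
Proof.
move=> [[m1 m2] d1] [[m3 m4] d2]; split; first split.
- by apply: eq_umeas (umeasD m1 m3) => M /=; rewrite cReD.
- by apply: eq_umeas (umeasD m2 m4) => M /=; rewrite cImD.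
- by move=> M E; have [[z hz] [w hw]] := (d1 M E, d2 M E); exists (z + w); exact: is_cderD.
Qed.

Lemma regN f : reg f -> reg (fun M => - f M).
Proof.
move=> [[m1 m2] d1]; split; first split.
- by apply: eq_umeas (umeasN m1) => M /=; rewrite cReN.
- by apply: eq_umeas (umeasN m2) => M /=; rewrite cImN.
- by move=> M E; have [z hz] := d1 M E; exists (- z); exact: is_cderN.
Qed.

Lemma regJ f : reg f -> reg (fun M => (f M)^*%R).
Proof.
move=> [[m1 m2] d1]; split; first split.
- by apply: eq_umeas m1 => M /=; rewrite cReJ.
- by apply: eq_umeas (umeasN m2) => M /=; rewrite cImJ.
- by move=> M E; have [z hz] := d1 M E; exists (z^*%R); exact: is_cder_conj.
Qed.

Lemma regM f g : reg f -> reg g -> reg (fun M => f M * g M).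
Proof.
move=> [[m1 m2] d1] [[m3 m4] d2]; split; first split.
- by apply: eq_umeas (umeasD (umeasM m1 m3) (umeasN (umeasM m2 m4))) => M /=; rewrite cReM.
- by apply: eq_umeas (umeasD (umeasM m1 m4) (umeasM m2 m3)) => M /=; rewrite cImM.
- move=> M E; have [[z hz] [w hw]] := (d1 M E, d2 M E).
  by exists (z * g M + f M * w); exact: is_cderM.
Qed.

Lemma regV f : reg f -> (forall M, f M != 0) -> reg (fun M => (f M)^-1).
Proof.
move=> [[m1 m2] d1] f0; split; last exact: cderivableV.
have mN : umeas (fun M => (Re (f M) ^+ 2 + Im (f M) ^+ 2)^-1).
  apply: umeasV; last by move=> M; exact: normsq_gt0.
  apply: eq_umeas (umeasD (umeasM m1 m1) (umeasM m2 m2)) => M /=.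
  by rewrite !expr2.
split.
- by apply: eq_umeas (umeasM m1 mN) => M /=; rewrite cReV.
- by apply: eq_umeas (umeasM (umeasN m2) mN) => M /=; rewrite cImV.
Qed.

Lemma reg_sum (I : Type) (s : seq I) (Q : pred I) (F : I -> V -> C) :
  (forall i, reg (F i)) -> reg (fun M => \sum_(i <- s | Q i) F i M).
Proof.
move=> rF; elim: s => [|i s IH].
  by under eq_fun do rewrite big_nil; exact: reg_cst.
under eq_fun do rewrite big_cons.
by case: (Q i) => //; exact: regD.
Qed.

Lemma reg_prod (I : Type) (s : seq I) (Q : pred I) (F : I -> V -> C) :
  (forall i, reg (F i)) -> reg (fun M => \prod_(i <- s | Q i) F i M).
Proof.
move=> rF; elim: s => [|i s IH].
  by under eq_fun do rewrite big_nil; exact: reg_cst.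
under eq_fun do rewrite big_cons.
by case: (Q i) => //; exact: regM.
Qed.

Definition mreg a b (F : V -> 'M[C]_(a, b)) := forall i j, reg (fun M => F M i j).

Definition is_mder a b (F : V -> 'M[C]_(a, b)) M E (Z : 'M[C]_(a, b)) :=
  forall i j, is_cder (fun M => F M i j) M E (Z i j).

Lemma mreg_cst a b (A : 'M[C]_(a, b)) : mreg (fun=> A).
Proof. by move=> i j; exact: reg_cst. Qed.

Lemma mregD a b (F G : V -> 'M[C]_(a, b)) : mreg F -> mreg G -> mreg (fun M => F M + G M).
Proof. by move=> rF rG i j; under eq_fun do rewrite mxE; exact: regD. Qed.

Lemma mregN a b (F : V -> 'M[C]_(a, b)) : mreg F -> mreg (fun M => - F M).
Proof. by move=> rF i j; under eq_fun do rewrite mxE; exact: regN. Qed.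

Lemma mregM a b c (F : V -> 'M[C]_(a, b)) (G : V -> 'M[C]_(b, c)) :
  mreg F -> mreg G -> mreg (fun M => F M *m G M).
Proof.
by move=> rF rG i j; under eq_fun do rewrite mxE; apply: reg_sum => k; exact: regM.
Qed.

Lemma mreg_adj a b (F : V -> 'M[C]_(a, b)) : mreg F -> mreg (fun M => (F M)^t*).
Proof. by move=> rF i j; under eq_fun do rewrite !mxE; exact: regJ. Qed.

Lemma mregJ a b (F : V -> 'M[C]_(a, b)) : mreg F -> mreg (fun M => map_mx Num.conj (F M)).
Proof. by move=> rF i j; under eq_fun do rewrite !mxE; exact: regJ. Qed.

Lemma reg_det a (F : V -> 'M[C]_a) : mreg F -> reg (fun M => \det (F M)).
Proof.
move=> rF; rewrite /determinant; apply: reg_sum => s.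
by apply: regM; [exact: reg_cst|exact: reg_prod].
Qed.

Lemma mreg_inv a (F : V -> 'M[C]_a) : mreg F -> (forall M, F M \in unitmx) ->
  mreg (fun M => invmx (F M)).
Proof.
move=> rF uF i j.
have -> : (fun M => invmx (F M) i j) =
          (fun M => (\det (F M))^-1 * cofactor (F M) j i).
  by apply/funext => M; rewrite /invmx uF !mxE.
apply: regM.
  apply: regV; first exact: reg_det.
  by move=> M; have := uF M; rewrite unitmxE unitfE.
rewrite /cofactor; apply: regM; first exact: reg_cst.
by apply: reg_det => i' j'; under eq_fun do rewrite !mxE; exact: rF.
Qed.

Lemma is_mder_unique a b (F : V -> 'M[C]_(a, b)) M E Z Z' :
  is_mder F M E Z -> is_mder F M E Z' -> Z = Z'.
Proof. by move=> h h'; apply/matrixP => i j; exact: is_cder_unique (h i j) (h' i j). Qed.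

Lemma mreg_is_mder a b (F : V -> 'M[C]_(a, b)) M E : mreg F -> exists Z, is_mder F M E Z.
Proof.
move=> rF; have h i j : {z | is_cder (fun M => F M i j) M E z}.
  by apply: cid; have [_] := rF i j; apply.
by exists (\matrix_(i, j) sval (h i j)) => i j; rewrite mxE; exact: svalP.
Qed.

Lemma is_mder_cst a b (A : 'M[C]_(a, b)) M E : is_mder (fun=> A) M E 0.
Proof. by move=> i j; rewrite mxE; exact: is_cder_cst. Qed.

Lemma is_mderD a b (F G : V -> 'M[C]_(a, b)) M E Z Z' :
  is_mder F M E Z -> is_mder G M E Z' -> is_mder (fun M => F M + G M) M E (Z + Z').
Proof. by move=> h h' i j; under eq_fun do rewrite mxE; rewrite mxE; exact: is_cderD. Qed.

Lemma is_mderN a b (F : V -> 'M[C]_(a, b)) M E Z :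
  is_mder F M E Z -> is_mder (fun M => - F M) M E (- Z).
Proof. by move=> h i j; under eq_fun do rewrite mxE; rewrite mxE; exact: is_cderN. Qed.

Lemma is_mder_adj a b (F : V -> 'M[C]_(a, b)) M E Z :
  is_mder F M E Z -> is_mder (fun M => (F M)^t*) M E (Z^t*).
Proof. by move=> h i j; under eq_fun do rewrite !mxE; rewrite !mxE; exact: is_cder_conj. Qed.

Lemma is_cder_sum (I : Type) (s : seq I) (F : I -> V -> C) M E (z : I -> C) :
  (forall i, is_cder (F i) M E (z i)) ->
  is_cder (fun M => \sum_(i <- s) F i M) M E (\sum_(i <- s) z i).
Proof.
move=> h; elim: s => [|i s IH].
  by under eq_fun do rewrite big_nil; rewrite big_nil; exact: is_cder_cst.
by under eq_fun do rewrite big_cons; rewrite big_cons; exact: is_cderD.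
Qed.

Lemma is_mderM a b c (F : V -> 'M[C]_(a, b)) (G : V -> 'M[C]_(b, c)) M E Z Z' :
  is_mder F M E Z -> is_mder G M E Z' ->
  is_mder (fun M => F M *m G M) M E (Z *m G M + F M *m Z').
Proof.
move=> h h' i j; under eq_fun do rewrite mxE; rewrite !mxE -big_split /=.
by apply: is_cder_sum => k; exact: is_cderM.
Qed.

Lemma is_mderMr a b c (F : V -> 'M[C]_(a, b)) (B : 'M[C]_(b, c)) M E Z :
  is_mder F M E Z -> is_mder (fun M => F M *m B) M E (Z *m B).
Proof. by move=> h; have := is_mderM h (is_mder_cst B M E); rewrite mulmx0 addr0. Qed.

(** Cramer's rule, through [mreg_inv], provides some derivative; the product rule applied to
    [F F^-1 = 1] identifies it. *)
Lemma is_mder_inv a (F : V -> 'M[C]_a) M E Z :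
  mreg F -> (forall M, F M \in unitmx) -> is_mder F M E Z ->
  is_mder (fun M => invmx (F M)) M E (- (invmx (F M) *m Z *m invmx (F M))).
Proof.
move=> rF uF h; have [Z' h'] := mreg_is_mder M E (mreg_inv rF uF).
suff <- : Z' = - (invmx (F M) *m Z *m invmx (F M)) by [].
have := is_mderM h h'.
have -> : (fun M => F M *m invmx (F M)) = fun=> 1%:M.
  by apply/funext => N; rewrite mulmxV.
move=> /(is_mder_unique (is_mder_cst _ M E)) /esym /eqP.
rewrite addrC addr_eq0 => /eqP h1.
have := congr1 (mulmx (invmx (F M))) h1.
by rewrite mulmxA mulVmx // mul1mx mulmxN mulmxA.
Qed.

Definition cmx (M : V) : 'M[C]_(n, l) := map_mx (real_complex R) M.

Lemma affine_is_derive (i : 'I_n) (j : 'I_l) M E :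
  is_derive (0 : R) (1 : R) (fun x : R => Re (cmx (M + x *: E) i j)) (E i j).
Proof.
have -> : (fun x : R => Re (cmx (M + x *: E) i j)) = cst (M i j) + (id : R -> R) * cst (E i j).
  by apply/funext => x; rewrite !mxE.
apply: (is_derive_eq (is_deriveD (is_derive_cst _ _ _)
    (is_deriveM (is_derive_id _ _) (is_derive_cst _ _ _)))).
by rewrite /= /GRing.scale /= mulr0 add0r mulr1 add0r.
Qed.

Lemma mreg_cmx : mreg cmx.
Proof.
move=> i j; split; first split.
- move=> d T W mW; rewrite (_ : _ \o W = fun t => W t i j) //.
  by apply/funext => t; rewrite /= mxE.
- move=> d T W mW; rewrite (_ : _ \o W = cst 0) //.
  by apply/funext => t; rewrite /= mxE.
move=> M E; exists (cmx E i j); split; rewrite !mxE /=.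
- exact: affine_is_derive.
- under eq_fun do rewrite !mxE /=.
  exact: is_derive_cst.
Qed.

Lemma is_mder_cmx M E : is_mder cmx M E (cmx E).
Proof.
move=> i j; split; rewrite !mxE /=.
- exact: affine_is_derive.
- under eq_fun do rewrite !mxE /=.
  exact: is_derive_cst.
Qed.

End RegularFunctions.

(** * Gaussian integration by parts *)

Section Normal.
Variable R : realType.
Local Notation mu := (@lebesgue_measure R).
Local Notation N := (@normal_prob R 0 1).
Local Notation phi := (@normal_pdf R 0 1).

(** The Radon-Nikodym derivative of [N] agrees almost everywhere with [phi], since both have the
    same integral over every measurable set. *)
Lemma integral_normal_ge0 (f : R -> R) : (forall x, 0 <= f x) ->
  measurable_fun [set: R] f ->
  (\int[N]_x (f x)%:E = \int[mu]_x (f x * phi x)%:E)%E.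
Proof.
move=> f0 mf.
have dom : N `<< mu := normal_prob_dominates 0 1.
have mf' : measurable_fun [set: R] (EFin \o f) by exact/measurable_EFinP.
rewrite -(Radon_Nikodym_SigmaFinite.change_of_variables dom (f := EFin \o f)) //.
have iR := Radon_Nikodym_SigmaFinite.f_integrable dom.
apply: ae_eq_integral => //.
- by apply: emeasurable_funM => //; exact: measurable_int iR.
- apply/measurable_EFinP; apply: measurable_funM => //; exact: measurable_normal_pdf.
- under [X in ae_eq _ _ _ X]eq_fun do rewrite EFinM.
  apply: ae_eqe_mul2l; apply: integral_ae_eq => //.
  + by apply/measurable_EFinP; exact: measurable_normal_pdf.
  + by move=> E _ mE; rewrite -(Radon_Nikodym_SigmaFinite.f_integral dom).
Qed.

Lemma normal_integrable (f : R -> R) : measurable_fun [set: R] f ->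
  mu.-integrable [set: R] (fun x => (f x * phi x)%:E) ->
  N.-integrable [set: R] (EFin \o f).
Proof.
move=> mf /integrableP [_ h]; apply/integrableP; split; first exact/measurable_EFinP.
apply: le_lt_trans h; rewrite le_eqVlt; apply/orP; left; apply/eqP.
under eq_integral do rewrite /=.
rewrite (integral_normal_ge0 (f := fun x => `|f x|)) //; last exact: measurableT_comp.
apply: eq_integral => x _ /=.
by rewrite normrM (ger0_norm (normal_pdf_ge0 _ _ _)).
Qed.

Lemma integral_normal (f : R -> R) : measurable_fun [set: R] f ->
  (\int[N]_x (f x)%:E = \int[mu]_x (f x * phi x)%:E)%E.
Proof.
have posE (g : R -> R) : (EFin \o g)^\+%E = EFin \o (fun x => Num.max (g x) 0).
  by apply/funext => x; rewrite funeposE /= EFin_max.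
have negE (g : R -> R) : (EFin \o g)^\-%E = EFin \o (fun x => Num.max (- g x) 0).
  by apply/funext => x; rewrite funenegE /= EFin_max EFinN.
move=> mf; rewrite integralE [RHS]integralE !(posE, negE) /=.
by congr (_ - _)%E; rewrite integral_normal_ge0 => [|x|]; rewrite ?le_max ?lexx ?orbT //;
  do ?[apply: measurable_maxr => //; exact: measurableT_comp];
  apply: eq_integral => x _; rewrite maxr_pMl ?normal_pdf_ge0 // mul0r ?mulNr.
Qed.

(* (1 + y) <= exp y at y = x^2/(4m) trades the polynomial for a quarter of the
   Gaussian exponent. *)
Lemma poly_normal_le m : exists2 B : R, 0 <= B &
  forall x : R, (1 + x ^+ 2) ^+ m * phi x <= B * expR (- (x ^+ 2 / 4)).
Proof.
have pk := normal_peak_ge0 (1 : R).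
exists ((4 * m.+1%:R) ^+ m * normal_peak 1).
  by apply: mulr_ge0 => //; apply: exprn_ge0; apply: mulr_ge0.
move=> x; rewrite normal_pdfE ?oner_eq0 // /normal_fun subr0 expr1n.
have -> : - x ^+ 2 / (1 *+ 2) = - (x ^+ 2 / 4) + - (x ^+ 2 / 4) :> R by lra.
have x2 := sqr_ge0 x.
have h : (1 + x ^+ 2) ^+ m <= (4 * m.+1%:R) ^+ m * expR (x ^+ 2 / 4).
  have m0 : 0 < (4 * m.+1%:R : R) by rewrite mulr_gt0.
  have -> : expR (x ^+ 2 / 4) = expR (x ^+ 2 / (4 * m.+1%:R)) ^+ m.+1.
    rewrite -expRM_natl; congr expR; field.
    by rewrite gt_eqF // addrC -natr1 ltr_pwDr.
  have e1 : 1 + x ^+ 2 / (4 * m.+1%:R) <= expR (x ^+ 2 / (4 * m.+1%:R)) by exact: expR_ge1Dx.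
  have e0 : 1 <= expR (x ^+ 2 / (4 * m.+1%:R)).
    by apply: le_trans e1; rewrite lerDl divr_ge0 // ltW.
  apply: (@le_trans _ _ ((4 * m.+1%:R * expR (x ^+ 2 / (4 * m.+1%:R))) ^+ m)).
    apply: lerXn2r; rewrite ?nnegrE.
    - by rewrite addr_ge0.
    - by apply: mulr_ge0; [exact: ltW|exact: expR_ge0].
    apply: (@le_trans _ _ (4 * m.+1%:R * (1 + x ^+ 2 / (4 * m.+1%:R)))).
      rewrite mulrDr mulrCA divff ?gt_eqF // !mulr1 lerD2r.
      have : (1 : R) <= m.+1%:R by rewrite ler1n.
      lra.
    by rewrite ler_pM2l.
  rewrite exprMn ler_pM2l ?exprn_gt0 //.
  exact: ler_weXn2l.
have uv : expR (x ^+ 2 / 4) * expR (- (x ^+ 2 / 4)) = 1 by rewrite expRxMexpNx_1.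
have v0 := expR_ge0 (- (x ^+ 2 / 4)).
rewrite expRD !mulrA ler_wpM2r // -mulrA mulrC -mulrA [leRHS]mulrC ler_wpM2l //.
by apply: le_trans (ler_wpM2l v0 h) _; rewrite mulrCA [expR (- _) * _]mulrC uv mulr1.
Qed.

Lemma integrable_gauss4 : mu.-integrable [set: R] (fun x => (expR (- (x ^+ 2 / 4)))%:E).
Proof.
have s0 : Num.sqrt 2 != 0 :> R by rewrite gt_eqF // sqrtr_gt0.
have := @integrable_normal_pdf R 0 (Num.sqrt 2).
move=> /(integrableZl measurableT (normal_peak (Num.sqrt 2))^-1).
apply: eq_integrable => // x _ /=.
rewrite -EFinM normal_pdfE // mulKf ?gt_eqF ?normal_peak_gt0 //.
rewrite /normal_fun subr0 sqr_sqrtr // -mulr_natr -natrM mulNr.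
by rewrite (_ : (2 * 2)%N = 4%N).
Qed.

Lemma growth_integrable (f : R -> R) (B : R) m : measurable_fun [set: R] f ->
  (forall x, `|f x| <= B * (1 + x ^+ 2) ^+ m) ->
  mu.-integrable [set: R] (fun x => (f x * phi x)%:E).
Proof.
move=> mf fB; have [D D0 hD] := poly_normal_le m.
have /(integrableZl measurableT (`|B| * D)) iD := integrable_gauss4.
apply: le_integrable iD => //.
  apply/measurable_EFinP; apply: measurable_funM => //; exact: measurable_normal_pdf.
move=> x _ /=; rewrite lee_fin normrM (ger0_norm (normal_pdf_ge0 _ _ _)).
rewrite [leRHS]ger0_norm; last first.
  by apply: mulr_ge0; [apply: mulr_ge0 => //|exact: expR_ge0].
rewrite -mulrA; apply: le_trans (_ : `|B| * ((1 + x ^+ 2) ^+ m * phi x) <= _).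
  rewrite mulrA ler_wpM2r ?normal_pdf_ge0 //; apply: le_trans (fB x) _.
  by rewrite ler_wpM2r ?exprn_ge0 ?addr_ge0 ?sqr_ge0 // ler_norm.
by rewrite ler_wpM2l.
Qed.

Lemma normal_pow_integrable m :
  N.-integrable [set: R] (EFin \o (fun x : R => (1 + x ^+ 2) ^+ m)).
Proof.
have mf : measurable_fun [set: R] (fun x : R => (1 + x ^+ 2) ^+ m).
  by apply: measurable_funX; apply: measurable_funD => //; exact: measurable_funX.
apply: normal_integrable => //.
apply: (growth_integrable (B := 1) (m := m)) => // x.
by rewrite mul1r ger0_norm // exprn_ge0 // addr_ge0 // sqr_ge0.
Qed.

Lemma is_derive_phi (x : R) : is_derive x (1 : R) phi (- x * phi x).
Proof.
rewrite normal_pdfE ?oner_eq0 //.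
have -> : (fun x : R => normal_peak 1 * normal_fun 0 1 x) =
   normal_peak 1 *: (expR \o (fun x : R => - x ^+ 2 / 2)).
  apply/funext => y; rewrite /= /normal_fun subr0 expr1n.
  by [].
have h : is_derive x (1 : R) (fun x : R => - x ^+ 2 / 2) (- x).
  have -> : (fun x : R => - x ^+ 2 / 2) = (- 2^-1 : R) *: ((id : R -> R) ^+ 2).
    by apply/funext => y; rewrite exprfctE /= -[RHS]/(- 2^-1 * (y ^+ 2)) mulrC mulNr mulrN.
  apply: is_derive_eq; rewrite /GRing.scale /= expr1 mulr1 -mulr_natr; lra.
apply: (is_derive_eq (is_deriveZ _ (is_derive1_comp (is_derive_expR _) h))).
rewrite /GRing.scale /= /normal_fun subr0 expr1n; ring.
Qed.

(** [f phi] has derivative [(f' - x f) phi], so over a symmetric interval the integral is a boundary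
    term; the Gaussian decay beats the polynomial growth as the interval exhausts the line. *)
Lemma stein1 (f f' : R -> R) (B : R) m :
  (forall x, is_derive x (1 : R) f (f' x)) -> continuous f' ->
  (forall x, `|f x| <= B * (1 + x ^+ 2) ^+ m) ->
  (forall x, `|f' x| <= B * (1 + x ^+ 2) ^+ m) ->
  (\int[N]_x (x * f x - f' x)%:E = 0)%E.
Proof.
move=> df cf' bf bf'.
have cf : continuous f.
  by move=> x; apply/differentiable_continuous/derivable1_diffP; case: (df x).
have B0 : 0 <= B.
  by have := le_trans (normr_ge0 _) (bf 0); rewrite expr0n addr0 expr1n mulr1.
have mf : measurable_fun [set: R] f by exact: continuous_measurable_fun.
have mf' : measurable_fun [set: R] f' by exact: continuous_measurable_fun.
pose g x := f x * phi x.
pose g' x := (f' x - x * f x) * phi x.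
have dg x : is_derive x (1 : R) g (g' x).
  apply: (is_derive_eq (is_deriveM (df x) (is_derive_phi x))).
  by rewrite /g' /GRing.scale /=; ring.
have cphi : continuous phi by apply: continuous_normal_pdf; rewrite oner_eq0.
have cg' : continuous g'.
  move=> x; apply: cvgM; last exact: cphi.
  apply: cvgB; first exact: cf'.
  by apply: cvgM; [exact: cvg_id|exact: cf].
have ig' : mu.-integrable [set: R] (fun x => (g' x)%:E).
  apply: (growth_integrable (B := B + B) (m := m.+1)).
    apply: measurable_funB => //; exact: measurable_funM.
  move=> x; apply: le_trans (ler_normB _ _) _; rewrite mulrDl lerD //.
    apply: le_trans (bf' x) _; rewrite ler_wpM2l // ler_weXn2l //.
    by rewrite lerDl sqr_ge0.
  rewrite normrM exprS mulrCA ler_pM // ?normr_ge0 //.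
  have -> : x ^+ 2 = `|x| ^+ 2 by rewrite real_normK ?num_real.
  move: `|x| => y; nra.
suff h : (\int[mu]_x (g' x)%:E = 0)%E.
  rewrite integral_normal; last first.
    by apply: measurable_funB => //; exact: measurable_funM.
  rewrite (_ : (fun x => _) = (fun x => (- 1)%:E * (g' x)%:E)%E).
    by rewrite integralZl // h mule0.
  by apply/funext => x; rewrite -EFinM /g'; congr EFin; ring.
pose I (n : nat) : set R := `[- (n.+1%:R : R), n.+1%:R]%classic.
pose F n := (fun x => (g' x)%:E) \_ (I n).
have [_ _ h] : [/\ mu.-integrable [set: R] (fun x => (g' x)%:E),
  [sequence (\int[mu]_x `|F n x - (g' x)%:E|)%E]_n @ \oo --> 0%E &
  [sequence (\int[mu]_x (F n x))%E]_n @ \oo --> (\int[mu]_x (g' x)%:E)%E].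
  apply: (@dominated_convergence _ _ _ mu _ measurableT F _ (fun x => `|(g' x)%:E|%E)) => //.
  - move=> n; apply: (measurable_restrictT (fun x : R => (g' x)%:E) (measurable_itv _)).1.
    by apply: measurable_funTS; exact: (measurable_int mu ig').
  - exact: (measurable_int mu ig').
  - apply: aeW => x _; apply: cvg_near_cst.
    have [n hn] : exists n : nat, `|x| <= n%:R.
      by exists (Num.bound `|x|); apply/ltW/archi_boundP.
    near=> k; rewrite /F patchE mem_set //.
    rewrite /I /= in_itv /=.
    have : n%:R <= k.+1%:R :> R.
      by rewrite ler_nat; apply: leqW; near: k; exists n.
    by move=> hk; rewrite -ler_norml; apply: le_trans hn _.
  - exact: integrable_abse.
  - apply: aeW => x n _; rewrite /F patchE; case: ifP => // _.
    by rewrite abse0 abse_ge0.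
have h2 : [sequence (\int[mu]_x (F n x))%E]_n @ \oo --> 0%E.
  have [D D0 hD] := poly_normal_le m.
  have E n : (\int[mu]_x (F n x))%E = (g n.+1%:R - g (- n.+1%:R))%:E.
    rewrite /F -integral_mkcond EFinB; apply: (@continuous_FTC2 _ g' g).
    - by rewrite gtrN.
    - exact: continuous_subspaceT.
    - have cg : continuous g by move=> x; apply: cvgM; [exact: cf|exact: cphi].
      split.
      + by move=> x _; case: (dg x).
      + by apply: cvg_at_right_filter; exact: cg.
      + by apply: cvg_at_left_filter; exact: cg.
    - by move=> x _; rewrite derive1E; case: (dg x).
  rewrite (_ : [sequence _]_n = EFin \o (fun n : nat => g n.+1%:R - g (- n.+1%:R))); last first.
    by apply/funext => n; exact: E.
  apply: cvg_EFin; first by near=> n.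
  (* The rate rests on the crude bound [exp (- y^2 / 4) <= 4 / y] for [y >= 1]. *)
  have gb x n : `|x| = n.+1%:R -> `|g x| <= 4 * B * D * harmonic n.
    move=> xn; rewrite /g normrM (ger0_norm (normal_pdf_ge0 _ _ _)).
    apply: (@le_trans _ _ (B * ((1 + x ^+ 2) ^+ m * phi x))).
      by rewrite mulrA ler_wpM2r ?normal_pdf_ge0.
    apply: (@le_trans _ _ (B * (D * expR (- (x ^+ 2 / 4))))).
      by rewrite ler_wpM2l.
    have -> : 4 * B * D * harmonic n = B * (D * (4 * harmonic n)) by ring.
    rewrite ler_wpM2l // ler_wpM2l //.
    have -> : x ^+ 2 = n.+1%:R ^+ 2 by rewrite -xn real_normK ?num_real.
    rewrite /harmonic; set y : R := n.+1%:R.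
    have y1 : 1 <= y by rewrite ler1n.
    rewrite expRN -[leRHS]invrK lef_pV2 ?posrE ?expR_gt0 //; last first.
      by rewrite invr_gt0 mulr_gt0 // invr_gt0; lra.
    apply: le_trans (expR_ge1Dx _).
    rewrite invfM invrK; nra.
  apply: (@squeeze_cvgr _ _ _ _ (fun n => - (8 * B * D) * harmonic n) (fun n => 8 * B * D * harmonic n)).
  + near=> n; rewrite mulNr -ler_norml; apply: le_trans (ler_normB _ _) _.
    have h3 := gb n.+1%:R n (ger0_norm (ler0n _ _)).
    have h4 : `|- n.+1%:R| = n.+1%:R :> R by rewrite normrN ger0_norm.
    have h5 := gb _ n h4.
    move: h3 h5; rewrite -!mulrA; move: (B * _) => z; lra.
  + rewrite -[X in _ --> X](mulr0 (- (8 * B * D))); apply: cvgM; [exact: cvg_cst|exact: cvg_harmonic].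
  + rewrite -[X in _ --> X](mulr0 (8 * B * D)); apply: cvgM; [exact: cvg_cst|exact: cvg_harmonic].
exact: cvg_unique h h2.
Unshelve. all: by end_near. Qed.

End Normal.

(** * Resampling one entry of a Gaussian matrix *)

Section Resampling.
Context {d : measure_display} {T : measurableType d} {R : realType}.
Variables (P : probability T R) (n l : nat) (W : T -> 'M[R]_(n, l)).
Local Notation N := (@normal_prob R 0 1).

Definition gaussian_mx :=
  (forall i j, std_normal P (fun w => W w i j)) /\
  mutually_independent P (fun (ij : 'I_n * 'I_l) w => W w ij.1 ij.2).

Hypothesis gW : gaussian_mx.
Variables (i0 : 'I_n) (j0 : 'I_l).

Let a0 := (i0, j0).
Let X (a : 'I_n * 'I_l) (w : T) : R := W w a.1 a.2.
Let mX a : measurable_fun [set: T] (X a).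
Proof. by have [h _] := gW; case: (h a.1 a.2). Qed.

Let pX a B : measurable B -> measurable (X a @^-1` B).
Proof. by move=> mB; rewrite -[_ @^-1` _]setTI; exact: mX. Qed.

Let cyl (B : 'I_n * 'I_l -> set R) : set T :=
  \bigcap_(a in [set` [set a | a != a0]%SET]) X a @^-1` B a.

Let G : set (set T) :=
  [set A | exists2 B, (forall a, measurable (B a)) & A = cyl B].

Let Gm : G `<=` measurable.
Proof.
move=> _ [B mB ->]; apply: fin_bigcap_measurable => [|a _]; last exact: pX.
exact: finite_finset.
Qed.

Let GI : setI_closed G.
Proof.
move=> _ _ [B mB ->] [B' mB' ->]; exists (fun a => B a `&` B' a).
  by move=> a; exact: measurableI.
rewrite predeqE => w; split.
- by move=> [h h'] a ha; split; [exact: h|exact: h'].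
- by move=> h; split=> a ha; have [] := h a ha.
Qed.

Let GT : G setT.
Proof.
by exists (fun=> setT) => //; rewrite predeqE => w; split => // _ a _.
Qed.

(** For fixed [B0] both sides are finite measures in [A]. Mutual independence makes them agree on
    the cylinders over the other entries, which are stable under intersection and include the whole
    space, hence on the sigma-algebra they generate. *)
Let indep (B0 : set R) (A : set T) : measurable B0 -> <<s G >> A ->
  P (X a0 @^-1` B0 `&` A) = (N B0 * P A)%E.
Proof.
move=> mB0 sA; have mX0 := pX a0 mB0.
pose m1 := mrestr P mX0.
have N0 : 0 <= fine (N B0) by apply: fine_ge0; exact: measure_ge0.
pose m2 := mscale (NngNum N0) P.
have Nf : (fine (N B0))%:E = N B0 by rewrite fineK // fin_num_measure.
have -> : P (X a0 @^-1` B0 `&` A) = m1 A by rewrite /m1 /mrestr setIC.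
have m2E D : m2 D = (N B0 * P D)%E by rewrite -[in RHS]Nf.
rewrite -[RHS]m2E.
apply: (@g_sigma_algebra_measure_unique _ _ _ G Gm (fun=> setT) (fun=> GT) _ m1 m2 GI) => //.
- by rewrite bigcup_const.
- move=> _ [B mB ->]; apply: etrans (esym (m2E _)); rewrite -[LHS]/(P (cyl B `&` X a0 @^-1` B0)).
  have [std ind] := gW.
  pose B' a := if a == a0 then B0 else B a.
  have mB' a : measurable (B' a) by rewrite /B'; case: ifP.
  have := ind [set: _]%SET B' mB'.
  rewrite (_ : \bigcap_(i in _) _ = cyl B `&` X a0 @^-1` B0); last first.
    rewrite predeqE => w; split.
    + move=> h; split.
      * move=> a /=; rewrite inE /= => ha; have := h a.
        by rewrite /= inE /B' (negbTE ha); apply.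
      * by have := h a0; rewrite /= inE /B' eqxx; apply.
    + move=> [h h0] a _; rewrite /B'; case: (eqVneq a a0) => [->|ha]; first exact: h0.
      by apply: h; rewrite /= inE.
  move=> ->; rewrite (bigD1 a0) //=; congr (_ * _)%E.
    by rewrite /B' eqxx; have [_ ->] := std i0 j0.
  rewrite (ind [set a | a != a0]%SET B mB); apply: eq_big => a; rewrite ?inE //.
  by move=> ha; rewrite /B' (negbTE ha).
- move=> k; rewrite -[X in (X < _)%E]/(P (setT `&` X a0 @^-1` B0)) setTI.
  by apply: le_lt_trans (probability_le1 _ _) _ => //; exact: ltry.
Qed.

(* On the sigma-algebra G generated by the other entries, the entry (i0, j0) is
   independent, so the law of (W i0 j0, identity) is a product measure. *)
Lemma resample_ge0 (h : 'M[R]_(n, l) -> R) : umeas h -> (forall M, 0 <= h M) ->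
  (\int[P]_w (h (W w))%:E =
   \int[P]_w \int[N]_x (h (W w + (x - W w i0 j0) *: delta_mx i0 j0))%:E)%E.
Proof.
move=> mh h0.
pose MR := measurableTypeR R.
pose TG := g_sigma_algebraType G.
have mid : measurable_fun [set: T] (id : T -> TG).
  move=> _ B sB; rewrite setTI preimage_id.
  apply: (smallest_sub _ Gm) sB; exact: sigma_algebra_measurable.
pose idm : {mfun T >-> TG} := mfun_Sub (mem_set mid).
pose PG := distribution P idm.
pose pr (w : T) : MR * TG := (X a0 w, w).
have mpr : measurable_fun [set: T] pr.
  by apply/measurable_fun_pairP; split; [exact: mX|exact: mid].
pose prm : {mfun T >-> (MR * TG)%type} := mfun_Sub (mem_set mpr).
pose PR := distribution P prm.
have PRE (D : set (MR * TG)) : measurable D -> (N \x PG)%E D = PR D.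
  apply: (@product_measure_unique _ _ _ _ R N PG PR) => A B mA mB.
  rewrite /PR /PG /distribution /pushforward /=.
  by rewrite -indep.
pose upd (z : MR * TG) : 'M[R]_(n, l) :=
  W z.2 + (z.1 - W z.2 i0 j0) *: delta_mx i0 j0.
have mupd i j : measurable_fun [set: MR * TG] (fun z => upd z i j).
  have E : (fun z => upd z i j) = if (i, j) == a0 then fst else (fun z => X (i, j) z.2).
    apply/funext => z; rewrite /upd !mxE /a0 /X; case: (@eqP _ (i, j)) => [[-> ->]|hn].
      by rewrite !eqxx mulr1 addrC subrK.
    rewrite (_ : (_ && _) = false) ?mulr0 ?addr0 //.
    by apply/negP => /andP [/eqP hi /eqP hj]; apply: hn; rewrite hi hj.
  rewrite E; case: eqP => [_|/eqP hn]; first exact: measurable_fst.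
  have mXG : measurable_fun [set: TG] (X (i, j)).
    move=> _ B mB; rewrite setTI; apply: sub_sigma_algebra.
    exists (fun a => if a == (i, j) then B else setT).
      by move=> a; case: ifP.
    rewrite predeqE => w; split.
      by move=> hB a _; case: eqP => [->|].
    by move=> /(_ (i, j)); rewrite /= inE eqxx; apply.
  exact: (measurableT_comp mXG measurable_snd).
have mh' : measurable_fun [set: MR * TG] (fun z => (h (upd z))%:E).
  by apply/measurable_EFinP; exact: mh.
transitivity (\int[PR]_z (h (upd z))%:E)%E.
  rewrite /PR /distribution ge0_integral_pushforward //; last first.
    by move=> z _; rewrite lee_fin.
  apply: eq_integral => w _ /=; congr (h _)%:E.
  by rewrite /upd /pr /= /X /= subrr scale0r addr0.
transitivity (\int[(N \x PG)%E]_z (h (upd z))%:E)%E.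
  by apply: eq_measure_integral => D mD _; apply/esym/PRE.
rewrite fubini_tonelli2 //; last by move=> z; rewrite lee_fin.
rewrite /PG /distribution ge0_integral_pushforward //.
- by apply: (measurable_fun_fubini_tonelli_G _ mh') => z; rewrite lee_fin.
- by move=> w _; apply: integral_ge0 => x _; rewrite lee_fin.
Qed.

End Resampling.

(** * Functions of polynomial growth *)

Section Growth.
Variables (R : realType) (n l : nat).
Local Notation V := 'M[R]_(n, l).
Implicit Types (f g : V -> R) (M : V).

(** Gauge for polynomial growth. The leading 1 makes powers monotone in the exponent and allows the
    factorization [sz_line] along a line in one entry. *)
Definition sz (M : V) : R := 1 + \sum_(a : 'I_n * 'I_l) M a.1 a.2 ^+ 2.

Lemma sz_ge1 M : 1 <= sz M.
Proof. by rewrite /sz lerDl sumr_ge0 // => a _; exact: sqr_ge0. Qed.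

Lemma sz_ge0 M : 0 <= sz M.
Proof. exact: le_trans ler01 (sz_ge1 M). Qed.

Lemma sz_entry M i j : `|M i j| <= sz M.
Proof.
rewrite /sz (bigD1 (i, j)) //= addrA.
apply: (@le_trans _ _ (1 + M i j ^+ 2)).
  rewrite -(real_normK (num_real _)); move: (`|M i j|) => y; nra.
by rewrite lerDl sumr_ge0 // => a _; exact: sqr_ge0.
Qed.

Lemma umeas_entry i j : umeas (fun M : V => M i j).
Proof. by move=> d T W /(_ i j). Qed.

Lemma line_entry M i0 j0 x : (M + (x - M i0 j0) *: delta_mx i0 j0) i0 j0 = x.
Proof. by rewrite !mxE !eqxx mulr1 addrC subrK. Qed.

Lemma sz_line M i0 j0 x :
  sz (M + (x - M i0 j0) *: delta_mx i0 j0) <= sz M * (1 + x ^+ 2).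
Proof.
rewrite /sz (bigD1 (i0, j0)) //= [in leRHS](bigD1 (i0, j0)) //= line_entry.
rewrite (eq_bigr (fun a => M a.1 a.2 ^+ 2)); last first.
  move=> [i j] /= hn; rewrite !mxE (_ : (_ && _) = false) ?mulr0 ?addr0 //.
  by apply/negP => /andP [/eqP hi /eqP hj]; move/eqP: hn; apply; rewrite hi hj.
have : 0 <= \sum_(a | a != (i0, j0)) M a.1 a.2 ^+ 2 by apply: sumr_ge0 => a _; exact: sqr_ge0.
move: (\sum_(_ | _) _) (M i0 j0) => z y; nra.
Qed.

Definition growth f := exists B m, forall M, `|f M| <= B * sz M ^+ m.

Lemma growthP f : growth f ->
  exists B m, 0 <= B /\ forall M, `|f M| <= B * sz M ^+ m.
Proof.
move=> [B [m h]]; exists `|B|, m; split => // M; apply: le_trans (h M) _.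
by rewrite ler_wpM2r ?exprn_ge0 ?sz_ge0 // ler_norm.
Qed.

Lemma growth_cst c : growth (fun=> c).
Proof. by exists `|c|, 0%N => M; rewrite expr0 mulr1. Qed.

Lemma growth_le f g : (forall M, `|f M| <= g M) -> growth g -> growth f.
Proof.
move=> fg [B [m h]]; exists B, m => M; apply: le_trans (fg M) _.
by apply: le_trans (h M); exact: ler_norm.
Qed.

Lemma growth_sz : growth sz.
Proof. by exists 1, 1%N => M; rewrite mul1r expr1 ger0_norm // sz_ge0. Qed.

Lemma growth_entry i j : growth (fun M : V => M i j).
Proof. by apply: growth_le growth_sz => M; exact: sz_entry. Qed.

Lemma growthD f g : growth f -> growth g -> growth (fun M => f M + g M).
Proof.
move=> /growthP [B [m [B0 h]]] /growthP [D [p [D0 k]]]; exists (B + D), (m + p)%N => M.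
apply: le_trans (ler_normD _ _) _; rewrite mulrDl lerD //.
- apply: le_trans (h M) _; rewrite ler_wpM2l // ler_weXn2l ?leq_addr //; exact: sz_ge1.
- apply: le_trans (k M) _; rewrite ler_wpM2l // ler_weXn2l ?leq_addl //; exact: sz_ge1.
Qed.

Lemma growthM f g : growth f -> growth g -> growth (fun M => f M * g M).
Proof.
move=> [B [m h]] [D [p k]]; exists (B * D), (m + p)%N => M.
by rewrite normrM exprD mulrACA ler_pM // ?normr_ge0.
Qed.

Lemma growthN f : growth f -> growth (fun M => - f M).
Proof. by move=> [B [m h]]; exists B, m => M; rewrite normrN. Qed.

Lemma growthB f g : growth f -> growth g -> growth (fun M => f M - g M).
Proof. by move=> hf hg; apply: growthD => //; exact: growthN. Qed.

Lemma growth_sum (I : Type) (s : seq I) (Q : pred I) (F : I -> V -> R) :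
  (forall i, growth (F i)) -> growth (fun M => \sum_(i <- s | Q i) F i M).
Proof.
move=> rF; elim: s => [|i s IH].
  by under eq_fun do rewrite big_nil; exact: growth_cst.
under eq_fun do rewrite big_cons.
by case: (Q i) => //; exact: growthD.
Qed.

Lemma eq_growth f g : f =1 g -> growth f -> growth g.
Proof. by move=> /funext ->. Qed.

Lemma umeas_max f g : umeas f -> umeas g -> umeas (fun M => Num.max (f M) (g M)).
Proof.
by move=> mf mg d T W mW; apply: measurable_maxr; [exact: mf|exact: mg].
Qed.

End Growth.

(** Resampling is stated for nonnegative functions; this form carries a vanishing integral through
    it by comparing positive and negative parts. *)
Lemma integral_eq0_posneg d (T : measurableType d) (R : realType)
    (mu : {measure set T -> \bar R}) (g : T -> R) :
  mu.-integrable [set: T] (fun x => (g x)%:E) ->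
  (\int[mu]_x (g x)%:E = 0)%E <->
  (\int[mu]_x (Num.max (g x) 0)%:E = \int[mu]_x (Num.max (- g x) 0)%:E)%E.
Proof.
move=> ig.
have fp := integrable_pos_fin_num measurableT ig.
have fn := integrable_neg_fin_num measurableT ig.
have pE : (fun x => (g x)%:E)^\+%E = fun x => (Num.max (g x) 0)%:E.
  by apply/funext => x; rewrite funeposE /= EFin_max.
have nE : (fun x => (g x)%:E)^\-%E = fun x => (Num.max (- g x) 0)%:E.
  by apply/funext => x; rewrite funenegE /= EFin_max EFinN.
rewrite integralE; rewrite pE nE in fp fn *.
move: fp fn; case: (integral _ _ _) => // a _; case: (integral _ _ _) => // b _.
by split=> [/eqP|[->]]; rewrite -EFinB ?subrr // eqe subr_eq0 => /eqP ->.
Qed.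

Section GaussianExpectation.
Context {d : measure_display} {T : measurableType d} {R : realType}.
Variables (P : probability T R) (n l : nat) (W : T -> 'M[R]_(n, l)).
Hypothesis gW : gaussian_mx P W.
Local Notation N := (@normal_prob R 0 1).
Local Notation V := 'M[R]_(n, l).

Let mW i j : measurable_fun [set: T] (fun w => W w i j).
Proof. by have [h _] := gW; case: (h i j). Qed.

Let mh (h : V -> R) : umeas h -> measurable_fun [set: T] (fun w => h (W w)).
Proof. by move=> hm; exact: hm. Qed.

Lemma expr_addr_le (x y : R) m : 0 <= x -> 0 <= y ->
  (x + y) ^+ m <= 2 ^+ m * (x ^+ m + y ^+ m).
Proof.
move=> x0 y0; wlog xy : x y x0 y0 / x <= y.
  move=> H; case: (leP x y) => [|/ltW] h; first exact: H.
  by rewrite addrC [X in _ * X]addrC; exact: H.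
apply: (@le_trans _ _ ((2 * y) ^+ m)).
  apply: lerXn2r; rewrite ?nnegrE; [exact: addr_ge0|exact: mulr_ge0|lra].
by rewrite exprMn ler_wpM2l ?exprn_ge0 // lerDr exprn_ge0.
Qed.

Lemma entry_pow_integrable i j m :
  P.-integrable [set: T] (fun w => ((1 + W w i j ^+ 2) ^+ m)%:E).
Proof.
have mp : measurable_fun [set: R] (fun x : R => (1 + x ^+ 2) ^+ m).
  by apply: measurable_funX; apply: measurable_funD => //; exact: measurable_funX.
have p0 (x : R) : 0 <= (1 + x ^+ 2) ^+ m by rewrite exprn_ge0 // addr_ge0 // sqr_ge0.
apply/integrableP; split.
  by apply/measurable_EFinP; exact: measurableT_comp mp (mW i j).
have absE S (g : S -> R) : (forall x, 0 <= g x) -> (fun x => `|(g x)%:E|)%E = EFin \o g.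
  by move=> g0; apply/funext => x /=; rewrite ger0_norm.
rewrite absE //; have /integrableP [_] := normal_pow_integrable R m.
rewrite absE //.
have [std _] := gW; have [mX dX] := std i j.
rewrite (_ : (\int[P]_w _ = \int[N]_x ((1 + x ^+ 2) ^+ m)%:E)%E) //.
have mX' : measurable_fun [set: T] ((fun w => W w i j) : T -> measurableTypeR R) by exact: mX.
pose X : {mfun T >-> measurableTypeR R} := @mfun_Sub _ _ T (measurableTypeR R) _ (mem_set mX').
transitivity (\int[distribution P X]_x ((1 + x ^+ 2) ^+ m)%:E)%E.
  rewrite ge0_integral_pushforward //; first exact/measurable_EFinP.
  by move=> x _; rewrite lee_fin.
by apply: eq_measure_integral => B mB _; first [exact: dX|exact: (esym (dX B mB))].
Qed.

(** [(x + y)^m <= 2^m (x^m + y^m)] splits off one entry at a time and reduces the claim to moments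
    of a single entry. *)
Lemma sz_pow_integrable m : P.-integrable [set: T] (fun w => (sz (W w) ^+ m)%:E).
Proof.
rewrite /sz; elim: (index_enum _) => [|a s IH].
  under eq_fun do rewrite big_nil addr0 expr1n.
  exact: finite_measure_integrable_cst.
have /(integrableZl measurableT (2 ^+ m)) i1 := integrableD measurableT (entry_pow_integrable a.1 a.2 m) IH.
apply: le_integrable i1 => //.
  apply/measurable_EFinP; apply: measurable_funX; apply: measurable_funD => //.
  apply: measurable_sum => b; exact: measurable_funX.
move=> w _ /=; rewrite lee_fin big_cons.
have S0 : 0 <= \sum_(b <- s) W w b.1 b.2 ^+ 2 by rewrite sumr_ge0 // => b _; exact: sqr_ge0.
have y0 := sqr_ge0 (W w a.1 a.2).
have nn1 : 0 <= (1 + (W w a.1 a.2 ^+ 2 + \sum_(b <- s) W w b.1 b.2 ^+ 2)) ^+ m.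
  by rewrite exprn_ge0 // addr_ge0 // addr_ge0.
rewrite (ger0_norm nn1); apply: le_trans (ler_norm _).
apply: le_trans (expr_addr_le m _ _); rewrite ?addr_ge0 //.
by apply: lerXn2r; rewrite ?nnegrE ?addr_ge0 //; lra.
Qed.

Lemma growth_expect (f : V -> R) : umeas f -> growth f ->
  P.-integrable [set: T] (fun w => (f (W w))%:E).
Proof.
move=> mf /growthP [B [m [B0 hB]]].
have /(integrableZl measurableT B) := sz_pow_integrable m.
apply: le_integrable => //; first by apply/measurable_EFinP; exact: mh.
by move=> w _ /=; rewrite lee_fin; apply: le_trans (ler_norm _).
Qed.

(** Resampling averages over the entry [(i0, j0)] with the others frozen, and the inner integral
    vanishes by [stein1]. The growth bounds pass to the line through [sz_line], and
    differentiability of [f'] is used for its continuity there. *)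
Lemma stein_entry (i0 : 'I_n) (j0 : 'I_l) (f f' : V -> R) :
  umeas f -> umeas f' -> growth f -> growth f' ->
  (forall M : V, is_derive (0 : R) (1 : R) (fun x : R => f (M + x *: delta_mx i0 j0)) (f' M)) ->
  (forall M : V, derivable (fun x : R => f' (M + x *: delta_mx i0 j0)) (0 : R) (1 : R)) ->
  (\int[P]_w (W w i0 j0 * f (W w) - f' (W w))%:E = 0)%E.
Proof.
move=> mf mf' gf gf' df df'.
pose h (M : V) := M i0 j0 * f M - f' M.
have mmh : umeas h.
  by apply: umeasD; [apply: umeasM => //; exact: umeas_entry|exact: umeasN].
have gh : growth h.
  by apply: growthB => //; apply: growthM => //; exact: growth_entry.
pose line (M : V) (x : R) : V := M + (x - M i0 j0) *: delta_mx i0 j0.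
have lineD M x y : line M (x + y) = line M x + y *: delta_mx i0 j0.
  by rewrite /line (addrAC x) scalerDl addrA.
have shiftD (g : V -> R) (g' : R) M x :
    is_derive (0 : R) (1 : R) (fun y : R => g (line M x + y *: delta_mx i0 j0)) g' ->
    is_derive x (1 : R) (fun y => g (line M y)) g'.
  move=> hg; have E : (fun y => g (line M y)) =
      (fun y : R => g (line M x + y *: delta_mx i0 j0)) \o (fun y => y - x).
    by apply/funext => y /=; rewrite -lineD addrC subrK.
  rewrite E -[g']mulr1; apply: is_derive1_comp; first by rewrite subrr.
  rewrite -[X in is_derive _ _ _ X]subr0; exact: is_deriveB.
have key M : (\int[N]_x (h (line M x))%:E = 0)%E /\
    N.-integrable [set: R] (fun x => (h (line M x))%:E).
  have [B [m [B0 hB]]] := growthP gf; have [D [p [D0 hD]]] := growthP gf'.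
  pose K := B * sz M ^+ m + D * sz M ^+ p.
  have b1 x : `|f (line M x)| <= K * (1 + x ^+ 2) ^+ (m + p).
    apply: le_trans (hB _) _; rewrite mulrDl; apply: ler_wpDr.
      by rewrite !mulr_ge0 ?exprn_ge0 ?sz_ge0 // addr_ge0 // sqr_ge0.
    rewrite -mulrA ler_wpM2l //.
    apply: le_trans (_ : (sz M * (1 + x ^+ 2)) ^+ m <= _).
      by apply: lerXn2r; rewrite ?nnegrE ?mulr_ge0 ?sz_ge0 ?addr_ge0 ?sqr_ge0 // sz_line.
    rewrite exprMn ler_wpM2l ?exprn_ge0 ?sz_ge0 // ler_weXn2l ?leq_addr //.
    by rewrite lerDl sqr_ge0.
  have b2 x : `|f' (line M x)| <= K * (1 + x ^+ 2) ^+ (m + p).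
    apply: le_trans (hD _) _; rewrite mulrDl; apply: ler_wpDl.
      by rewrite !mulr_ge0 ?exprn_ge0 ?sz_ge0 // addr_ge0 // sqr_ge0.
    rewrite -mulrA ler_wpM2l //.
    apply: le_trans (_ : (sz M * (1 + x ^+ 2)) ^+ p <= _).
      by apply: lerXn2r; rewrite ?nnegrE ?mulr_ge0 ?sz_ge0 ?addr_ge0 ?sqr_ge0 // sz_line.
    rewrite exprMn ler_wpM2l ?exprn_ge0 ?sz_ge0 // ler_weXn2l ?leq_addl //.
    by rewrite lerDl sqr_ge0.
  have d1 x : is_derive x (1 : R) (fun y => f (line M y)) (f' (line M x)).
    by apply: shiftD; exact: df.
  have c1 : continuous (fun y => f (line M y)).
    by move=> x; apply/differentiable_continuous/derivable1_diffP; case: (d1 x).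
  have c2 : continuous (fun y => f' (line M y)).
    move=> x; apply/differentiable_continuous/derivable1_diffP.
    have := shiftD f' _ M x (derivableP (df' (line M x))).
    by case.
  have E x : h (line M x) = x * f (line M x) - f' (line M x).
    by rewrite /h {1}/line line_entry.
  have mline : measurable_fun [set: R] (fun x => h (line M x)).
    rewrite (_ : (fun x => _) = (fun x => x * f (line M x) - f' (line M x))); last exact/funext.
    apply: measurable_funB; last exact: continuous_measurable_fun.
    by apply: measurable_funM => //; exact: continuous_measurable_fun.
  split; first by under eq_integral do rewrite E; exact: stein1 d1 c2 b1 b2.
  apply: normal_integrable => //.
  apply: (growth_integrable (B := K + K) (m := (m + p).+1)) => // x.
  have K0 : 0 <= K by rewrite addr_ge0 // mulr_ge0 // exprn_ge0 // sz_ge0.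
  rewrite E; apply: le_trans (ler_normB _ _) _; rewrite mulrDl lerD //.
    rewrite normrM exprS mulrCA ler_pM // ?normr_ge0 //.
    have -> : x ^+ 2 = `|x| ^+ 2 by rewrite real_normK ?num_real.
    move: `|x| => y; nra.
  apply: le_trans (b2 x) _; rewrite ler_wpM2l // ler_weXn2l //.
  by rewrite lerDl sqr_ge0.
have ih := growth_expect mmh gh.
apply/(integral_eq0_posneg ih).
rewrite (resample_ge0 gW i0 j0 (h := fun M => Num.max (h M) 0)); first last.
- by move=> M; rewrite le_max lexx orbT.
- by apply: umeas_max => //; exact: umeas_cst.
rewrite [RHS](resample_ge0 gW i0 j0 (h := fun M => Num.max (- h M) 0)); first last.
- by move=> M; rewrite le_max lexx orbT.
- by apply: umeas_max; [exact: umeasN|exact: umeas_cst].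
apply: eq_integral => w _; have [k1 k2] := key (W w).
exact/(integral_eq0_posneg k2).
Qed.

End GaussianExpectation.

(** * Almost sure nonsingularity and expectations *)

Section LeadingMinor.
Variables (R : realType) (n l : nat).
Local Notation V := 'M[R]_(n, l).

Definition lead s (hn : (s <= n)%N) (hl : (s <= l)%N) (M : V) : 'M[R]_s :=
  \matrix_(i, j) M (widen_ord hn i) (widen_ord hl j).

Lemma umeas_sum (I : Type) (r : seq I) (F : I -> V -> R) :
  (forall i, umeas (F i)) -> umeas (fun M => \sum_(i <- r) F i M).
Proof.
move=> mF; elim: r => [|i r IH].
  by under eq_fun do rewrite big_nil; exact: umeas_cst.
by under eq_fun do rewrite big_cons; exact: umeasD.
Qed.

Lemma umeas_prod (I : Type) (r : seq I) (F : I -> V -> R) :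
  (forall i, umeas (F i)) -> umeas (fun M => \prod_(i <- r) F i M).
Proof.
move=> mF; elim: r => [|i r IH].
  by under eq_fun do rewrite big_nil; exact: umeas_cst.
by under eq_fun do rewrite big_cons; exact: umeasM.
Qed.

Lemma umeas_lead_det s (hn : (s <= n)%N) (hl : (s <= l)%N) :
  umeas (fun M => \det (lead hn hl M)).
Proof.
rewrite /determinant; apply: umeas_sum => p; apply: umeasM; first exact: umeas_cst.
apply: umeas_prod => i.
rewrite (_ : (fun M : V => _) = fun M : V => M (widen_ord hn i) (widen_ord hl (p i))).
  exact: umeas_entry.
by apply/funext => M; rewrite mxE.
Qed.

Definition singular s (hn : (s <= n)%N) (hl : (s <= l)%N) (M : V) : R :=
  (\det (lead hn hl M) == 0)%:R.

Lemma umeas_singular s (hn : (s <= n)%N) (hl : (s <= l)%N) : umeas (singular hn hl).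
Proof.
have m0 : measurable_fun [set: R] (fun x : R => (x == 0)%:R : R).
  rewrite (_ : (fun x => _) = \1_[set 0]); first exact: measurable_indic.
  by apply/funext => x; rewrite indicE; congr (nat_of_bool _)%:R; apply/eqP/idP; rewrite in_setE.
move=> d T W mW; exact: (measurableT_comp m0 (umeas_lead_det hn hl mW)).
Qed.

Lemma singular_ge0 s (hn : (s <= n)%N) (hl : (s <= l)%N) M : 0 <= singular hn hl M.
Proof. by rewrite ler0n. Qed.

(** Expand along the last row: the corner entry occurs once, and its cofactor is the previous
    leading minor. *)
Lemma det_lead_affine s (hn : (s < n)%N) (hl : (s < l)%N) (M : V) :
  let i0 := Ordinal hn in let j0 := Ordinal hl in
  exists c, forall x : R,
    \det (lead hn hl (M + (x - M i0 j0) *: delta_mx i0 j0)) =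
    x * \det (lead (ltnW hn) (ltnW hl) M) + c.
Proof.
move=> i0 j0.
exists (\sum_(j | j != ord_max) lead hn hl M ord_max j * cofactor (lead hn hl M) ord_max j).
move=> x; set L := lead _ _ _.
have LE i j : L i j = if (i == ord_max) && (j == ord_max) then x else lead hn hl M i j.
  rewrite !mxE.
  have -> : (widen_ord hn i == i0) = (i == ord_max) by rewrite -!val_eqE.
  have -> : (widen_ord hl j == j0) = (j == ord_max) by rewrite -!val_eqE.
  case: (eqVneq i ord_max) => [->|_]; case: (eqVneq j ord_max) => [->|_] /=; rewrite ?mulr0 ?addr0 //.
  rewrite (_ : widen_ord hn ord_max = i0); last exact: val_inj.
  rewrite (_ : widen_ord hl ord_max = j0); last exact: val_inj.
  by rewrite mulr1 addrC subrK.
clearbody L.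
have cofE j : cofactor L ord_max j = cofactor (lead hn hl M) ord_max j.
  rewrite /cofactor; congr (_ * \det _); apply/matrixP => a b.
  by rewrite 2![in LHS]mxE 2![in RHS]mxE LE eq_sym (negbTE (neq_lift _ _)).
rewrite (expand_det_row L ord_max) (bigD1 ord_max) //=; congr (_ + _); last first.
  by apply: eq_bigr => j hj; rewrite LE (negbTE hj) andbF cofE.
rewrite LE !eqxx cofE /cofactor -signr_odd addnn odd_double expr0 mul1r; congr (_ * \det _).
apply/matrixP => a b; rewrite !mxE; congr (M _ _); apply: val_inj => /=.
  by rewrite /bump leqNgt ltn_ord.
by rewrite /bump leqNgt ltn_ord.
Qed.

End LeadingMinor.

(* No measurability is needed: the integral of a nonnegative function is a
   supremum over the simple functions below it. *)
Lemma ge0_le_integral_any d (T : measurableType d) (R : realType)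
    (mu : {measure set T -> \bar R}) (f g : T -> \bar R) :
  (forall x, 0 <= f x)%E -> (forall x, f x <= g x)%E ->
  (\int[mu]_x f x <= \int[mu]_x g x)%E.
Proof.
move=> f0 fg; have g0 x : (0 <= g x)%E by exact: le_trans (f0 x) (fg x).
rewrite !ge0_integralTE //; apply: ereal_sup_le => _ [h hf <-]; exists h => // x.
exact: le_trans (hf x) (fg x).
Qed.

Section Expectation.
Context {d : measure_display} {T : measurableType d} {R : realType}.
Variables (P : probability T R) (n l : nat) (W : T -> 'M[R]_(n, l)).
Hypothesis gW : gaussian_mx P W.
Local Notation N := (@normal_prob R 0 1).
Local Notation V := 'M[R]_(n, l).

Lemma gaussian_meas i j : measurable_fun [set: T] (fun w => W w i j).
Proof. by have [h _] := gW; case: (h i j). Qed.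

Lemma normal_affine_null (a c : R) : a != 0 ->
  (\int[N]_x ((x * a + c == 0)%:R)%:E = 0)%E.
Proof.
move=> a0.
have E : (fun x : R => ((x * a + c == 0)%:R)%:E : \bar R) = fun x => (\1_[set - c / a] x)%:E.
  apply/funext => x; rewrite indicE; congr (nat_of_bool _)%:R%:E.
  apply/eqP/idP; rewrite in_setE /=.
    by move=> /eqP; rewrite addr_eq0 => /eqP <-; rewrite mulfK.
  by move=> ->; rewrite divfK // addNr.
rewrite E integral_indic // setIT.
have /null_content_dominatesP dom := normal_prob_dominates (0 : R) 1.
by apply: dom => //; exact: lebesgue_measure_set1.
Qed.

(** Induction on the size. Where the previous minor is nonzero, the next one is a nonconstant affine
    function of the resampled corner entry and vanishes at a single point; where it is zero, the
    inner integral is at most 1 and the induction hypothesis takes over. *)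
Lemma singular_null s (hn : (s <= n)%N) (hl : (s <= l)%N) :
  (\int[P]_w (singular hn hl (W w))%:E = 0)%E.
Proof.
elim: s hn hl => [|s IH] hn hl.
  rewrite (_ : (fun w => _) = cst 0%E) ?integral0 //.
  by apply/funext => w; rewrite /singular det_mx00 oner_eq0.
rewrite (resample_ge0 gW (Ordinal hn) (Ordinal hl)); [|exact: umeas_singular|exact: singular_ge0].
apply/eqP; rewrite eq_le; apply/andP; split; last first.
  by apply: integral_ge0 => w _; apply: integral_ge0 => x _; rewrite lee_fin singular_ge0.
rewrite -(IH (ltnW hn) (ltnW hl)).
apply: ge0_le_integral_any => w.
  by apply: integral_ge0 => x _; rewrite lee_fin singular_ge0.
have [c hc] := det_lead_affine hn hl (W w).
rewrite /singular; case: eqP => [_|/eqP d0].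
  apply: (@le_trans _ _ (\int[N]_x (cst 1%E x))%E); last first.
    rewrite integral_cst // mul1e.
    by rewrite (_ : _ setT = 1%E) //; exact: (probability_setT (N : probability _ R)).
  by apply: ge0_le_integral_any => x; rewrite /= lee_fin ?ler0n // lern1 leq_b1.
rewrite le_eqVlt; apply/orP; left; apply/eqP.
apply: etrans (normal_affine_null c d0) => //=; apply: eq_integral => x _.
by rewrite hc.
Qed.

Lemma singular_ae s (hn : (s <= n)%N) (hl : (s <= l)%N) :
  {ae P, forall w, \det (lead hn hl (W w)) != 0}.
Proof.
have m0 : measurable_fun [set: T] (fun w => (singular hn hl (W w))%:E).
  by apply/measurable_EFinP; apply: umeas_singular => i j; exact: gaussian_meas.
have /(ae_eq_integral_abs P measurableT m0) : (\int[P]_w `|(singular hn hl (W w))%:E| = 0)%E.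
  apply: etrans (singular_null hn hl); apply: eq_integral => w _.
  by rewrite gee0_abs // lee_fin singular_ge0.
apply: filterS => w /(_ I) [] /eqP; rewrite /singular pnatr_eq0.
by rewrite eqb0.
Qed.

Definition good (h : V -> R) := umeas h /\ growth h.

Lemma good_integrable h : good h -> P.-integrable [set: T] (fun w => (h (W w))%:E).
Proof. by move=> [m g]; exact: growth_expect gW _ m g. Qed.

Lemma good_cst c : good (fun=> c).
Proof. by split; [exact: umeas_cst|exact: growth_cst]. Qed.
Lemma goodD h g : good h -> good g -> good (fun M => h M + g M).
Proof. by move=> [m1 g1] [m2 g2]; split; [exact: umeasD|exact: growthD]. Qed.
Lemma goodN h : good h -> good (fun M => - h M).
Proof. by move=> [m1 g1]; split; [exact: umeasN|exact: growthN]. Qed.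
Lemma goodM h g : good h -> good g -> good (fun M => h M * g M).
Proof. by move=> [m1 g1] [m2 g2]; split; [exact: umeasM|exact: growthM]. Qed.
Lemma goodB h g : good h -> good g -> good (fun M => h M - g M).
Proof. by move=> h1 h2; apply: goodD => //; exact: goodN. Qed.
Lemma goodZ c h : good h -> good (fun M => c * h M).
Proof. by move=> h1; apply: goodM => //; exact: good_cst. Qed.
Lemma good_sum (I : Type) (r : seq I) (F : I -> V -> R) :
  (forall i, good (F i)) -> good (fun M => \sum_(i <- r) F i M).
Proof.
move=> gF; split; first by apply: umeas_sum => i; case: (gF i).
by apply: growth_sum => i; case: (gF i).
Qed.

Definition ex (h : V -> R) : R := (\int[P]_w h (W w))%R.

Lemma exE h : good h -> (\int[P]_w (h (W w))%:E = (ex h)%:E)%E.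
Proof.
move=> /good_integrable gh; rewrite /ex /Rintegral fineK //.
exact: integrable_fin_num.
Qed.

Lemma exD h g : good h -> good g -> ex (fun M => h M + g M) = ex h + ex g.
Proof. by move=> gh gg; rewrite /ex RintegralD //; exact: good_integrable. Qed.

Lemma exZ c h : good h -> ex (fun M => c * h M) = c * ex h.
Proof. by move=> gh; rewrite /ex RintegralZl //; exact: good_integrable. Qed.

Lemma exB h g : good h -> good g -> ex (fun M => h M - g M) = ex h - ex g.
Proof. by move=> gh gg; rewrite /ex RintegralB //; exact: good_integrable. Qed.

Lemma ex_le h g : good h -> good g -> (forall M, h M <= g M) -> ex h <= ex g.
Proof.
by move=> gh gg hg; rewrite /ex; apply: le_Rintegral => //; exact: good_integrable.
Qed.

Lemma ex_cst c : ex (fun=> c) = c.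
Proof.
rewrite /ex /Rintegral (_ : (fun=> _) = cst c%:E) // integral_cst //.
by rewrite (_ : _ setT = 1%E) ?mule1 //; exact: probability_setT.
Qed.

Lemma ex_ge0 h : good h -> (forall M, 0 <= h M) -> 0 <= ex h.
Proof. by move=> gh h0; rewrite -(ex_cst 0); apply: ex_le => //; exact: good_cst. Qed.

Lemma ex_sum (I : Type) (r : seq I) (F : I -> V -> R) :
  (forall i, good (F i)) -> ex (fun M => \sum_(i <- r) F i M) = \sum_(i <- r) ex (F i).
Proof.
move=> gF; elim: r => [|i r IH].
  under [X in ex X]eq_fun do rewrite big_nil; rewrite big_nil; exact: ex_cst.
under [X in ex X]eq_fun do rewrite big_cons; rewrite big_cons exD ?IH //.
exact: good_sum.
Qed.

Lemma eq_ex h g : h =1 g -> ex h = ex g.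
Proof. by move=> /funext ->. Qed.

Lemma stein_ex (i0 : 'I_n) (j0 : 'I_l) (f f' : V -> R) : good f -> good f' ->
  (forall M : V, is_derive (0 : R) (1 : R) (fun x : R => f (M + x *: delta_mx i0 j0)) (f' M)) ->
  (forall M : V, derivable (fun x : R => f' (M + x *: delta_mx i0 j0)) (0 : R) (1 : R)) ->
  ex (fun M => M i0 j0 * f M) = ex f'.
Proof.
move=> [mf gf] [mf' gf'] df df'.
have g1 : good (fun M => M i0 j0 * f M).
  by split; [apply: umeasM => //; exact: umeas_entry|apply: growthM => //; exact: growth_entry].
apply/eqP; rewrite -subr_eq0 -exB //; apply/eqP.
by rewrite /ex /Rintegral (stein_entry gW mf mf' gf gf' df df').
Qed.

(** Dominated convergence: the constant [c] dominates, and the rate, whose [B] may depend on [M], is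
    asked for only off the null set where the minor vanishes. *)
Lemma ex_vanish (g : nat -> V -> R) (c : R) s (hn : (s <= n)%N) (hl : (s <= l)%N) :
  (forall j, umeas (g j)) -> (forall j M, 0 <= g j M <= c) ->
  (forall M, \det (lead hn hl M) != 0 -> exists B, forall j, g j M <= B / j.+1%:R) ->
  forall eta, 0 < eta -> exists j, ex (g j) <= eta.
Proof.
move=> mg gc gB eta eta0.
have mgW j : measurable_fun [set: T] (fun w => (g j (W w))%:E).
  by apply/measurable_EFinP; apply: mg => a b; exact: gaussian_meas.
have gg j : good (g j).
  split=> //; exists c, 0%N => M; have /andP [h1 h2] := gc j M.
  by rewrite expr0 mulr1 ger0_norm.
have ic : P.-integrable [set: T] (cst c%:E) by exact: finite_measure_integrable_cst.
have ae1 : {ae P, forall w, [set: T] w -> (fun j => (g j (W w))%:E) @ \oo --> (cst 0%E w : \bar R)}.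
  apply: filterS (singular_ae hn hl) => w /gB [B hB] _ /=.
  apply: cvg_EFin; first by near=> k.
  apply: (@squeeze_cvgr _ _ _ _ (fun=> 0) (fun j => B * harmonic j)).
  + by near=> j; have /andP [-> _] := gc j (W w); exact: hB.
  + exact: cvg_cst.
  + rewrite -[X in _ --> X](mulr0 B); apply: cvgM; [exact: cvg_cst|exact: cvg_harmonic].
have ae2 : {ae P, forall w j, [set: T] w -> (`|(g j (W w))%:E| <= cst c%:E w)%E}.
  apply: aeW => w j _ /=; have /andP [h1 h2] := gc j (W w).
  by rewrite lee_fin ger0_norm.
have [_ _] := dominated_convergence measurableT mgW (measurable_cst _) ae1 ic ae2.
rewrite integral0 (_ : [sequence _]_j = fun j => (ex (g j))%:E); last first.
  by apply/funext => j; exact: exE.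
move=> h.
have /fine_cvgP [_] := h => /cvgrPdist_le /(_ _ eta0) [j _ /(_ j (leqnn j))] /=.
rewrite sub0r normrN => hj; exists j; exact: le_trans (ler_norm _) hj.
Unshelve. all: by end_near. Qed.

End Expectation.

(** * Matrix-valued functions of the Gaussian matrix and their Stein identity *)

Section MatrixFunctions.
Variables (R : realType) (n l : nat).
Local Notation C := (Num.ClosedField.sort (complex_complex__canonical__Num_ClosedField R)).
Local Notation Re := (@complex.Re R).
Local Notation V := 'M[R]_(n, l).
Local Notation cj := (map_mx Num.conj).

Lemma re_sqr_le_fsq m p (A : 'M[C]_(m, p)) i j : Re (A i j) ^+ 2 <= fsq A.
Proof.
rewrite fsqE (bigD1 i) //= (bigD1 j) //= -!addrA lerDl.
rewrite !addr_ge0 ?sqr_ge0 //; last by do 2![apply: sumr_ge0 => ? _]; rewrite addr_ge0 // sqr_ge0.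
by apply: sumr_ge0 => ? _; rewrite addr_ge0 // sqr_ge0.
Qed.

Definition mgood a b (F : V -> 'M[C]_(a, b)) := mreg F /\ growth (fun M => fsq (F M)).

Lemma mgood_cst a b (A : 'M[C]_(a, b)) : mgood (fun=> A).
Proof. by split; [exact: mreg_cst|exact: growth_cst]. Qed.

Lemma mgoodD a b (F G : V -> 'M[C]_(a, b)) : mgood F -> mgood G -> mgood (fun M => F M + G M).
Proof.
move=> [r1 g1] [r2 g2]; split; first exact: mregD.
apply: growth_le (growthM (growth_cst n l (2 : R)) (growthD g1 g2)) => M.
rewrite ger0_norm ?fsq_ge0 //; have := fsqDS (F M) (G M) ltr01.
by rewrite invr1; move: (fsq _) (fsq _) (fsq _) => x y z; lra.
Qed.

Lemma mgoodN a b (F : V -> 'M[C]_(a, b)) : mgood F -> mgood (fun M => - F M).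
Proof.
move=> [r1 g1]; split; first exact: mregN.
by apply: eq_growth g1 => M; rewrite fsqN.
Qed.

Lemma mgoodB a b (F G : V -> 'M[C]_(a, b)) : mgood F -> mgood G -> mgood (fun M => F M - G M).
Proof. by move=> h1 h2; apply: mgoodD => //; exact: mgoodN. Qed.

Lemma mgoodM a b c (F : V -> 'M[C]_(a, b)) (G : V -> 'M[C]_(b, c)) :
  mgood F -> mgood G -> mgood (fun M => F M *m G M).
Proof.
move=> [r1 g1] [r2 g2]; split; first exact: mregM.
apply: growth_le (growthM g1 g2) => M.
rewrite ger0_norm ?fsq_ge0 //; exact: fsqM.
Qed.

Lemma mgood_adj a b (F : V -> 'M[C]_(a, b)) : mgood F -> mgood (fun M => (F M)^t*).
Proof.
move=> [r1 g1]; split; first exact: mreg_adj.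
by apply: eq_growth g1 => M; rewrite fsq_adj.
Qed.

Lemma mgoodJ a b (F : V -> 'M[C]_(a, b)) : mgood F -> mgood (fun M => cj (F M)).
Proof.
move=> [r1 g1]; split; first exact: mregJ.
by apply: eq_growth g1 => M; rewrite fsq_conj.
Qed.

Lemma mgood_cmx : mgood (@cmx R n l).
Proof.
split; first exact: mreg_cmx.
apply: growth_le (growth_sz R n l) => M; rewrite ger0_norm ?fsq_ge0 // fsqE /sz.
rewrite pair_big /= ler_wpDl //; apply: ler_sum => -[i j] _ /=.
by rewrite !mxE /= expr0n /= addr0.
Qed.

Lemma good_re a b (F : V -> 'M[C]_(a, b)) i j : mgood F -> good (fun M => Re (F M i j)).
Proof.
move=> [r1 g1]; split; first by have [[]] := r1 i j.
apply: growth_le (growthD (growth_cst n l (1 : R)) g1) => M.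
have := re_sqr_le_fsq (F M) i j; rewrite -(real_normK (num_real (Re _))).
move: `|_| (fsq _) => x y; nra.
Qed.

Lemma good_rtr a (F : V -> 'M[C]_a) : mgood F -> good (fun M => rtr (F M)).
Proof.
move=> gF; have -> : (fun M => rtr (F M)) = fun M => \sum_i Re (F M i i).
  by apply/funext => M; rewrite rtrE /mxtrace (raddf_sum (@complex.Re R : Rcomplex R -> R)).
by apply: good_sum => i; exact: good_re.
Qed.

Lemma good_fsq a b (F : V -> 'M[C]_(a, b)) : mgood F -> good (fun M => fsq (F M)).
Proof.
move=> gF; have -> : (fun M => fsq (F M)) = fun M => rtr ((F M)^t* *m F M).
  by apply/funext => M; rewrite fsqC.
by apply: good_rtr; apply: mgoodM => //; exact: mgood_adj.
Qed.

Lemma good_qf a b (A : 'M[C]_a) (F : V -> 'M[C]_(a, b)) : mgood F -> good (fun M => qf A (F M)).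
Proof.
move=> gF; have -> : (fun M => qf A (F M)) = fun M => rtr ((F M)^t* *m A *m F M).
  by apply/funext => M; rewrite qfE.
apply: good_rtr; apply: mgoodM => //; apply: mgoodM; last exact: mgood_cst.
exact: mgood_adj.
Qed.

Variables (H : 'M[C]_n) (d : R).
Hypotheses (Hp : psd H) (d0 : 0 < d).
Local Notation W := (@cmx R n l).
Local Notation rg := (fun M => ridge H d (W M)).
Local Notation cf := (fun M => coefm H d (W M)).
Local Notation df := (fun M => defect H d (W M)).
Local Notation rs := (fun M => resid H d (W M)).

Lemma mreg_gramd : mreg (fun M => gramd H d (W M)).
Proof.
apply: mregD; last exact: mreg_cst.
apply: mregM; last exact: mreg_cmx.
apply: mregM; last exact: mreg_cst.
by apply: mreg_adj; exact: mreg_cmx.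
Qed.

Lemma mgood_ridge : mgood rg.
Proof.
split; first by apply: mreg_inv => [|M]; [exact: mreg_gramd|exact: gramd_unit].
apply: growth_le (growth_cst n l (l%:R / d ^+ 2)) => M.
by rewrite ger0_norm ?fsq_ge0 //; exact: fsq_ridge.
Qed.

Lemma mgood_coefm : mgood cf.
Proof.
apply: mgoodM; last exact: mgood_cst.
by apply: mgoodM; [exact: mgood_ridge|apply: mgood_adj; exact: mgood_cmx].
Qed.

Lemma mgood_defect : mgood df.
Proof.
apply: mgoodB; first exact: mgood_cst.
by apply: mgoodM; [exact: mgood_cmx|exact: mgood_coefm].
Qed.

Lemma mgood_resid : mgood rs.
Proof. by apply: mgoodM; [exact: mgood_cst|exact: mgood_defect]. Qed.

Lemma is_mder_defect M E : is_mder df M E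
  (- (df M *m W E *m cf M) - W M *m rg M *m (W E)^t* *m rs M).
Proof.
have dW := is_mder_cmx M E.
have dWa := is_mder_adj dW.
have dG : is_mder (fun M => gramd H d (W M)) M E
    ((W E)^t* *m H *m W M + (W M)^t* *m H *m W E).
  have := is_mderD (is_mderM (is_mderM dWa (is_mder_cst H M E)) dW) (is_mder_cst d%:C%:M M E).
  by rewrite mulmx0 !addr0.
have dK := is_mder_inv mreg_gramd (fun M => gramd_unit (W M) Hp d0) dG.
have dY := is_mderM (is_mderM dK dWa) (is_mder_cst H M E).
rewrite mulmx0 addr0 in dY.
have h := is_mderD (is_mder_cst 1%:M M E) (is_mderN (is_mderM dW dY)).
rewrite add0r in h.
exact: (eq_ind _ (fun Z => is_mder df M E Z) h _
  (defect_derivative (W M) (W E) H (ridge H d (W M)))).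
Qed.

Lemma cmx_delta i j : W (delta_mx i j) = delta_mx i j.
Proof. by apply/matrixP => a b; rewrite !mxE; case: (_ && _). Qed.

Lemma cmx_conj M : cj (W M) = W M.
Proof. by apply/matrixP => a b; rewrite !mxE conjCE conjc_real. Qed.

Lemma adj_delta i j : (delta_mx i j : 'M[C]_(n, l))^t* = delta_mx j i.
Proof. by rewrite trmx_delta map_delta_mx. Qed.

Variable A : 'M[C]_n.
Let F M := (df M)^t* *m A *m W M.
Let dF i j M :=
  (- ((cf M)^t* *m delta_mx j i *m (df M)^t* ) -
   rs M *m delta_mx i j *m (rg M *m (W M)^t* )) *m A *m W M + (df M)^t* *m A *m delta_mx i j.

Let mgood_F : mgood F.
Proof.
apply: mgoodM; last exact: mgood_cmx.
by apply: mgoodM; [apply: mgood_adj; exact: mgood_defect|exact: mgood_cst].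
Qed.

Let mgood_dF i j : mgood (dF i j).
Proof.
have g1 := mgood_adj mgood_coefm; have g2 := mgood_adj mgood_defect.
have g3 := mgood_adj mgood_cmx.
apply: mgoodD; last by apply: mgoodM; [apply: mgoodM => //; exact: mgood_cst|exact: mgood_cst].
apply: mgoodM; last exact: mgood_cmx.
apply: mgoodM; last exact: mgood_cst.
apply: mgoodB.
  by apply: mgoodN; apply: mgoodM => //; apply: mgoodM => //; exact: mgood_cst.
apply: mgoodM; first by apply: mgoodM; [exact: mgood_resid|exact: mgood_cst].
by apply: mgoodM => //; exact: mgood_ridge.
Qed.

Let is_mder_F i j M : is_mder F M (delta_mx i j) (dF i j M).
Proof.
have E : (- (df M *m W (delta_mx i j) *m cf M) - W M *m rg M *m (W (delta_mx i j))^t* *m rs M)^t* =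
    - ((cf M)^t* *m delta_mx j i *m (df M)^t* ) - rs M *m delta_mx i j *m (rg M *m (W M)^t* ).
  rewrite cmx_delta -(adj_delta i j).
  exact: adj_defect_derivative (psd_adj (resid_psd (W M) Hp d0)) (ridge_adj (W M) Hp d0).
have h1 := eq_ind _ (fun Z => is_mder (fun M => (df M)^t* ) M (delta_mx i j) Z)
  (is_mder_adj (is_mder_defect M (delta_mx i j))) _ E.
have h2 := eq_ind _ (fun Z => is_mder W M (delta_mx i j) Z)
  (is_mder_cmx M (delta_mx i j)) _ (cmx_delta i j).
exact: is_mderM (is_mderMr A h1) h2.
Qed.

(** This lets the real part pass through the product of two traces in the divergence. *)
Lemma im_rtr_resid M : complex.Im (\tr (rs M)) = 0.
Proof.
have : (\tr (rs M))^*%R = \tr (rs M).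
  rewrite -[in RHS](psd_adj (resid_psd (W M) Hp d0)).
  by rewrite /mxtrace rmorph_sum; apply: eq_bigr => i _; rewrite !mxE.
by rewrite conjCE; case: (\tr _) => x y [] /= h; lra.
Qed.

Context {disp : measure_display} {T : measurableType disp}.
Variables (P : probability T R) (X : T -> V).
Hypothesis gX : gaussian_mx P X.
Local Notation ex := (ex P X).

(** Pairing the field [Xi^* A W] with [W] collapses by [W^* Xi^* = d K W^*], whence the small factor
    [d] on the left. The right side is the divergence, in which the ridge residual appears
    multiplied by [tr (K W^* A W)]. *)
Lemma stein_divergence :
  ex (fun M => d * rtr (rg M *m ((W M)^t* *m A *m W M))) =
  ex (fun M => (l%:R - 1) * rtr ((df M)^t* *m A) + rtr ((df M)^t* *m A *m cj (df M)) -
               rtr (rs M) * rtr (rg M *m ((W M)^t* *m A *m W M))).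
Proof.
transitivity (ex (fun M => \sum_i \sum_j M i j * Re (F M i j))).
  apply: eq_ex => M.
  have E1 : (W M)^t* *m F M = d%:C *: (rg M *m ((W M)^t* *m A *m W M)).
    have h : (W M)^t* *m (df M)^t* = d%:C *: (rg M *m (W M)^t* ).
      rewrite -adjmxM (defect_W (W M) Hp d0) adjmxZr adjmxM.
      by rewrite (ridge_adj (W M) Hp d0).
    exact: mulmx_scale_shift.
  rewrite -rtrZ -E1 rtrE /mxtrace (raddf_sum (@complex.Re R : Rcomplex R -> R)) exchange_big /=.
  apply: eq_bigr => j _; rewrite mxE (raddf_sum (@complex.Re R : Rcomplex R -> R)) /=.
  apply: eq_bigr => i _; rewrite -[LHS]/(Re (((W M)^t* j i : C) * (F M i j : C))) cReM.
  have -> : (W M)^t* j i = (M i j)%:C by rewrite !mxE conjCE conjc_real.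
  by rewrite /= mul0r subr0.
have gs i j : good (fun M : V => M i j * Re (F M i j)).
  apply: goodM; last exact: good_re.
  by split; [exact: umeas_entry|exact: growth_entry].
transitivity (ex (fun M => \sum_i \sum_j Re (dF i j M i j))).
  rewrite (ex_sum gX _ (F := fun i M => \sum_j M i j * Re (F M i j))); last first.
    by move=> i; exact: good_sum.
  rewrite (ex_sum gX _ (F := fun i M => \sum_j Re (dF i j M i j))); last first.
    by move=> i; apply: good_sum => j; exact: good_re.
  apply: eq_bigr => i _; rewrite (ex_sum gX _ (F := fun j M => M i j * Re (F M i j))) //.
  rewrite (ex_sum gX _ (F := fun j M => Re (dF i j M i j))); last first.
    by move=> j; exact: good_re.
  apply: eq_bigr => j _; apply: stein_ex => //; try exact: good_re.
    by move=> M; have [h _] := is_mder_F i j M i j.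
  move=> M; have [r _] := mgood_dF i j; have [_ dd] := r i j.
  by have [z [h _]] := dd M (delta_mx i j); case: h.
apply: eq_ex => M.
have := divergence_trace A (rs M) (rg M) (cmx_conj M) (erefl ((cf M)^t* )).
move=> /(congr1 (@complex.Re R)).
rewrite (raddf_sum (@complex.Re R : Rcomplex R -> R)) /=.
under eq_bigr => i _ do rewrite (raddf_sum (@complex.Re R : Rcomplex R -> R)) /=.
move=> ->; rewrite cReD cReN cReM im_rtr_resid mul0r subr0 !rtrE.
rewrite cReD cReD cReN -(rmorph_nat (real_complex R)) cReM /= mul0r subr0.
by congr (_ - _); rewrite mulrBl mul1r.
Qed.

End MatrixFunctions.

(** * The supremum argument *)

Section OneStep.
Variables (R : realType) (n l k : nat).
Local Notation C := (Num.ClosedField.sort (complex_complex__canonical__Num_ClosedField R)).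
Local Notation V := 'M[R]_(n, l).
Local Notation cj := (map_mx Num.conj).
Local Notation W := (@cmx R n l).
Context {disp : measure_display} {T : measurableType disp}.
Variables (P : probability T R) (X : T -> V).
Hypothesis gX : gaussian_mx P X.
Local Notation ex := (ex P X).

Lemma psd_defect_adj (A Xi : 'M[C]_n) : psd A -> rtr (Xi^t* *m A) = rtr (A *m Xi).
Proof. by move=> Ap; rewrite -[LHS]rtr_adj adjmxM trmxCK (psd_adj Ap). Qed.

Lemma rtr_mul_psd_ge0 m (K A : 'M[C]_m) : psd K -> psd A -> 0 <= rtr (K *m A).
Proof.
move=> Kp [q [B ->]]; rewrite mulmxA rtr_mulC mulmxA.
have := psd_congr (B^t*) Kp; rewrite trmxCK => /psd_rtr_ge0; exact.
Qed.

(** Inversion reverses the order of positive matrices. With [G = B^* B], Young's inequality for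
    [B Kb] and [B K] gives [2 tr K <= tr Kb + |B K|^2], and [|B K|^2 <= tr K]. *)
Lemma rtr_inv_anti m (G D K Kb : 'M[C]_m) : psd G -> psd D ->
  Kb^t* = Kb -> K^t* = K -> Kb *m G = 1%:M -> G *m Kb = 1%:M -> (G + D) *m K = 1%:M ->
  rtr K <= rtr Kb.
Proof.
move=> [t [B GB]] Dp hb hk KG GK GDK.
have h := rtr_AMGM (B *m Kb) (B *m K) ltr01.
have e1 : rtr ((B *m Kb)^t* *m (B *m K)) = rtr K.
  by rewrite adjmxM mulmxA -(mulmxA _ _ B) -GB hb KG mul1mx.
have e2 : fsq (B *m Kb) = rtr Kb.
  by rewrite -qf_fsq -GB qfE -mulmxA GK mulmx1 hb.
have e3 : fsq (B *m K) <= rtr K.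
  have e4 : qf (G + D) K = rtr K by rewrite qfE -mulmxA GDK mulmx1 hk.
  by rewrite -[leRHS]e4 qfD GB qf_fsq lerDl; exact: qf_ge0.
by move: h; rewrite e1 e2 invr1 !mul1r => h; lra.
Qed.

Lemma rtr_ridge_anti m q (H H' : 'M[C]_m) (Z : 'M[C]_(m, q)) (d : R) :
  psd H -> psd H' -> 0 < d -> rtr (ridge (H + H') d Z) <= rtr (ridge H d Z).
Proof.
move=> Hp Hp' d0; have HHp := psdD Hp Hp'.
apply: (@rtr_inv_anti _ (gramd H d Z) (Z^t* *m H' *m Z)).
- apply: psdD; first exact: psd_congr.
  by rewrite -scalemx1; apply: psdZ; [exact: ltW|exact: psd1].
- exact: psd_congr.
- exact: ridge_adj.
- exact: ridge_adj.
- exact: Kgramd.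
- exact: gramdK.
- have <- : gramd (H + H') d Z = gramd H d Z + Z^t* *m H' *m Z.
    by rewrite /gramd mulmxDr mulmxDl addrAC.
  exact: gramdK.
Qed.

Variables (V1 : 'M[C]_(n, k)).
Hypothesis V1u : V1^t* *m V1 = 1%:M.
Local Notation P1 := (V1 *m V1^t*).
Local Notation P2 := (1%:M - V1 *m V1^t*).

Lemma psd_P1 : psd P1.
Proof. by exists k, (V1^t*); rewrite trmxCK. Qed.

Lemma P1_idem : P1 *m P1 = P1.
Proof. by rewrite mulmxA -(mulmxA V1) V1u mulmx1. Qed.

Lemma P2_idem : P2 *m P2 = P2.
Proof. by rewrite mulmxBl mul1mx mulmxBr mulmx1 P1_idem subrr subr0. Qed.

Lemma P1P2 : P1 *m P2 = 0.
Proof. by rewrite mulmxBr mulmx1 P1_idem subrr. Qed.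

Lemma P2_adj : P2^t* = P2.
Proof. by rewrite adjmxB adjmx1 (psd_adj psd_P1). Qed.

Lemma psd_P2 : psd P2.
Proof. by exists n, P2; rewrite P2_adj P2_idem. Qed.

Lemma rtr_P1 : rtr P1 = k%:R.
Proof. by rewrite rtr_mulC V1u rtr1. Qed.

Lemma rtr_P2_le : rtr P2 <= n%:R.
Proof. by rewrite rtrB rtr1 rtr_P1 lerBlDr lerDl ler0n. Qed.

Lemma qf_P1 q (Z : 'M[C]_(n, q)) : qf P1 Z = fsq (P1 *m Z).
Proof. by rewrite -qf_fsq (psd_adj psd_P1) P1_idem. Qed.

Lemma qf_P2 q (Z : 'M[C]_(n, q)) : qf P2 Z = fsq (P2 *m Z).
Proof. by rewrite -qf_fsq P2_adj P2_idem. Qed.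

Variables (lam d : R).
Hypotheses (lam0 : 0 < lam) (d0 : 0 < d) (hkl : (k + 2 <= l)%N).
Local Notation Hh H2 := (lam%:C *: P1 + H2).

Definition admissible (H2 : 'M[C]_n) := psd H2 /\ P1 *m H2 = 0.

Lemma psd_Hh H2 : psd H2 -> psd (Hh H2).
Proof. by move=> h; apply: psdD => //; apply: psdZ; [exact: ltW|exact: psd_P1]. Qed.

Definition mean_resid H2 := ex (fun M => rtr (resid (Hh H2) d (W M))).
Definition mean_qf H2 A := ex (fun M => qf A (defect (Hh H2) d (W M))).

Section Fixed.
Variable H2 : 'M[C]_n.
Hypothesis adm : admissible H2.
Let Hp : psd H2 := adm.1.
Let HHp : psd (Hh H2) := psd_Hh adm.1.
Let gd : mgood (fun M : V => defect (Hh H2) d (W M)).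
Proof. exact: mgood_defect. Qed.
Let gr : mgood (fun M : V => resid (Hh H2) d (W M)).
Proof. exact: mgood_resid. Qed.
Let gk : mgood (fun M : V => ridge (Hh H2) d (W M)).
Proof. exact: mgood_ridge. Qed.

Lemma good_resid_tr : good (fun M => rtr (resid (Hh H2) d (W M))).
Proof. exact: good_rtr gr. Qed.

Lemma good_defect_qf A : good (fun M => qf A (defect (Hh H2) d (W M))).
Proof. exact: good_qf gd. Qed.

Lemma rtr_resid_ge0 M : 0 <= rtr (resid (Hh H2) d (W M)).
Proof. exact: psd_rtr_ge0 (resid_psd (W M) HHp d0). Qed.

Lemma rtr_resid_split M : rtr (resid (Hh H2) d (W M)) =
  lam * qf P1 (defect (Hh H2) d (W M)) + qf H2 (defect (Hh H2) d (W M)) +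
  d * fsq (coefm (Hh H2) d (W M)).
Proof. by rewrite (rtr_resid (W M) HHp d0) /cost qfD qfZ. Qed.

(** The mean of [r t] is bounded above by the Stein identity, after dropping [d t >= 0], and below
    through [t >= l - k - kap]. The error [r kap] is linearized by [r <= lam k + tr H2]. Computing
    [kap] from the lower bound [b] of [H] makes it independent of [H2], as uniformity over
    competitors demands. *)
Lemma one_step (b : R) : 0 < b -> (exists2 H', psd H' & Hh H2 = b%:C%:M + H') ->
  (l%:R - k%:R) * mean_resid H2 -
    (lam * k%:R + rtr H2) * ex (fun M => d * rtr (ridge (b%:C%:M) d (W M))) <=
  (l%:R - 1) * rtr H2 + 2^-1 * (mean_qf H2 H2 + mean_qf H2 (cj H2)).
Proof.
move=> b0 [H' Hp' HE].
have bp : psd (b%:C%:M : 'M[C]_n).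
  by rewrite -scalemx1; apply: psdZ; [exact: ltW|exact: psd1].
pose t M := rtr (ridge (Hh H2) d (W M) *m ((W M)^t* *m H2 *m W M)).
pose r M := rtr (resid (Hh H2) d (W M)).
pose kap M := d * rtr (ridge (b%:C%:M) d (W M)).
pose Xi M := defect (Hh H2) d (W M).
have gt : good t.
  apply: good_rtr; apply: mgoodM => //; apply: mgoodM; last exact: mgood_cmx.
  by apply: mgoodM; [apply: mgood_adj; exact: mgood_cmx|exact: mgood_cst].
have gkap : good kap by apply: goodZ; apply: good_rtr; exact: mgood_ridge.
have gr' : good r := good_resid_tr.
have ga : good (fun M => rtr ((Xi M)^t* *m H2)).
  by apply: good_rtr; apply: mgoodM; [apply: mgood_adj; exact: gd|exact: mgood_cst].
have gb : good (fun M => rtr ((Xi M)^t* *m H2 *m cj (Xi M))).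
  apply: good_rtr; apply: mgoodM; last by apply: mgoodJ; exact: gd.
  by apply: mgoodM; [apply: mgood_adj; exact: gd|exact: mgood_cst].
have q1 : good (fun M => qf H2 (Xi M)) := good_defect_qf H2.
have q2 : good (fun M => qf (cj H2) (Xi M)) := good_defect_qf (cj H2).
have l1 : 1 <= l%:R :> R by rewrite ler1n; apply: leq_trans hkl; rewrite addn2.
have st := stein_divergence HHp d0 H2 gX.
have tge M : l%:R - k%:R - kap M <= t M.
  have h1 := rtr_ridge_tail (W M) d0 V1 (ltW lam0) Hp; cbv zeta in h1.
  have h2 : rtr (ridge (Hh H2) d (W M)) <= rtr (ridge (b%:C%:M) d (W M)).
    by rewrite HE; exact: rtr_ridge_anti.
  have h3 := ler_wpM2l (ltW d0) h2.
  apply: le_trans h1; exact: lerB (lexx _) h3.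
have t0 M : 0 <= t M.
  by apply: rtr_mul_psd_ge0; [exact: ridge_psd|exact: psd_congr].
have r0 M : 0 <= r M by exact: rtr_resid_ge0.
have kap0 M : 0 <= kap M.
  by apply: mulr_ge0; [exact: ltW|exact: psd_rtr_ge0 (ridge_psd (W M) bp d0)].
have rle M : r M <= lam * k%:R + rtr H2.
  apply: le_trans (rtr_resid_le (W M) HHp d0) _.
  by rewrite rtrD rtrZ rtr_P1.
have e1 : ex (fun M => r M * t M) <= (l%:R - 1) * rtr H2 + 2^-1 * (mean_qf H2 H2 + mean_qf H2 (cj H2)).
  have -> : mean_qf H2 H2 + mean_qf H2 (cj H2) =
      ex (fun M => qf H2 (Xi M) + qf (cj H2) (Xi M)) by rewrite (exD gX q1 q2).
  have gq := goodD q1 q2.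
  rewrite -(exZ gX _ gq) -[X in X + _](ex_cst P X).
  rewrite -(exD gX (good_cst _ _ _) (goodZ _ gq)).
  have st2 : ex (fun M => d * t M + r M * t M) =
    ex (fun M => (l%:R - 1) * rtr ((Xi M)^t* *m H2) + rtr ((Xi M)^t* *m H2 *m cj (Xi M))).
    rewrite (exD gX (goodZ d gt) (goodM gr' gt)).
    have -> : ex (fun M => d * t M) = ex (fun M =>
        ((l%:R - 1) * rtr ((Xi M)^t* *m H2) + rtr ((Xi M)^t* *m H2 *m cj (Xi M))) - r M * t M) by exact: st.
    rewrite (exB gX (goodD (goodZ _ ga) gb) (goodM gr' gt)) subrK.
    by [].
  apply: (@le_trans _ _ (ex (fun M => d * t M + r M * t M))).
    apply: (ex_le gX) => [||M]; first exact: goodM.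
      by apply: goodD; [exact: goodZ|exact: goodM].
    by rewrite lerDr; apply: mulr_ge0 => //; exact: ltW.
  rewrite st2; apply: (ex_le gX) => [||M].
  - by apply: goodD => //; exact: goodZ.
  - by apply: goodD; [exact: good_cst|exact: goodZ].
  apply: lerD.
    rewrite ler_wpM2l ?subr_ge0 // psd_defect_adj //.
    exact: rtr_tail_defect psd_P1 Hp (ltW lam0) adm.2.
  have := rtr_bilinear_le (Xi M) Hp.
  by move: (rtr _) (qf _ _) (qf _ _) => x y z; lra.
apply: le_trans e1; rewrite /mean_resid -(exZ gX _ gr') -(exZ gX _ gkap).
rewrite -(exB gX (goodZ _ gr') (goodZ _ gkap)).
apply: (ex_le gX) => [||M]; [by apply: goodB; exact: goodZ|exact: goodM|].
move: (tge M) (t0 M) (r0 M) (kap0 M) (rle M); rewrite -/(r M).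
move: (t M) (r M) (kap M) (rtr H2) (lam * k%:R) (l%:R - k%:R) => t' r' k' a c q; nra.
Qed.

End Fixed.
End OneStep.

Lemma near_square_arith (R : realFieldType) (e N phi g : R) :
  0 < e -> e <= 1 / 4 -> 0 <= e * N -> e * N <= 1 / 4 -> 0 <= phi -> g <= (1 + 3 * e) * phi ->
  (1 + e) * (e + (1 + 2 * e * N) * g) <= 2 * e + (1 + (2 * N + 8) * e) * phi.
Proof.
move=> e0 e4 eN0 eN phi0 g2.
have h1 : (1 + 2 * e * N) * g <= (1 + 2 * e * N) * ((1 + 3 * e) * phi).
  by apply: ler_wpM2l; lra.
have h2 : (1 + e) * ((1 + 2 * e * N) * (1 + 3 * e)) <= 1 + (2 * N + 8) * e.
  have h3 : (1 + e) * (1 + 3 * e) <= 1 + 5 * e by nra.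
  have h4 : (1 + 2 * (e * N)) * ((1 + e) * (1 + 3 * e)) <= (1 + 2 * (e * N)) * (1 + 5 * e).
    by apply: ler_wpM2l; lra.
  have h5 : (e * N) * e <= 1 / 4 * e by apply: ler_wpM2r; lra.
  lra.
have h3 := ler_wpM2r phi0 h2.
have h4 : (1 + e) * ((1 + 2 * e * N) * g) <= (1 + e) * ((1 + 2 * e * N) * ((1 + 3 * e) * phi)).
  by apply: ler_wpM2l => //; lra.
have h5 : (1 + e) * e <= 2 * e by nra.
lra.
Qed.

Lemma combine_arith (R : realFieldType) (p L N e phi R2 K Q1 Q2 x : R) :
  0 < e -> e <= 1 / 4 -> 2 <= p -> 0 <= N -> 0 <= phi -> x <= L -> K <= e ->
  (1 - 3 / 2 * e) * (phi - e ^+ 2) <= R2 -> R2 <= phi -> Q1 <= R2 ->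
  Q2 <= 2 * e + (1 + (2 * N + 8) * e) * phi + 2 * e * phi ->
  p * R2 - K <= x + 2^-1 * (Q1 + Q2) ->
  (p - 1 - (2 * p + N + 6) * e) * phi <= L + (p + 2) * e.
Proof.
move=> e0 e4 p2 N0 phi0 Lt Ke R2low R2phi Q1R Q2b one.
have p0 : 0 <= p by lra.
have pR := ler_wpM2l p0 R2low.
have h : (1 - 3 / 2 * e) * e ^+ 2 <= e by clear -e0 e4; nra.
have pe := ler_wpM2l p0 h.
have ep : 0 <= e * phi by rewrite mulr_ge0 // ltW.
have pep : 0 <= p * (e * phi) by rewrite mulr_ge0.
have Nep : 0 <= N * (e * phi) by rewrite mulr_ge0.
clear h R2low; lra.
Qed.

(** Numerical end of [sup_step], with [p = l - k], [L = l - 1], [N = n]. At the defect of the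
    competitor, [g], [a], [u], [eP] are the mean quadratic forms of [G], [A1], [P2], [P1]; [c] is
    its head cost, [y] its penalty and [t] its trace. [R2] and [RG] are the mean residuals of the
    competitor and of the near maximizer. *)
Lemma sup_arith (R : realFieldType) (p L N e e1 phi lam c g a u y t R2 RG K Q1 Q2 eP : R) :
  2 <= p -> 0 <= L -> 0 <= N -> 0 < e -> 4 * (N + 1) * e <= 1 ->
  e1 = e * (1 + 2 * e * N) -> 1 <= e ^+ 2 * lam ->
  0 <= g -> 0 <= a -> 0 <= u -> 0 <= y -> 0 <= eP -> c = lam * eP -> t <= 1 ->
  R2 = c + ((1 - e1) * g + e * a + e * (2 * e) * u) + y -> R2 <= phi ->
  RG <= c + g + y -> phi - e ^+ 2 <= RG -> K <= e ->
  p * R2 - K <= L * t + 2^-1 * (Q1 + Q2) -> Q1 <= R2 ->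
  Q2 <= (1 + e) * (a + 2 * e * u) + (1 + e^-1) * eP ->
  (p - 1 - (2 * p + N + 6) * e) * phi <= L + (p + 2) * e.
Proof.
move=> p2 L0 N0 e0 Ne e1E elam g0 a0 u0 y0 eP0 cE t1 R2E R2phi RGle phiRG Ke one Q1R Q2le.
have lam0 : 0 < lam.
  by rewrite -(pmulr_rgt0 _ (exprn_gt0 2 e0)); apply: lt_le_trans elam.
have c0 : 0 <= c by rewrite cE mulr_ge0 // ltW.
have eN : e * N <= 1 / 4 by nra.
have e4 : e <= 1 / 4 by nra.
have eN0 : 0 <= e * N by rewrite mulr_ge0 // ltW.
have e1b : e1 <= 3 / 2 * e by rewrite e1E; nra.
have e10 : 0 <= e1 by rewrite e1E; nra.
have phi0 : 0 <= phi.
  apply: le_trans R2phi; rewrite R2E; nra.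
have eg : 0 <= e * a by rewrite mulr_ge0 // ltW.
have eu : 0 <= e * u by rewrite mulr_ge0 // ltW.
have eeu : 0 <= e * (2 * e) * u by rewrite !mulr_ge0 // ltW.
have g1 : (1 - e1) * g <= phi by lra.
have g2 : g <= (1 + 3 * e) * phi.
  have h1 : (1 + 2 * e1) * ((1 - e1) * g) <= (1 + 2 * e1) * phi by apply: ler_wpM2l; lra.
  have h2 : 1 <= (1 + 2 * e1) * (1 - e1) by nra.
  have h3 : g <= (1 + 2 * e1) * (1 - e1) * g by rewrite -[leLHS]mul1r; apply: ler_wpM2r.
  have h4 : (1 + 2 * e1) * phi <= (1 + 3 * e) * phi by apply: ler_wpM2r; lra.
  rewrite -mulrA in h3; lra.
(* Near maximality: from [R2 <= phi <= RG + e^2] and [RG <= c + g + y], the gain [e a + 2 e^2 u]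
   exceeds the loss [e1 g] by at most [e^2]. Dividing by [e] controls the conjugate form [a] by
   [g]. *)
have au : a + 2 * e * u <= e + (1 + 2 * e * N) * g.
  have h : e * (a + 2 * e * u) <= e * (e + (1 + 2 * e * N) * g).
    have : e * a + e * (2 * e) * u <= e ^+ 2 + e1 * g by lra.
    rewrite e1E; nra.
  by rewrite ler_pM2l in h.
(* Since [lam eP = c <= phi] and [lam >= e^-2], the part of the defect in the head is negligible
   even after the factor [1 + 1 / e]. *)
have ePb : (1 + e^-1) * eP <= 2 * e * phi.
  have h1 : eP <= e ^+ 2 * phi.
    apply: (@le_trans _ _ (e ^+ 2 * lam * eP)).
      by rewrite -[leLHS]mul1r; apply: ler_wpM2r.
    rewrite -mulrA ler_pM2l ?exprn_gt0 // -cE.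
    by apply: le_trans R2phi; rewrite R2E; nra.
  have ei : 0 <= 1 + e^-1 by rewrite addr_ge0 // invr_ge0 ltW.
  apply: le_trans (ler_wpM2l ei h1) _.
  rewrite mulrA ler_wpM2r // expr2 mulrDl mul1r mulrA mulVf ?gt_eqF // mul1r; nra.
have R2low : (1 - 3 / 2 * e) * (phi - e ^+ 2) <= R2.
  have h1 : (1 - e1) * RG <= R2.
    apply: (@le_trans _ _ ((1 - e1) * (c + g + y))); first by apply: ler_wpM2l; lra.
    by rewrite R2E; nra.
  have [h2|h2] := leP 0 (phi - e ^+ 2).
    apply: le_trans h1; apply: (@le_trans _ _ ((1 - e1) * (phi - e ^+ 2))).
      by apply: ler_wpM2r => //; lra.
    by apply: ler_wpM2l; lra.
  apply: (@le_trans _ _ 0); first by rewrite nmulr_lle0 //; lra.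
  by rewrite R2E; nra.
have prod := near_square_arith e0 e4 eN0 eN phi0 g2.
have Q2b : Q2 <= 2 * e + (1 + (2 * N + 8) * e) * phi + 2 * e * phi.
  apply: le_trans Q2le _; apply: lerD => //; apply: le_trans prod.
  by apply: ler_wpM2l => //; lra.
have Lt : L * t <= L by rewrite -[leRHS]mulr1; apply: ler_wpM2l.
exact: combine_arith e0 e4 p2 N0 phi0 Lt Ke R2low R2phi Q1R Q2b one.
Qed.

Lemma abel_rearrange (Z : zmodType) (x a b c t : Z) :
  x + (a + (b + c)) = t + c + (x - t + (a + b)).
Proof. by rewrite [RHS]addrACA subrKC [c + _]addrC -[in RHS]addrA. Qed.

Lemma trace_arith (R : realFieldType) (e w N x y z : R) :
  (1 - e * (1 + w * N)) * x <= (1 - e * (1 + w * N)) * 1 -> e * y <= e * 1 ->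
  e * w * z <= e * w * N ->
  (1 - e * (1 + w * N)) * x + (e * y + e * w * z) <= 1.
Proof. lra. Qed.

Lemma sandwich_arith (R : realFieldType) (e w N a u x y : R) :
  e * x <= e * u -> e * w * y <= e * w * (N * u) ->
  e * (1 + w * N) * u <= w * u -> 0 <= e * (1 + w * N) * a ->
  (1 - e * (1 + w * N)) * a + (e * x + e * w * y) <= a + w * u.
Proof. lra. Qed.

(** * The perturbed near maximizer *)

Section Supremum.
Variables (R : realType) (n l k : nat).
Local Notation C := (Num.ClosedField.sort (complex_complex__canonical__Num_ClosedField R)).
Local Notation V := 'M[R]_(n, l).
Local Notation cj := (map_mx Num.conj).
Local Notation W := (@cmx R n l).
Context {disp : measure_display} {T : measurableType disp}.
Variables (P : probability T R) (X : T -> V).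
Hypothesis gX : gaussian_mx P X.
Local Notation ex := (ex P X).
Variables (V1 : 'M[C]_(n, k)).
Hypothesis V1u : V1^t* *m V1 = 1%:M.
Local Notation P1 := (V1 *m V1^t*).
Local Notation P2 := (1%:M - V1 *m V1^t*).
Hypothesis hkl : (k + 2 <= l)%N.

Lemma qf_DS m q (J : 'M[C]_m) (A B : 'M[C]_(m, q)) (s : R) : psd J -> 0 < s ->
  qf J (A + B) <= (1 + s) * qf J A + (1 + s^-1) * qf J B.
Proof. by move=> [t [D ->]] s0; rewrite !qf_fsq mulmxDr; exact: fsqDS. Qed.

Lemma conjZr m q (a : R) (A : 'M[C]_(m, q)) : cj (a%:C *: A) = a%:C *: cj A.
Proof. by rewrite map_mxZ; congr (_ *: _); exact: conjc_real. Qed.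

Lemma P2_split q (Z : 'M[C]_(n, q)) : Z = P2 *m Z + P1 *m Z.
Proof. by rewrite mulmxBl mul1mx subrK. Qed.

Definition adm1 (H2 : 'M[C]_n) := admissible V1 H2 /\ rtr H2 <= 1.

(* The competitor H2 leans from the near maximizer G towards P2 (conj G) P2 +
   2 e P2; its mean residual is at most phi <= mean_resid G + e^2, which bounds
   the mean quadratic forms of these two directions. *)
Lemma sup_step (lam d e phi : R) (G : 'M[C]_n) : 0 < lam -> 0 < d ->
  adm1 G -> (forall H2, adm1 H2 -> mean_resid P X V1 lam d H2 <= phi) ->
  phi - e ^+ 2 <= mean_resid P X V1 lam d G ->
  0 < e -> 4 * (n%:R + 1) * e <= 1 -> 1 <= e ^+ 2 * lam -> e * (2 * e) <= lam ->
  (lam * k%:R + 1) * ex (fun M => d * rtr (ridge ((e * (2 * e))%:C%:M) d (W M))) <= e ->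
  (l%:R - k%:R - 1 - (2 * (l%:R - k%:R) + n%:R + 6) * e) * phi <=
  (l%:R - 1) + (l%:R - k%:R + 2) * e.
Proof.
move=> lam0 d0 [[Gp PG] G1] phimax Gnear e0 ne elam blam Ksmall.
(* [e1] is the trace budget of the two added directions, [e] for [A1] and [e w n] for [P2], so
   removing it from [G] keeps the trace at most 1. The factor 2 in [w] ensures [e1 <= w]. *)
set w := 2 * e; set e1 := e * (1 + w * n%:R).
have n0 : 0 <= n%:R :> R by rewrite ler0n.
have w0 : 0 < w by rewrite mulr_gt0.
have b0 : 0 < e * w by rewrite mulr_gt0.
have e10 : 0 <= e1 by rewrite mulr_ge0 ?(ltW e0) // addr_ge0 // mulr_ge0 // ltW.
have en : e * n%:R <= 1 / 4 by nra.
have e1w : e1 <= w by rewrite /e1 /w; nra.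
have e1l : 0 <= 1 - e1 by move: e1w; rewrite /w; nra.
have pP2 := psd_P2 V1u.
pose A1 := P2^t* *m cj G *m P2.
have A1p : psd A1 by apply: psd_congr; exact: psd_conj.
have rA1 : rtr A1 <= 1.
  have cGp := psd_conj Gp.
  have E : rtr A1 = rtr (cj G *m P2).
    by rewrite /A1 rtr_mulC mulmxA (P2_adj V1) (P2_idem V1u) rtr_mulC.
  rewrite E mulmxBr mulmx1 rtrB rtr_conj.
  by apply: le_trans G1; rewrite lerBlDr lerDl; exact: rtr_mul_psd_ge0 cGp (psd_P1 V1).
pose H2 := (1 - e1)%:C *: G + (e%:C *: A1 + (e * w)%:C *: P2).
have H2p : psd H2.
  apply: psdD; first exact: psdZ.
  by apply: psdD; apply: psdZ => //; exact: ltW.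
have PH2 : P1 *m H2 = 0.
  have PA : P1 *m A1 = 0.
    by rewrite /A1 (P2_adj V1) -(mulmxA P2) (mulmxA P1) (P1P2 V1u) mul0mx.
  rewrite /H2 mulmxDr mulmxDr -!scalemxAr PG PA (P1P2 V1u) !scaler0.
  by rewrite !addr0.
have rH2 : rtr H2 <= 1.
  rewrite /H2 !rtrD !rtrZ; have rP2 := rtr_P2_le V1u.
  have r1 := ler_wpM2l e1l G1; have r2 := ler_wpM2l (ltW e0) rA1.
  have r3 := ler_wpM2l (ltW b0) rP2.
  exact: trace_arith r1 r2 r3.
have adm : admissible V1 H2 by [].
pose Xi M : 'M[C]_n := defect (lam%:C *: P1 + H2) d (W M).
pose Y M : 'M[C]_(l, n) := coefm (lam%:C *: P1 + H2) d (W M).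
have HHp := psd_Hh V1 lam0 H2p.
have gxi A : good (fun M => qf A (Xi M)) .
  by apply: good_qf; exact: mgood_defect.
have gY : good (fun M => fsq (Y M)) by apply: good_fsq; exact: mgood_coefm.
have q0 A : psd A -> 0 <= ex (fun M => qf A (Xi M)).
  by move=> Ap; apply: (ex_ge0 gX) => [|M]; [exact: gxi|exact: qf_ge0].
have sumE (a1 a2 a3 a4 a5 : V -> R) (c1 c2 c3 c4 c5 : R) :
    good a1 -> good a2 -> good a3 -> good a4 -> good a5 ->
    good (fun M => c1 * a1 M + (c2 * a2 M + c3 * a3 M + c4 * a4 M) + c5 * a5 M) /\
    ex (fun M => c1 * a1 M + (c2 * a2 M + c3 * a3 M + c4 * a4 M) + c5 * a5 M) =
    c1 * ex a1 + (c2 * ex a2 + c3 * ex a3 + c4 * ex a4) + c5 * ex a5.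
  move=> h1 h2 h3 h4 h5.
  have z1 := goodZ c1 h1; have z2 := goodZ c2 h2; have z3 := goodZ c3 h3.
  have z4 := goodZ c4 h4; have z5 := goodZ c5 h5.
  have z23 := goodD z2 z3; have z234 := goodD z23 z4; have z14 := goodD z1 z234.
  split; first exact: goodD.
  by rewrite (exD gX z14 z5) (exD gX z1 z234) (exD gX z23 z4) (exD gX z2 z3) !(exZ gX).
have R2E : mean_resid P X V1 lam d H2 =
    lam * ex (fun M => qf P1 (Xi M)) + ((1 - e1) * ex (fun M => qf G (Xi M)) +
      e * ex (fun M => qf A1 (Xi M)) + e * w * ex (fun M => qf P2 (Xi M))) +
    d * ex (fun M => fsq (Y M)).
  have [_ <-] := sumE _ _ _ _ _ lam (1 - e1) e (e * w) d (gxi P1) (gxi G) (gxi A1) (gxi P2) gY.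
  apply: eq_ex => M; rewrite (rtr_resid_split lam0 d0 adm) -/(Xi M) -/(Y M).
  have -> : qf H2 (Xi M) =
      (1 - e1) * qf G (Xi M) + e * qf A1 (Xi M) + e * w * qf P2 (Xi M).
    by rewrite /H2 qfD qfD !qfZ addrA.
  by [].
(* The coefficients of the competitor are inserted in the minimization that defines the residual of
   [G]. *)
have RGle : mean_resid P X V1 lam d G <=
    lam * ex (fun M => qf P1 (Xi M)) + ex (fun M => qf G (Xi M)) + d * ex (fun M => fsq (Y M)).
  have [gs E] := sumE _ _ _ _ _ lam 1 0 0 d (gxi P1) (gxi G) (gxi G) (gxi G) gY.
  rewrite !mul0r !addr0 mul1r in E; rewrite -E; apply: (ex_le gX) => //.
    by apply: good_resid_tr.
  move=> M; apply: le_trans (cost_min (W M) (psd_Hh V1 lam0 Gp) d0 (Y M)) _.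
  by rewrite /cost -[1%:M - _]/(Xi M) qfD qfZ mul1r !mul0r !addr0.
have Q1R : mean_qf P X V1 lam d H2 H2 <= mean_resid P X V1 lam d H2.
  apply: (ex_le gX) => [||M]; [exact: gxi|by apply: good_resid_tr|].
  rewrite (rtr_resid_split lam0 d0 adm) addrAC lerDr addr_ge0 // mulr_ge0 ?(ltW lam0) ?(ltW d0) //.
    by apply: qf_ge0; exact: psd_P1.
  exact: fsq_ge0.
(* The defect is split along [P2] and [P1]. On the range of [P2] the form of [conj G] is that of
   [A1]; the conjugates of the two small terms are bounded by their traces, at total cost
   [e1 u <= w u]. *)
have Q2le : mean_qf P X V1 lam d H2 (cj H2) <=
    (1 + e) * (ex (fun M => qf A1 (Xi M)) + w * ex (fun M => qf P2 (Xi M))) +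
    (1 + e^-1) * ex (fun M => qf P1 (Xi M)).
  have [gs E] := sumE _ _ _ _ _ 0 (1 + e) ((1 + e) * w) (1 + e^-1) 0 (gxi A1) (gxi A1) (gxi P2) (gxi P1) gY.
  rewrite !mul0r add0r addr0 -mulrA -mulrDr in E; rewrite -E.
  apply: (ex_le gX) => [||M]; [exact: gxi|exact: gs|].
  rewrite !mul0r add0r addr0 -/(Xi M).
  have Jp := psd_conj H2p.
  rewrite {1}(P2_split (Xi M)); apply: le_trans (qf_DS _ _ Jp e0) _.
  have ei : 0 <= 1 + e^-1 by rewrite addr_ge0 // invr_ge0 ltW.
  apply: lerD; last first.
    apply: ler_wpM2l => //; apply: le_trans (qf_le_rtr _ Jp) _.
    rewrite (qf_P1 V1u) rtr_conj -[leRHS]mul1r; apply: ler_wpM2r => //; exact: fsq_ge0.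
  rewrite -mulrA -mulrDr; apply: ler_wpM2l; first by rewrite addr_ge0 // ltW.
  have uE := qf_P2 V1u (Xi M).
  have u0 : 0 <= qf P2 (Xi M) by exact: qf_ge0.
  have -> : qf (cj H2) (P2 *m Xi M) = (1 - e1) * qf A1 (Xi M) +
      (e * qf (cj A1) (P2 *m Xi M) + e * w * qf (cj P2) (P2 *m Xi M)).
    have -> : qf A1 (Xi M) = qf (cj G) (P2 *m Xi M) by exact: qf_congr.
    have cE : cj H2 = (1 - e1)%:C *: cj G + (e%:C *: cj A1 + (e * w)%:C *: cj P2).
      by rewrite /H2 map_mxD conjZr map_mxD !conjZr.
    by rewrite cE qfD qfD !qfZ.
  have h1 : qf (cj A1) (P2 *m Xi M) <= qf P2 (Xi M).
    apply: le_trans (qf_le_rtr _ (psd_conj A1p)) _.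
    by rewrite uE rtr_conj -[leRHS]mul1r; apply: ler_wpM2r => //; exact: fsq_ge0.
  have h2 : qf (cj P2) (P2 *m Xi M) <= n%:R * qf P2 (Xi M).
    apply: le_trans (qf_le_rtr _ (psd_conj pP2)) _.
    rewrite uE rtr_conj; apply: ler_wpM2r; [exact: fsq_ge0|exact: rtr_P2_le].
  have a0 : 0 <= qf A1 (Xi M) by exact: qf_ge0.
  have h3 := ler_wpM2l (ltW e0) h1; have h4 := ler_wpM2l (ltW b0) h2.
  have h5 := ler_wpM2r u0 e1w; have h6 := mulr_ge0 e10 a0.
  exact: sandwich_arith h3 h4 h5 h6.
have one : (l%:R - k%:R) * mean_resid P X V1 lam d H2 -
    (lam * k%:R + rtr H2) * ex (fun M => d * rtr (ridge ((e * w)%:C%:M) d (W M))) <=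
  (l%:R - 1) * rtr H2 + 2^-1 * (mean_qf P X V1 lam d H2 H2 + mean_qf P X V1 lam d H2 (cj H2)).
  apply: (one_step gX V1u lam0 d0 hkl adm b0).
  (* [H] exceeds [e w] times the identity: on the head because [e w <= lam], and on its complement
     thanks to the [P2] term of the competitor. *)
  exists ((lam - e * w)%:C *: P1 + ((1 - e1)%:C *: G + e%:C *: A1)).
    apply: psdD; first by apply: psdZ; [rewrite subr_ge0|exact: psd_P1].
    by apply: psdD; apply: psdZ => //; exact: ltW.
  have -> : (e * w)%:C%:M = (e * w)%:C *: P1 + (e * w)%:C *: P2.
    by rewrite -scalerDr (addrC P1) subrK scalemx1.
  have -> : (lam - e * w)%:C *: P1 = lam%:C *: P1 - (e * w)%:C *: P1.
    by rewrite rmorphB scalerBl.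
  exact: abel_rearrange.
have kap0 : 0 <= ex (fun M => d * rtr (ridge ((e * w)%:C%:M) d (W M))).
  have bp : psd ((e * w)%:C%:M : 'M[C]_n).
    by rewrite -scalemx1; apply: psdZ; [exact: ltW|exact: psd1].
  apply: (ex_ge0 gX) => [|M]; first by apply: goodZ; apply: good_rtr; exact: mgood_ridge.
  by apply: mulr_ge0; [exact: ltW|exact: psd_rtr_ge0 (ridge_psd (W M) bp d0)].
have Ke : (lam * k%:R + rtr H2) * ex (fun M => d * rtr (ridge ((e * w)%:C%:M) d (W M))) <= e.
  by apply: le_trans Ksmall; apply: ler_wpM2r => //; rewrite lerD2l.
have R2phi := phimax H2 (conj adm rH2).
have p2 : 2 <= l%:R - k%:R :> R.
  by rewrite lerBrDr addrC -natrD ler_nat.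
have L0 : 0 <= l%:R - 1 :> R.
  by rewrite subr_ge0 ler1n; apply: leq_trans hkl; rewrite addn2.
have y0 : 0 <= d * ex (fun M => fsq (Y M)).
  by apply: mulr_ge0; [exact: ltW|apply: (ex_ge0 gX) => // M; exact: fsq_ge0].
exact: (sup_arith p2 L0 n0 e0 ne (erefl e1) elam (q0 _ Gp) (q0 _ A1p) (q0 _ pP2) y0
  (q0 _ (psd_P1 V1)) (erefl _) rH2 R2E R2phi RGle Gnear Ke one Q1R Q2le).
Qed.

End Supremum.

Lemma core_arith (R : realFieldType) (q r x y g : R) :
  y * (q + 1) <= g / 2 -> x * (r + 1) <= g / 2 -> y <= 1 -> x <= 1 -> 0 <= y -> 0 <= x ->
  (r + y) * (q + x) <= q * r + g.
Proof. nra. Qed.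

(** * Limits in the parameters and the mean residual *)

Section Core.
Variables (R : realType) (n l k : nat).
Local Notation C := (Num.ClosedField.sort (complex_complex__canonical__Num_ClosedField R)).
Local Notation V := 'M[R]_(n, l).
Local Notation W := (@cmx R n l).
Context {disp : measure_display} {T : measurableType disp}.
Variables (P : probability T R) (X : T -> V).
Hypothesis gX : gaussian_mx P X.
Local Notation ex := (ex P X).

Lemma rtr_ridge_bound (H : 'M[C]_n) (d : R) (Z : 'M[C]_(n, l)) : psd H -> 0 < d ->
  0 <= d * rtr (ridge H d Z) <= l%:R.
Proof.
move=> Hp d0; have Kp := ridge_psd Z Hp d0.
rewrite mulr_ge0 ?(ltW d0) ?psd_rtr_ge0 //=.
have E : rtr (ridge H d Z *m gramd H d Z) = l%:R by rewrite Kgramd // rtr1.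
rewrite -E /gramd mulmxDr rtrD -scalemx1 -scalemxAr mulmx1 rtrZ lerDr.
by apply: rtr_mul_psd_ge0 => //; exact: psd_congr.
Qed.

Lemma lead_left_inv (hn : (l <= n)%N) (M : V) :
  \det (lead hn (leqnn l) M) != 0 -> exists Z : 'M[C]_(l, n), Z *m W M = 1%:M.
Proof.
move=> dM; have u : lead hn (leqnn l) M \in unitmx by rewrite unitmxE unitfE.
exists (map_mx (real_complex R) (invmx (lead hn (leqnn l) M) *m rowsub (widen_ord hn) 1%:M)).
rewrite -map_mxM -mulmxA -rowsubE (_ : rowsub _ M = lead hn (leqnn l) M).
  by rewrite mulVmx // map_mx1.
by apply/matrixP => i j; rewrite !mxE; congr (M _ _); exact: val_inj.
Qed.

Lemma lead_right_inv (hl : (n <= l)%N) (M : V) :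
  \det (lead (leqnn n) hl M) != 0 -> exists Y : 'M[C]_(l, n), W M *m Y = 1%:M.
Proof.
move=> dM; have u : lead (leqnn n) hl M \in unitmx by rewrite unitmxE unitfE.
exists (map_mx (real_complex R) (colsub (widen_ord hl) 1%:M *m invmx (lead (leqnn n) hl M))).
rewrite -map_mxM mulmxA mulmx_colsub mulmx1 (_ : colsub _ M = lead (leqnn n) hl M).
  by rewrite mulmxV // map_mx1.
by apply/matrixP => i j; rewrite !mxE; congr (M _ _); exact: val_inj.
Qed.

(** For [l <= n] almost every [W] has a left inverse, so [d tr K] is of order [d] there;
    [rtr_ridge_bound] dominates it by [l]. *)
Lemma ridge_vanish (b : R) : (l <= n)%N -> 0 < b -> forall eta, 0 < eta ->
  exists2 d, 0 < d & ex (fun M => d * rtr (ridge (b%:C%:M) d (W M))) <= eta.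
Proof.
move=> hn b0 eta eta0.
have bp : psd (b%:C%:M : 'M[C]_n).
  by rewrite -scalemx1; apply: psdZ; [exact: ltW|exact: psd1].
pose dj (j : nat) : R := j.+1%:R^-1.
have dj0 j : 0 < dj j by rewrite invr_gt0.
have gB (M : V) : \det (lead hn (leqnn l) M) != 0 ->
    exists B, forall j : nat, dj j * rtr (ridge (b%:C%:M) (dj j) (W M)) <= B / j.+1%:R.
  move=> /lead_left_inv [Z ZW].
  exists (fsq Z / b) => j; rewrite mulrC; apply: ler_wpM2r; first exact: ltW.
  have := rtr_ridge_left_inv (dj0 j) b0 (psd0 R n) ZW.
  by rewrite addr0.
have [j hj] := ex_vanish gX
  (fun j => (goodZ (dj j) (good_rtr (mgood_ridge l bp (dj0 j)))).1)
  (fun j M => rtr_ridge_bound (W M) bp (dj0 j)) gB eta0.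
by exists (dj j).
Qed.

(** For [n <= l] almost every [W] has a right inverse, so the identity is fitted exactly at a
    penalty of order [d]; [rtr H] dominates. *)
Lemma resid_vanish (H : 'M[C]_n) : (n <= l)%N -> psd H -> forall eta, 0 < eta ->
  exists2 d, 0 < d & ex (fun M => rtr (resid H d (W M))) <= eta.
Proof.
move=> hl Hp eta eta0.
pose dj (j : nat) : R := j.+1%:R^-1.
have dj0 j : 0 < dj j by rewrite invr_gt0.
have bd j M : 0 <= rtr (resid H (dj j) (W M)) <= rtr H.
  by rewrite (psd_rtr_ge0 (resid_psd (W M) Hp (dj0 j))) (rtr_resid_le (W M) Hp (dj0 j)).
have gB (M : V) : \det (lead (leqnn n) hl M) != 0 ->
    exists B, forall j : nat, rtr (resid H (dj j) (W M)) <= B / j.+1%:R.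
  move=> /lead_right_inv [Y WY].
  exists (fsq Y) => j; rewrite mulrC; exact: rtr_resid_right_inv.
have [j hj] := ex_vanish gX
  (fun j => (good_rtr (mgood_resid l Hp (dj0 j))).1) bd gB eta0.
by exists (dj j).
Qed.

Variables (V1 : 'M[C]_(n, k)).
Hypothesis V1u : V1^t* *m V1 = 1%:M.
Hypothesis hkl : (k + 2 <= l)%N.

Lemma resid_scale (H : 'M[C]_n) (t d : R) (Z : 'M[C]_(n, l)) : psd H -> 0 < t -> 0 < d ->
  rtr (resid (t%:C *: H) (t * d) Z) <= t * rtr (resid H d Z).
Proof.
move=> Hp t0 d0; have td0 : 0 < t * d by rewrite mulr_gt0.
apply: le_trans (cost_min Z (psdZ (ltW t0) Hp) td0 (coefm H d Z)) _.
by rewrite (rtr_resid Z Hp d0) /cost qfZ mulrDr mulrA.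
Qed.

Lemma choose_eps (p N L g : R) : 2 <= p -> 0 <= N -> 0 <= L -> 0 < g ->
  exists2 e, 0 < e & 4 * (N + 1) * e <= 1 /\
  forall phi, (p - 1 - (2 * p + N + 6) * e) * phi <= L + (p + 2) * e ->
    phi <= L / (p - 1) + g.
Proof.
move=> p2 N0 L0 g0; set A := 2 * p + N + 6; set B := p + 2.
have p1 : 0 < p - 1 by lra.
have A0 : 0 < A by rewrite /A; lra.
have B0 : 0 < B by rewrite /B; lra.
set q := L / (p - 1); have q0 : 0 <= q by rewrite divr_ge0 // ltW.
have Lq : L = q * (p - 1) by rewrite /q divfK // gt_eqF.
clearbody q.
clearbody A B.
(* The comparison [(p - 1 - A e) (q + g) >= L + B e] amounts to [e D <= (p - 1) g], and
   [p - 1 >= 1]. *)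
set D := B + A * q + A * g.
have D0 : 0 < D.
  by rewrite /D; have := mulr_ge0 (ltW A0) q0; have := mulr_gt0 A0 g0; lra.
have N1 : 0 < 4 * (N + 1) by lra.
exists (Num.min (4 * (N + 1))^-1 (g / D)); first by rewrite lt_min invr_gt0 N1 divr_gt0.
set e := Num.min _ _.
have e0 : 0 < e by rewrite lt_min invr_gt0 N1 divr_gt0.
have e1 : e <= (4 * (N + 1))^-1 by rewrite ge_min lexx.
have e2 : e * D <= g by rewrite -ler_pdivlMr // ge_min lexx orbT.
split; first by rewrite mulrC -ler_pdivlMr // mul1r.
move=> phi h.
have Ae : A * e < 1.
  rewrite -(ltr_pM2r g0) mul1r; apply: lt_le_trans e2.
  rewrite /D !mulrDr; have z1 := mulr_gt0 e0 B0; have z2 := mulr_ge0 (ltW e0) (mulr_ge0 (ltW A0) q0).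
  by rewrite -[A * e * g]mulrA [A * (e * g)]mulrCA; lra.
have c0 : 0 < p - 1 - A * e by lra.
rewrite -(ler_pM2l c0); apply: le_trans h _; rewrite Lq.
have : e * D <= g * (p - 1) by apply: le_trans e2 _; rewrite ler_peMr ?(ltW g0) //; lra.
rewrite /D; lra.
Qed.

(** For [n <= l] the residual can be made arbitrarily small. Otherwise [H2] is scaled into the trace
    ball, where [sup_step] bounds the supremum; [lam] and [d] are scaled by the same factor [t],
    under which the residual is homogeneous. *)
Lemma core_bound (H2 : 'M[C]_n) (lam0 gam : R) : admissible V1 H2 -> 0 < gam ->
  exists lam d, [/\ lam0 <= lam, 0 < lam, 0 < d &
    mean_resid P X V1 lam d H2 <= (l%:R - 1) / (l%:R - k%:R - 1) * rtr H2 + gam].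
Proof.
move=> [Hp PH] gam0; set q := (l%:R - 1) / (l%:R - k%:R - 1).
have p2 : 2 <= l%:R - k%:R :> R by rewrite lerBrDr addrC -natrD ler_nat.
have L0 : 0 <= l%:R - 1 :> R.
  by rewrite subr_ge0 ler1n; apply: leq_trans hkl; rewrite addn2.
have q0 : 0 <= q by rewrite divr_ge0 //; lra.
have n0 : 0 <= n%:R :> R by rewrite ler0n.
have tr0 := psd_rtr_ge0 Hp.
have [nl|ln] := leqP n l.
  pose lam := Num.max lam0 1.
  have lam1 : 0 < lam by rewrite lt_max ltr01 orbT.
  have [d d0 hd] := resid_vanish nl (psd_Hh V1 lam1 Hp) gam0.
  exists lam, d; split => //; first by rewrite le_max lexx.
  by apply: le_trans hd _; rewrite lerDr mulr_ge0.
pose g := Num.min (gam / (2 * (rtr H2 + 1))) 1.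
have g0 : 0 < g by rewrite lt_min ltr01 andbT divr_gt0 // mulr_gt0 // ltr_wpDl.
(* The added slack keeps [t] positive when [H2 = 0]. It and [g] are sized so that [t (q + g)]
   exceeds [q tr H2] by at most [gam]. *)
pose t := rtr H2 + Num.min (gam / (2 * (q + 1))) 1.
have dt0 : 0 < Num.min (gam / (2 * (q + 1))) 1.
  by rewrite lt_min ltr01 andbT divr_gt0 // mulr_gt0 // ltr_wpDl.
have t0 : 0 < t by rewrite ltr_wpDl.
have [e e0 [ne hphi]] := choose_eps p2 n0 L0 g0.
(* In order: [t lam] must reach the prescribed [lam0], the head part of the defect must be
   negligible, and [H] must stay above [e (2 e)] times the identity. *)
pose lam := Num.max (lam0 / t) (Num.max (e ^+ 2)^-1 (e * (2 * e))).
have ee0 : 0 < e * (2 * e) by rewrite !mulr_gt0.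
have lam1 : 0 < lam by rewrite !lt_max ee0 !orbT.
have S0 : 0 < lam * k%:R + 1 by rewrite ltr_wpDl // mulr_ge0 // ltW.
have [d d0 hd] := ridge_vanish (ltnW ln) ee0 (divr_gt0 e0 S0).
have K : (lam * k%:R + 1) * ex (fun M => d * rtr (ridge ((e * (2 * e))%:C%:M) d (W M))) <= e.
  by rewrite mulrC -ler_pdivlMr.
have tlam0 : 0 < t * lam by rewrite mulr_gt0.
have td0 : 0 < t * d by rewrite mulr_gt0.
exists (t * lam), (t * d); split => //.
  by rewrite mulrC -ler_pdivrMr // le_max lexx.
pose S := [set x | exists2 H, adm1 V1 H & x = mean_resid P X V1 lam d H].
have Sub : has_ubound S.
  exists (lam * k%:R + 1) => _ [H [[Hp' PH'] H1] ->].
  rewrite -[leRHS](ex_cst P X); apply: (ex_le gX) => [||M].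
  - exact: good_resid_tr.
  - exact: good_cst.
  - apply: le_trans (rtr_resid_le (W M) (psd_Hh V1 lam1 Hp') d0) _.
    by rewrite rtrD rtrZ (rtr_P1 V1u) lerD2l.
have adm0 : adm1 V1 (0 : 'M[C]_n).
  by split; [split; [exact: psd0|rewrite mulmx0]|rewrite rtr0 ler01].
have Snz : S !=set0 by exists (mean_resid P X V1 lam d 0); exists 0.
have Ssup : has_sup S by [].
have e20 : 0 < e ^+ 2 by rewrite exprn_gt0.
have [_ [G admG ->] hG] := sup_adherent e20 Ssup.
have phiP : sup S <= q + g.
  apply: hphi; apply: (sup_step gX V1u hkl lam1 d0 admG) => //.
  - by move=> H admH; apply: ub_le_sup => //; exists H.
  - exact: ltW.
  - by rewrite mulrC -ler_pdivrMr // mul1r !le_max lexx !orbT.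
  - by rewrite !le_max lexx !orbT.
have tinv : 0 <= t^-1 by rewrite invr_ge0 ltW.
have tH : adm1 V1 (t^-1%:C *: H2).
  split; first by split; [exact: psdZ|rewrite -scalemxAr PH scaler0].
  by rewrite rtrZ mulrC ler_pdivrMr // mul1r lerDl ltW.
have fH : mean_resid P X V1 lam d (t^-1%:C *: H2) <= q + g.
  by apply: le_trans phiP; apply: ub_le_sup => //; exists (t^-1%:C *: H2).
have HE : (t * lam)%:C *: (V1 *m V1^t*) + H2 =
    t%:C *: (lam%:C *: (V1 *m V1^t*) + t^-1%:C *: H2).
  rewrite scalerDr !scalerA -!rmorphM mulfV ?gt_eqF //.
  by rewrite rmorph1 scale1r.
apply: (@le_trans _ _ (t * mean_resid P X V1 lam d (t^-1%:C *: H2))).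
  rewrite -(exZ gX); last exact: good_resid_tr (tH.1).
  apply: (ex_le gX) => [||M]; first exact: good_resid_tr.
    by apply: goodZ; exact: good_resid_tr (tH.1).
  by rewrite HE; apply: resid_scale => //; exact: psd_Hh tH.1.1.
apply: le_trans (ler_wpM2l (ltW t0) fH) _.
have h1 : Num.min (gam / (2 * (q + 1))) 1 * (q + 1) <= gam / 2.
  rewrite -ler_pdivlMr ?ltr_wpDl // -mulrA -invfM ge_min lexx //.
have h2 : g * (rtr H2 + 1) <= gam / 2.
  by rewrite -ler_pdivlMr ?ltr_wpDl // -mulrA -invfM ge_min lexx.
have h3 : Num.min (gam / (2 * (q + 1))) 1 <= 1 by rewrite ge_min lexx orbT.
have h4 : g <= 1 by rewrite ge_min lexx orbT.
exact: core_arith h1 h2 h3 h4 (ltW dt0) (ltW g0).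
Qed.

End Core.

(** * From subspace iteration to the ridge residual *)

Section Reduction.
Variable R : realType.
Local Notation C := (Num.ClosedField.sort (complex_complex__canonical__Num_ClosedField R)).
Local Notation Re := (@complex.Re R).
Local Notation Im := (@complex.Im R).

(** Each QR step writes its input as the orthonormal factor times some matrix, whatever the ranks.
    The resulting inclusion of ranges is all that the projection error needs, so the ambiguity of QR
    is harmless. *)
Lemma subspace_iter_range m n l (M : 'M[C]_(m, n)) (N : 'M[C]_(n, l)) q r (Q : 'M[C]_(m, r)) :
  subspace_iter M N q Q ->
  Q^t* *m Q = 1%:M /\ exists B, iter q (mulmx (M *m M^t* )) (M *m N) = Q *m B.
Proof.
elim=> [Q0 [Q1 [Rf [_ E]]]|j r' Q0 G Q' _ [_ [B EB]] [_ [Rf [_ E]]] [Q1 [Rf' [_ E']]]].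
  by split=> //; exists Rf.
split=> //; exists (Rf' *m Rf *m B).
rewrite iterS EB -(mulmxA M) (mulmxA (M^t* )) [in LHS]E !mulmxA.
by rewrite -[in RHS]E'.
Qed.

Lemma fsq_proj m n r (M : 'M[C]_(m, n)) (Q : 'M[C]_(m, r)) (B : 'M[C]_(r, n)) :
  Q^t* *m Q = 1%:M -> fsq (M - Q *m (Q^t* *m M)) <= fsq (M - Q *m B).
Proof.
move=> Q1; set A := M - Q *m (Q^t* *m M).
have -> : M - Q *m B = A + Q *m (Q^t* *m M - B) by rewrite mulmxBr addrA subrK.
have QA : A^t* *m Q = 0.
  have : Q^t* *m A = 0 by rewrite /A mulmxBr (mulmxA (Q^t* ) Q) Q1 mul1mx subrr.
  move=> /(congr1 (fun Z => Z^t*)); rewrite adjmxM trmxCK => ->.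
  by rewrite trmx0 map_mx0.
by rewrite fsqD mulmxA QA mul0mx rtr0 mulr0 addr0 lerDl fsq_ge0.
Qed.

Definition dg n (f : 'I_n -> R) : 'M[C]_n := diag_mx (\row_j (f j)%:C).

Section Diag.
Variable n : nat.
Implicit Types f g : 'I_n -> R.

Lemma dgE f i j : dg f i j = (f i)%:C *+ (i == j).
Proof. by rewrite !mxE; case: eqP => [->|]. Qed.

Lemma dgM f g : dg f *m dg g = dg (fun j => f j * g j).
Proof.
rewrite mul_diag_mx; apply/matrixP => i j; rewrite !mxE.
by case: eqP => _; rewrite ?mulr1n ?mulr0n ?mulr0 // -rmorphM.
Qed.

Lemma dg_adj f : (dg f)^t* = dg f.
Proof.
apply/matrixP => i j; rewrite !mxE eq_sym; case: eqP => [->|_].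
  by rewrite !mulr1n conjCE conjc_real.
by rewrite !mulr0n rmorph0.
Qed.

Lemma dgD f g : dg f + dg g = dg (fun j => f j + g j).
Proof. by apply/matrixP => i j; rewrite mxE !dgE rmorphD mulrnDl. Qed.

Lemma dgZ a f : a%:C *: dg f = dg (fun j => a * f j).
Proof. by apply/matrixP => i j; rewrite mxE !dgE rmorphM mulrnAr. Qed.

Lemma dg1 : dg (fun _ : 'I_n => 1 : R) = 1%:M.
Proof. by apply/matrixP => i j; rewrite dgE !mxE. Qed.

Lemma dg_mulE f m (Z : 'M[C]_(n, m)) i j : (dg f *m Z) i j = (f i)%:C * Z i j.
Proof. by rewrite mul_diag_mx !mxE. Qed.

Lemma mul_dgE f m (Z : 'M[C]_(m, n)) i j : (Z *m dg f) i j = Z i j * (f j)%:C.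
Proof. by rewrite mul_mx_diag !mxE. Qed.

Lemma rtr_dg f : rtr (dg f) = \sum_j f j.
Proof.
rewrite rtrE /mxtrace (raddf_sum (@complex.Re R : Rcomplex R -> R)) /=.
by apply: eq_bigr => i _; rewrite dgE eqxx.
Qed.

Lemma qf_dg f m (Z : 'M[C]_(n, m)) : (forall j, 0 <= f j) ->
  qf (dg f) Z = \sum_i \sum_j f i * (Re (Z i j) ^+ 2 + Im (Z i j) ^+ 2).
Proof.
move=> f0.
have -> : dg f = (dg (fun j => Num.sqrt (f j)))^t* *m dg (fun j => Num.sqrt (f j)).
  by rewrite dg_adj dgM; congr (dg _); apply/funext => j; rewrite -expr2 sqr_sqrtr.
rewrite qf_fsq fsqE; apply: eq_bigr => i _; apply: eq_bigr => j _.
rewrite dg_mulE cReM cImM /= !mul0r subr0 addr0 !exprMn sqr_sqrtr // mulrDr.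
by [].
Qed.

Lemma psd_dg f : (forall j, 0 <= f j) -> psd (dg f).
Proof.
move=> f0; exists n, (dg (fun j => Num.sqrt (f j))).
by rewrite dg_adj dgM; congr (dg _); apply/funext => j; rewrite -expr2 sqr_sqrtr.
Qed.

End Diag.

Section Unitary.
Variables (n : nat) (V : 'M[C]_n).
Hypothesis Vu : V^t* *m V = 1%:M.

Lemma unitaryC : V *m V^t* = 1%:M.
Proof. exact: mulmx1C. Qed.

Lemma unitary_sandwich (A B : 'M[C]_n) :
  (V *m A *m V^t* ) *m (V *m B *m V^t* ) = V *m (A *m B) *m V^t*.
Proof. by rewrite !mulmxA -(mulmxA _ (V^t* ) V) Vu mulmx1. Qed.

Lemma qf_unitary_r (H : 'M[C]_n) (Z : 'M[C]_n) : qf H (Z *m V^t* ) = qf H Z.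
Proof.
rewrite !qfE (_ : (Z *m V^t* )^t* *m H *m (Z *m V^t* ) = V *m (Z^t* *m H *m Z) *m V^t* ).
  by rewrite rtr_mulC mulmxA Vu mul1mx.
by rewrite adjmxM trmxCK !mulmxA.
Qed.

End Unitary.

(** In the square of [(1 - r) + r x] the cross term is at most [2 r (1 - r)], and
    [(1 - r)^2 + 2 r (1 - r) = 1 - r^2]. *)
Lemma entry_bound (a r x y : R) : 0 <= r <= 1 -> x <= 1 -> 0 <= a ->
  a * ((1 - r * (1 - x)) ^+ 2 + (r * y) ^+ 2) <= a - a * r ^+ 2 + a * r ^+ 2 * (x ^+ 2 + y ^+ 2).
Proof.
move=> /andP [r0 r1] x1 a0.
have -> : a - a * r ^+ 2 + a * r ^+ 2 * (x ^+ 2 + y ^+ 2) =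
  a * (1 - r ^+ 2 + r ^+ 2 * (x ^+ 2 + y ^+ 2)) by ring.
apply: ler_wpM2l => //.
have s0 : 0 <= 1 - r by rewrite subr_ge0.
have t0 : 0 <= 1 - x by rewrite subr_ge0.
have := mulr_ge0 (mulr_ge0 r0 s0) t0; lra.
Qed.

End Reduction.

(** * The deterministic error bound on one slice *)

Section Slice.
Variable R : realType.
Local Notation C := (Num.ClosedField.sort (complex_complex__canonical__Num_ClosedField R)).
Local Notation Re := (@complex.Re R).
Local Notation Im := (@complex.Im R).

Lemma gram_svd m n (M : 'M[C]_(m, n)) (s : nat -> R) : singular_values M s ->
  exists V : 'M[C]_n, V^t* *m V = 1%:M /\
    M^t* *m M = V *m dg (fun j : 'I_n => s j.+1 ^+ 2) *m V^t*.
Proof.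
move=> [s0 _ smin [U [V [/unitarymxP Uu /unitarymxP Vu ME]]]].
exists V; split; first exact: mulmx1C.
set S := \matrix_(i, j) _ in ME.
have UU : U^t* *m U = 1%:M by exact: mulmx1C.
rewrite ME !adjmxM trmxCK !mulmxA -(mulmxA _ (U^t* ) U) UU mulmx1.
suff -> : dg (fun j : 'I_n => s j.+1 ^+ 2) = S^t* *m S by rewrite !mulmxA.
apply/matrixP => i j; rewrite dgE mxE.
have Sc a b : S^t* a b = (if b == a :> nat then (s b.+1)%:C else 0).
  by rewrite !mxE; case: eqP => _; rewrite ?rmorph0 // conjCE conjc_real.
under eq_bigr => b _ do rewrite Sc mxE.
(* For [i >= m] column [i] of [S] is zero, which matches the convention that [s] vanishes beyond
   [minn m n]. *)
case: (ltnP i m) => im; last first.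
  rewrite big1 => [|b _].
    rewrite smin ?expr0n /= ?rmorph0 ?mul0rn // ltnS.
    by apply: leq_trans im; exact: geq_minl.
  by case: eqP => [bi|]; rewrite ?mul0r //; have := ltn_ord b; rewrite bi ltnNge im.
rewrite (bigD1 (Ordinal im)) //= eqxx big1 ?addr0 => [|b bi]; last first.
  rewrite (_ : (b == i :> nat) = false) ?mul0r //.
  by apply/negbTE; move: bi; rewrite -val_eqE.
rewrite -val_eqE /=; case: (_ == _); rewrite ?mulr1n ?mulr0n ?mulr0 //.
by rewrite rmorphXn expr2.
Qed.

Lemma iter_gram m n l (M : 'M[C]_(m, n)) (N : 'M[C]_(n, l)) q :
  iter q (mulmx (M *m M^t* )) (M *m N) = M *m iter q (mulmx (M^t* *m M)) N.
Proof. by elim: q => // q IH; rewrite !iterS IH !mulmxA. Qed.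

Lemma iter_diag n l (V : 'M[C]_n) (f : 'I_n -> R) (N : 'M[C]_(n, l)) q :
  V^t* *m V = 1%:M ->
  iter q (mulmx (V *m dg f *m V^t* )) N = V *m dg (fun j => f j ^+ q) *m V^t* *m N.
Proof.
move=> Vu; elim: q => [|q IH].
  have -> : dg (fun j => f j ^+ 0) = 1%:M by rewrite -dg1.
  by rewrite mulmx1 (unitaryC Vu) mul1mx.
have E : (fun j => f j * f j ^+ q) = (fun j => f j ^+ q.+1).
  by apply/funext => j; rewrite exprS.
rewrite iterS IH -E -dgM; exact: sandwich_step.
Qed.

Variables (m n k l q : nat) (M : 'M[C]_(m, n)) (sg : nat -> R).
Hypothesis sv : singular_values M sg.
Hypotheses (k0 : (0 < k)%N) (sk0 : 0 < sg k).

Let sg0 j : 0 <= sg j. Proof. by have [h _ _ _] := sv. Qed.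
Let sg_le i j : (0 < i <= j)%N -> sg j <= sg i. Proof. by have [_ h _ _] := sv; exact: h. Qed.

Let kn : (k <= n)%N.
Proof.
rewrite leqNgt; apply/negP => nk; have [_ _ h _] := sv.
by move: sk0; rewrite h ?ltxx //; apply: leq_ltn_trans nk; exact: geq_minr.
Qed.

Let s (j : 'I_n) : R := sg j.+1.
Let sig := sg k.
Let head (j : 'I_n) : R := (j < k)%N%:R.
(** Amplification of direction [j] relative to direction [k] after [q] iterations. Its square weighs
    the tail in [dd], which is the origin of the exponent [4 q]. *)
Let rr (j : 'I_n) : R := (s j / sig) ^+ (2 * q).
Let dd (j : 'I_n) : R := if (j < k)%N then 0 else s j ^+ 2 * rr j ^+ 2.

Let rr0 j : 0 <= rr j.
Proof. by rewrite exprn_ge0 // divr_ge0 ?sg0. Qed.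

Let rr1 (j : 'I_n) : (k <= j)%N -> rr j <= 1.
Proof.
move=> kj; apply: exprn_ile1; first by rewrite divr_ge0 ?sg0.
by rewrite ler_pdivrMr // mul1r; apply: sg_le; rewrite k0 ltnW.
Qed.

Let dd0 j : 0 <= dd j.
Proof. by rewrite /dd; case: ifP => // _; rewrite mulr_ge0 // exprn_ge0 ?sg0. Qed.

Let head0 j : 0 <= head j. Proof. exact: ler0n. Qed.

Definition tail_energy : R := \sum_(k.+1 <= j < (minn m n).+1) sg j ^+ 2.

Let tailE : tail_energy = \sum_(j < n | (k <= j)%N) s j ^+ 2.
Proof.
have [_ _ h _] := sv.
rewrite /tail_energy big_add1 /=.
have mn : (minn m n <= n)%N by exact: geq_minr.
transitivity (\sum_(k <= j < n) sg j.+1 ^+ 2).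
  case: (leqP k (minn m n)) => kmin; last first.
    move: sk0; rewrite h ?ltxx //.
  rewrite [RHS](big_cat_nat kmin mn) /= [X in _ + X]big_nat_cond [X in _ + X]big1 ?addr0 // => j.
  by rewrite andbT => /andP [mj _]; rewrite h ?expr0n.
by rewrite (big_nat_widenl k 0) // big_mkord.
Qed.

(** The projection error is at most that of any matrix with columns in the range of [Q]. The
    candidate is the iterated sample times the ridge coefficients times a diagonal unscaling. It
    trades the damped part [rtr H2] of the tail energy for a ridge residual and keeps the rest of
    the tail. *)
Lemma slice_bound : exists (V1 : 'M[C]_(n, k)) (H2 : 'M[C]_n) (lam0 : R),
  [/\ V1^t* *m V1 = 1%:M, admissible V1 H2,
      rtr H2 <= (sg k.+1 / sg k) ^+ (4 * q) * tail_energy &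
      forall lam d (N : 'M[C]_(n, l)) r (Q : 'M[C]_(m, r)), lam0 <= lam -> 0 < lam -> 0 < d ->
        subspace_iter M N q Q ->
        fsq (M - Q *m (Q^t* *m M)) <=
        tail_energy - rtr H2 + rtr (resid (lam%:C *: (V1 *m V1^t* ) + H2) d N)].
Proof.
have [V [Vu HE]] := gram_svd sv.
pose Ck : 'M[C]_(n, k) := \matrix_(i, j) ((i == j :> nat)%:R).
have CkE : Ck *m Ck^t* = dg head.
  apply/matrixP => i j; rewrite dgE mxE.
  under eq_bigr => b _ do rewrite !mxE rmorph_nat -natrM mulnb.
  case: (ltnP i k) => ik; last first.
    rewrite /head ltnNge ik mul0rn big1 // => b _.
    rewrite (_ : (i == b :> nat) = false) //; apply/negbTE.
    by rewrite neq_ltn (leq_trans (ltn_ord b) ik) orbT.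
  rewrite (bigD1 (Ordinal ik)) //= eqxx big1 ?addr0 => [|b bi].
    by rewrite /head ik eq_sym -val_eqE /= rmorph1; case: (_ == _).
  rewrite (_ : (i == b :> nat) = false) //; apply/negbTE.
  by move: bi; rewrite -val_eqE eq_sym.
have CkC : Ck^t* *m Ck = 1%:M.
  apply/matrixP => i j; rewrite !mxE.
  under eq_bigr => b _ do rewrite !mxE rmorph_nat -natrM mulnb.
  rewrite (bigD1 (widen_ord kn i)) //= eqxx big1 ?addr0 => [|b bi].
    by rewrite -val_eqE.
  rewrite (_ : (b == i :> nat) = false) //; apply/negbTE.
  by move: bi; rewrite -val_eqE.
pose V1 := V *m Ck.
pose H2 := V *m dg dd *m V^t*.
have V1E : V1 *m V1^t* = V *m dg head *m V^t*.
  by rewrite /V1 adjmxM !mulmxA -(mulmxA V) CkE.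
have Dpsd f : (forall j, 0 <= f j) -> psd (V *m dg f *m V^t* ).
  by move=> f0; have := psd_congr (V^t* ) (psd_dg f0); rewrite trmxCK.
have rD f : rtr (V *m dg f *m V^t* ) = \sum_j f j.
  by rewrite rtr_mulC mulmxA Vu mul1mx rtr_dg.
(* This [lam0] dominates both [s i ^+ 2] and [s i ^+ 2 * rr i ^+ 2], as the diagonal and the
   off-diagonal entries in the head rows require. *)
exists V1, H2, (\sum_j s j ^+ 2 * (1 + rr j ^+ 2)); split.
- by rewrite /V1 adjmxM mulmxA -(mulmxA (Ck^t* )) Vu mulmx1.
- split; first exact: Dpsd.
  rewrite V1E (unitary_sandwich Vu) dgM.
  rewrite (_ : (fun j => _) = fun=> 0); last first.
    by apply/funext => j; rewrite /head /dd; case: ifP; rewrite ?mulr0 ?mul0r.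
  by rewrite (_ : dg _ = 0) ?mulmx0 ?mul0mx //; apply/matrixP => i j; rewrite dgE mxE mul0rn.
- rewrite rD tailE mulr_sumr big_mkcond [leRHS]big_mkcond /=.
  apply: ler_sum => j _; rewrite /dd; case: (leqP k j) => // kj.
  rewrite mulrC ler_wpM2r ?sqr_ge0 // /rr -exprM mulnAC (_ : (2 * 2)%N = 4%N) //.
  apply: lerXn2r; rewrite ?nnegrE ?divr_ge0 ?sg0 //.
  by rewrite ler_pM2r ?invr_gt0 //; apply: sg_le.
move=> lam d N r Q lamge lam0 d0 hQ.
have [Q1 [B HB]] := subspace_iter_range hQ.
pose h j := lam * head j + dd j.
have h0 j : 0 <= h j by rewrite addr_ge0 // mulr_ge0 // ltW.
have HH : lam%:C *: (V1 *m V1^t* ) + H2 = V *m dg h *m V^t*.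
  rewrite V1E; apply: (etrans (scale_sandwichD _ _ _ _ _)).
  have -> : lam%:C *: dg head + dg dd = dg h by rewrite dgZ dgD.
  by [].
rewrite HH; set H := V *m dg h *m V^t*.
have Hp : psd H by exact: Dpsd.
pose Xi := defect H d N; pose Y := coefm H d N.
have NY : N *m Y = 1%:M - Xi by rewrite /Xi /defect opprB addrC subrK.
(* The unscaling inverts [a] on the head. On the tail it is capped at the value for [sig], which
   avoids dividing by small singular values and gives [a j * e j = rr j <= 1]. *)
pose e (j : 'I_n) := if (j < k)%N then ((s j ^+ 2) ^+ q)^-1 else ((sig ^+ 2) ^+ q)^-1.
pose a (j : 'I_n) := (s j ^+ 2) ^+ q.
pose xi := V^t* *m Xi *m V.
have VV : V *m V^t* = 1%:M by exact: unitaryC.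
have err : fsq (M - Q *m (Q^t* *m M)) <=
    qf (dg (fun j => s j ^+ 2)) (1%:M - dg a *m (1%:M - xi) *m dg e).
  apply: le_trans (fsq_proj M (B *m (Y *m (V *m dg e *m V^t* ))) Q1) _.
  rewrite (mulmxA Q) -HB iter_gram HE (iter_diag (fun j : 'I_n => sg j.+1 ^+ 2) N q Vu).
  set Z := 1%:M - V *m dg a *m V^t* *m (1%:M - Xi) *m (V *m dg e *m V^t* ).
  have -> : M - M *m (V *m dg (fun j : 'I_n => (sg j.+1 ^+ 2) ^+ q) *m V^t* *m N) *m
      (Y *m (V *m dg e *m V^t* )) = M *m Z.
    by rewrite /Z -NY mulmxBr mulmx1 !mulmxA.
  rewrite -qf_fsq HE.
  have VZ : V^t* *m Z = (1%:M - dg a *m (1%:M - xi) *m dg e) *m V^t*.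
    exact: unitary_defect.
  by rewrite qf_sandwich VZ (qf_unitary_r Vu).
apply: le_trans err _.
have subE (A1 A2 : 'M[C]_n) i j : (A1 - A2) i j = A1 i j - A2 i j by rewrite !mxE.
(* [xi = 1 - Bp * dg h] with [Bp] positive semidefinite and [h >= 0], so the diagonal of the
   subtracted product has nonnegative real part. This is the one-sided bound required by
   [entry_bound]. *)
have xi_diag j : Re (xi j j) <= 1.
  pose Bp := V^t* *m N *m ridge H d N *m (N^t* *m V).
  have -> : xi = 1%:M - Bp *m dg h.
    rewrite /xi /Xi /defect mulmxBr mulmxBl mulmx1 Vu; congr (_ - _).
    by rewrite /coefm /Bp /H !mulmxA -(mulmxA _ (V^t* ) V) Vu mulmx1.
  rewrite subE cReD cReN mul_dgE cReM /= mulr0 subr0 mxE eqxx /=.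
  rewrite lerBlDr lerDl mulr_ge0 //.
  have [t [D ->]] : psd Bp.
    have := psd_congr (N^t* *m V) (ridge_psd N Hp d0).
    by rewrite /Bp adjmxM trmxCK !mulmxA.
  rewrite mxE (raddf_sum (@complex.Re R : Rcomplex R -> R)) sumr_ge0 // => b _.
  rewrite !mxE conjCE; case: (D b j) => x y /=.
  by rewrite mulNr opprK addr_ge0 // -expr2 sqr_ge0.
have e0 j : 0 <= e j by rewrite /e; case: ifP => _; rewrite invr_ge0 !exprn_ge0 // ?sg0.
have a0 j : 0 <= a j by rewrite !exprn_ge0 // sg0.
have sigq : 0 < (sig ^+ 2) ^+ q by rewrite !exprn_gt0.
have rrE j : a j / (sig ^+ 2) ^+ q = rr j by rewrite /a /rr !exprM expr_div_n expr_div_n.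
have e_le j : e j <= ((sig ^+ 2) ^+ q)^-1.
  rewrite /e; case: ltnP => // jk.
  have sj : sig <= s j by apply: sg_le.
  rewrite lef_pV2 ?posrE ?exprn_gt0 //; last exact: lt_le_trans sj.
  by rewrite -!exprM lerXn2r ?nnegrE ?sg0.
have lam_s j : s j ^+ 2 * (1 + rr j ^+ 2) <= lam.
  apply: le_trans lamge; rewrite (bigD1 j) //= lerDl sumr_ge0 // => b _.
  by rewrite mulr_ge0 ?sqr_ge0 // addr_ge0 // sqr_ge0.
have hs j : s j ^+ 2 * rr j ^+ 2 <= h j.
  rewrite /h /head /dd; case: (leqP k j) => jk.
    by rewrite mulr0 add0r.
  rewrite mulr1 addr0; apply: le_trans (lam_s j).
  by rewrite ler_wpM2l ?sqr_ge0 // lerDr.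
(* Off the diagonal, [a i * e j <= rr i] suffices. On the diagonal of the head [a i * e i = 1]
   cancels the identity; on that of the tail [entry_bound] leaves a constant, and these constants
   add up to [tail_energy - rtr H2]. *)
have entry i j : s i ^+ 2 * (Re ((1%:M - dg a *m (1%:M - xi) *m dg e) i j) ^+ 2 +
      Im ((1%:M - dg a *m (1%:M - xi) *m dg e) i j) ^+ 2) <=
    (if (i == j) && (k <= j)%N then s j ^+ 2 - dd j else 0) +
    h i * (Re (xi i j) ^+ 2 + Im (xi i j) ^+ 2).
  rewrite subE mul_dgE dg_mulE subE.
  have delta : (1%:M : 'M[C]_n) i j = ((i == j)%:R : R)%:C by rewrite mxE rmorph_nat.
  rewrite delta cReD cImD cReN cImN !cReM !cImM !cReD !cImD !cReN !cImN /=.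
  move: (xi_diag i); case: (eqVneq i j) => [<-|ij] /=; last first.
    move=> _; rewrite add0r !mul0r !mulr0 !addr0 !sub0r !add0r !subr0.
    set x := Re _; set y := Im _.
    have -> : (- (a i * - x * e j)) ^+ 2 + (- (a i * - y * e j)) ^+ 2 =
      (a i * e j) ^+ 2 * (x ^+ 2 + y ^+ 2) by ring.
    rewrite mulrA ler_wpM2r ?addr_ge0 ?sqr_ge0 //; apply: le_trans (hs i).
    rewrite ler_wpM2l ?sqr_ge0 // lerXn2r ?nnegrE ?mulr_ge0 //.
    by rewrite -rrE ler_wpM2l.
  set x := Re _; set y := Im _ => x1.
  rewrite !mul0r !mulr0 !addr0 !subr0 !add0r.
  have -> : (1 - a i * (1 - x) * e i) ^+ 2 + (- (a i * - y * e i)) ^+ 2 =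
    (1 - (a i * e i) * (1 - x)) ^+ 2 + ((a i * e i) * y) ^+ 2 by ring.
  have xy0 : 0 <= x ^+ 2 + y ^+ 2 by rewrite addr_ge0 ?sqr_ge0.
  case: (leqP k i) => ik.
    have -> : a i * e i = rr i by rewrite /e ltnNge ik /= rrE.
    apply: le_trans (entry_bound y _ x1 (sqr_ge0 (s i))) _; first by rewrite rr0 rr1.
    by rewrite /h /head /dd ltnNge ik /= mulr0 add0r.
  have -> : a i * e i = 1.
    rewrite /e ik /a mulfV // gt_eqF // !exprn_gt0 //.
    by apply: lt_le_trans sk0 _; apply: sg_le.
  have -> : (1 - 1 * (1 - x)) ^+ 2 + (1 * y) ^+ 2 = x ^+ 2 + y ^+ 2 by ring.
  rewrite add0r; apply: ler_wpM2r => //.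
  rewrite /h /head /dd ik mulr1 addr0; apply: le_trans (lam_s i).
  by rewrite ler_peMr ?sqr_ge0 // lerDl sqr_ge0.
rewrite qf_dg => [|j]; last exact: sqr_ge0.
apply: (le_trans (ler_sum _ (fun i _ => ler_sum _ (fun j _ => entry i j)))).
under eq_bigr => i _ do rewrite big_split /=.
rewrite big_split /= -qf_dg //.
apply: lerD.
  rewrite tailE rD [X in _ - X](bigID (fun j : 'I_n => (k <= j)%N)) /=.
  rewrite [X in _ - (_ + X)]big1 ?addr0 => [|j jk]; last by rewrite /dd ltnNge jk.
  rewrite -sumrB [leRHS]big_mkcond; apply: ler_sum => i _.
  rewrite (bigD1 i) //= eqxx big1 ?addr0 //= => j ji.
  by rewrite eq_sym (negbTE ji).
have -> : qf (dg h) xi = qf H Xi.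
  have -> : xi = V^t* *m Xi *m (V^t* )^t* by rewrite trmxCK.
  rewrite (qf_unitary_r (V := V^t* )) ?trmxCK // -qf_congr.
  by rewrite trmxCK.
rewrite (rtr_resid N Hp d0) /cost lerDl mulr_ge0 ?(ltW d0) //; exact: fsq_ge0.
Qed.

End Slice.

(** * Discrete Fourier transform *)

Section Fourier.
Variables (R : realType) (n : nat).
Local Notation C := (Num.ClosedField.sort (complex_complex__canonical__Num_ClosedField R)).
Local Notation Re := (@complex.Re R).
Local Notation Im := (@complex.Im R).
Hypothesis n0 : (0 < n)%N.
Let om : C := dft_root n.

Lemma dft_root_exp k : om ^+ k = cos (2 * pi / n%:R *+ k) -i* sin (2 * pi / n%:R *+ k).
Proof.
rewrite /om /dft_root; set a := _ / _.
elim: k => [|k IH]; first by rewrite expr0 !mulr0n cos0 sin0 oppr0.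
rewrite exprS IH mulrS cosD sinD; set b := a *+ k.
by apply: ceqP; rewrite ?cReM ?cImM /=; ring.
Qed.

Lemma dft_root_n : om ^+ n = 1.
Proof.
rewrite dft_root_exp -mulr_natr divfK ?pnatr_eq0 -?lt0n //.
have -> : (2 * pi : R) = pi *+ 2 by rewrite mulr_natl.
by rewrite cos2pi sin2pi oppr0.
Qed.

(** With [x = pi k / n] strictly between 0 and [pi], the real part is
    [cos (2 x) = 1 - 2 (sin x)^2 < 1]. *)
Lemma dft_root_neq1 k : (0 < k < n)%N -> om ^+ k != 1.
Proof.
move=> /andP [k0 kn]; rewrite dft_root_exp; apply/eqP => /(congr1 Re) /= h.
set x := pi / n%:R *+ k : R.
have xE : 2 * pi / n%:R *+ k = x *+ 2 by rewrite /x -mulrA mulr_natl mulrnAC.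
have np : 0 < n%:R :> R by rewrite ltr0n.
have x0 : 0 < x by rewrite /x mulrn_wgt0 // divr_gt0 // pi_gt0.
have xpi : x < pi.
  by rewrite /x -mulr_natr mulrAC ltr_pdivrMr // ltr_pM2l ?pi_gt0 // ltr_nat.
have sx : 0 < sin x by apply: sin_gt0_pi; rewrite x0.
move: h; rewrite xE mulr2n cosD -!expr2.
have := cos2Dsin2 x; nra.
Qed.

Lemma dft_root_neq0 : om != 0.
Proof.
apply/eqP => h; have := dft_root_n; rewrite h expr0n gtn_eqF //= => /eqP.
by rewrite eq_sym oner_eq0.
Qed.

Lemma dft_root_conj k : (om ^+ k)^*%R = om ^- k.
Proof.
have h : (om ^+ k) * (om ^+ k)^*%R = 1.
  rewrite dft_root_exp conjCE; set x := _ *+ k; have cs := cos2Dsin2 x.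
  clearbody x; apply: ceqP; rewrite ?cReM ?cImM /=; last by ring.
  by rewrite -[RHS]cs; ring.
by rewrite -[RHS]mulr1 -h mulKf // expf_neq0 // dft_root_neq0.
Qed.

Lemma dft_root_mod i m : om ^+ (i * (m %% n)) = om ^+ (i * m).
Proof.
rewrite [in RHS](divn_eq m n) mulnDr exprD.
have -> : om ^+ (i * (m %/ n * n)) = 1 by rewrite mulnA mulnC exprM dft_root_n expr1n.
by rewrite mul1r.
Qed.

(** A geometric sum whose ratio is an [n]-th root of unity, different from 1 unless [i = j]. *)
Lemma dft_orthogonal (i j : 'I_n) :
  \sum_(t < n) om ^+ (i * t) * om ^- (j * t) = (n%:R : C) *+ (i == j).
Proof.
have term (t : 'I_n) : om ^+ (i * t) * om ^- (j * t) = (om ^+ i / om ^+ j) ^+ t.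
  by rewrite expr_div_n -!exprM.
under eq_bigr => t _ do rewrite term.
set z := om ^+ i / om ^+ j.
have [eij|ij] := eqVneq i j.
  rewrite mulr1n /z; have -> : om ^+ i / om ^+ j = 1 by rewrite eij divff // expf_neq0 // dft_root_neq0.
  by under eq_bigr do rewrite expr1n; rewrite sumr_const card_ord.
rewrite mulr0n.
have zn : z ^+ n = 1.
  by rewrite /z expr_div_n -!exprM (mulnC i) (mulnC j) !exprM dft_root_n !expr1n divr1.
have z1 : z - 1 != 0.
  rewrite subr_eq0; apply/eqP => h.
  have e : om ^+ i = om ^+ j.
    by rewrite -[LHS](divfK (expf_neq0 j dft_root_neq0)) -/z h mul1r.
  wlog lt : i j ij {term z h zn} e / (i < j)%N.
    move=> H; case: (ltngtP i j) => [lt|lt|/val_inj E]; first exact: (H i j).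
      by apply: (H j i) => //; rewrite eq_sym.
    by rewrite E eqxx in ij.
  have : om ^+ (j - i) != 1.
    by apply: dft_root_neq1; rewrite subn_gt0 lt /=; apply: leq_ltn_trans (ltn_ord j); exact: leq_subr.
  move/eqP; apply; apply: (mulfI (expf_neq0 i dft_root_neq0)).
  by rewrite -exprD subnKC ?(ltnW lt) // mulr1 e.
apply: (mulfI z1); rewrite mulr0.
by have := subrX1 z n; rewrite zn subrr => /esym.
Qed.

Lemma dft_idft a b (B : tensor R[i] a b n) i : dft (idft B) i = B i.
Proof.
rewrite !ffunE; under eq_bigr => t _ do rewrite ffunE scalerA mulrC -scalerA scaler_sumr.
rewrite -scaler_sumr exchange_big /=.
under eq_bigr => j _ do [under eq_bigr => t _ do rewrite scalerA mulrC; rewrite -scaler_suml].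
have E (j : 'I_n) : \sum_(t < n) om ^- (j * t) * om ^+ (i * t) = (n%:R : C) *+ (i == j).
  by under eq_bigr => t _ do rewrite mulrC; exact: dft_orthogonal.
rewrite (bigD1 i) //= E eqxx mulr1n big1 ?addr0 => [|j ji].
  by rewrite scalerA mulVf ?scale1r // pnatr_eq0 -lt0n.
by rewrite E eq_sym (negbTE ji) mulr0n scale0r.
Qed.

Lemma dft_ttr a b (B : tensor R[i] a b n) i : dft (ttr B) i = (dft B i)^t*.
Proof. by rewrite /ttr dft_idft ffunE. Qed.

Lemma dftE a b (B : tensor R[i] a b n) i x y :
  dft B i x y = \sum_(t < n) om ^+ (i * t) * B t x y.
Proof. by rewrite ffunE summxE; apply: eq_bigr => t _; rewrite mxE. Qed.

Lemma dft_sub a b (B D : tensor R[i] a b n) i : dft (B - D) i = dft B i - dft D i.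
Proof.
rewrite !ffunE -sumrB; apply: eq_bigr => t _.
by rewrite !ffunE scalerBr.
Qed.

Lemma dft_tprod a b c (B : tensor R[i] a b n) (D : tensor R[i] b c n) i :
  dft (tprod B D) i = dft B i *m dft D i.
Proof.
rewrite !ffunE mulmx_suml.
under eq_bigr => t _ do rewrite ffunE scaler_sumr.
rewrite exchange_big /=; apply: eq_bigr => u _.
rewrite mulmx_sumr.
under eq_bigr => t _ do rewrite scaler_sumr.
rewrite (exchange_big_dep xpredT) //=; apply: eq_bigr => v _.
rewrite (big_pred1 (Ordinal (ltn_pmod (u + v) n0))) => [|t]; last first.
  by rewrite /= eq_sym -val_eqE.
rewrite /= (dft_root_mod i (u + v)) mulnDr exprD.
by rewrite -scalemxAl -scalemxAr scalerA.
Qed.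

Lemma dft_first a b (B : tensor R[i] a b n) (t0 : 'I_n) i : t0 = 0%N :> nat ->
  (forall t : 'I_n, t != 0%N :> nat -> B t = 0) -> dft B i = B t0.
Proof.
move=> t00 B0; rewrite ffunE (bigD1 t0) //= t00 muln0 expr0 scale1r.
rewrite big1 ?addr0 // => t tt0; rewrite B0 ?scaler0 //.
by rewrite -t00; exact: tt0.
Qed.

Lemma parseval a b (B : tensor R[i] a b n) :
  n%:R * frobenius B ^+ 2 = \sum_i fsq (dft B i).
Proof.
have nrm (z : C) : ComplexField.Normc.normc z ^+ 2 = Re (z * z^*%R).
  case: z => x y; rewrite conjCE /= sqr_sqrtr ?addr_ge0 ?sqr_ge0 //.
  by rewrite mulrN opprK !expr2.
have nrm2 (z : C) : Re z ^+ 2 + Im z ^+ 2 = Re (z * z^*%R).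
  by case: z => x y; rewrite conjCE /= mulrN opprK !expr2.
rewrite sqr_sqrtr; last first.
  do 3![apply: sumr_ge0 => ? _]; exact: sqr_ge0.
under [RHS]eq_bigr => i _ do rewrite fsqE.
rewrite mulr_sumr [RHS]exchange_big /=.
under eq_bigr => t _ do rewrite mulr_sumr.
rewrite exchange_big /=; apply: eq_bigr => x _.
rewrite [RHS]exchange_big /=.
under eq_bigr => t _ do rewrite mulr_sumr.
rewrite exchange_big /=; apply: eq_bigr => y _.
under [RHS]eq_bigr => i _ do rewrite nrm2 dftE.
under [LHS]eq_bigr => t _ do rewrite nrm.
rewrite -(raddf_sum (@complex.Re R : Rcomplex R -> R)) -mulr_sumr.
rewrite -(raddf_sum (@complex.Re R : Rcomplex R -> R)).
have E : \sum_(i < n) (\sum_(t < n) om ^+ (i * t) * B t x y) *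
    (\sum_(t < n) om ^+ (i * t) * B t x y)^*%R =
    n%:R * \sum_(t < n) B t x y * (B t x y)^*%R.
  have e (i : 'I_n) : (\sum_(t < n) om ^+ (i * t) * B t x y) *
      (\sum_(t < n) om ^+ (i * t) * B t x y)^*%R =
      \sum_(t < n) \sum_(u < n) (om ^+ (t * i) * om ^- (u * i)) * (B t x y * (B u x y)^*%R).
    rewrite rmorph_sum mulr_suml; apply: eq_bigr => t _; rewrite mulr_sumr.
    by apply: eq_bigr => u _; rewrite rmorphM /= dft_root_conj (mulnC i t) (mulnC i u) mulrACA.
  under eq_bigr => i _ do rewrite e.
  rewrite exchange_big mulr_sumr; apply: eq_bigr => t _.
  rewrite exchange_big (bigD1 t) //= [X in _ + X]big1 ?addr0 => [|u ut].
    by rewrite -mulr_suml dft_orthogonal eqxx.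
  by rewrite -mulr_suml dft_orthogonal eq_sym (negbTE ut) mulr0n mul0r.
have reM (x0 : R) (z : C) : Re (x0%:C * z) = x0 * Re z by rewrite cReM /= mul0r subr0.
have nC : (n%:R : C) = (n%:R : R)%:C by rewrite rmorph_nat.
by rewrite E nC; apply/esym; exact: reM.
Qed.

End Fourier.

(** * From the slices to the tensor *)

Section Assembly.
Variable R : realType.
Local Notation C := (Num.ClosedField.sort (complex_complex__canonical__Num_ClosedField R)).

Lemma subspace_iter_rank m n l (M : 'M[C]_(m, n)) (N : 'M[C]_(n, l)) q r (Q : 'M[C]_(m, r)) :
  subspace_iter M N q Q -> (r <= l)%N.
Proof.
elim=> [Q0 _|j r' Q0 G Q' _ h _ _]; first exact: geq_minr.
by apply: leq_trans (geq_minr _ _) _; apply: leq_trans (geq_minr _ _) h.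
Qed.

Lemma pid_sandwich m r l (Q : 'M[C]_(m, r)) : (r <= l)%N ->
  (Q *m (pid_mx r : 'M[C]_(r, l))) *m (Q *m (pid_mx r : 'M[C]_(r, l)))^t* = Q *m Q^t*.
Proof.
move=> rl; rewrite adjmxM tr_pid_mx map_pid_mx mulmxA -(mulmxA Q) pid_mx_id //.
by rewrite pid_mx_1 mulmx1.
Qed.

(** [h] is the trace of the damped tail. Since [(k + p - 1) / (p - 1) = 1 + k / (p - 1)], the
    subtracted [h] cancels and only the excess is damped by [t]. *)
Lemma ratio_arith (t T h k p : R) : 1 < p -> 0 <= k -> h <= t * T ->
  T - h + ((k + p - 1) / (k + p - k - 1) * h) <= (1 + k / (p - 1) * t) * T.
Proof.
move=> p1 k0 ht; have -> : k + p - k - 1 = p - 1 by ring.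
have pp : 0 < p - 1 by rewrite subr_gt0.
have -> : T - h + (k + p - 1) / (p - 1) * h = T + k / (p - 1) * h.
  by field; rewrite gt_eqF.
by rewrite mulrDl mul1r lerD2l -[leRHS]mulrA ler_wpM2l // divr_ge0 // ltW.
Qed.

(** The square root is linearized at [c] instead of invoking Jensen's inequality: being pointwise,
    the bound applies before integration to an error that may not be measurable. *)
Lemma le_half_square (x y c : R) : 0 < c -> x ^+ 2 <= y -> x <= 2^-1 * (c^-1 * y + c).
Proof.
move=> c0 xy; rewrite ler_pdivlMl // -(ler_pM2l c0).
have -> : c * (c^-1 * y + c) = y + c * c by field; rewrite gt_eqF.
by have := sqr_ge0 (x - c); nra.
Qed.

End Assembly.

Theorem theorem5 (R : realType) (d : measure_display) (T : measurableType d)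
    (P : probability T R) (n1 n2 n3 k p : nat)
    (A : tensor R n1 n2 n3) (q : 'I_n3 -> nat)
    (W : T -> tensor R n2 (k + p) n3)
    (Q : T -> tensor R[i] n1 (k + p) n3)
    (sigma : 'I_n3 -> nat -> R)
    (tau := fun i : 'I_n3 => sigma i k.+1 / sigma i k)
    (hk : (1 <= k)%N) (hp : (2 <= p)%N)
    (hW : gaussian_tensor P W)
    (hsigma : forall i, singular_values (dft (tensorC A) i) (sigma i))
    (hsigmak : forall i, 0 < sigma i k)
    (htau : forall i, tau i < 1)
    (hQ : forall w,
        tensor_subspace_iter (tensorC A) (tensorC (W w)) q (Q w)) :
  ('E_P[fun w => frobenius
                   (tensorC A - tprod (tprod (Q w) (ttr (Q w))) (tensorC A))%R]
   <= (Num.sqrt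
         (n3%:R^-1 *
          \sum_(i < n3)
            (1 + k%:R / (p%:R - 1) * tau i ^+ (4 * q i)) *
            (\sum_(k.+1 <= j < (minn n1 n2).+1) sigma i j ^+ 2))%R)%:E)%E.
Proof.
set Err := fun w => tensorC A - tprod (tprod (Q w) (ttr (Q w))) (tensorC A).
set Bd := (n3%:R^-1 * _)%R; rewrite unlock.
have [n30|n3pos] := posnP n3.
  rewrite (_ : (fun w => _) = cst 0%E) ?integral0 ?lee_fin ?sqrtr_ge0 //.
  apply/funext => w /=; rewrite /frobenius big1 ?sqrtr0 // => t _.
  by have := leq_trans (ltn_ord t) (eq_leq n30).
pose t0 := Ordinal n3pos; pose X w := W w t0.
have gX : gaussian_mx P X by exact: (hW t0).
have n3R : 0 < n3%:R :> R by rewrite ltr0n.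
have p1 : 1 < p%:R :> R by rewrite ltr1n.
have dftW w i : dft (tensorC (W w)) i = @cmx R n2 (k + p) (X w).
  rewrite (dft_first i (t0 := t0)) // ?ffunE // => t tt0.
  by have := hW t; rewrite (negbTE tt0) => /(_ w) h; rewrite ffunE h map_mx0.
have dftErr w i : exists r (Qi : 'M[R[i]]_(n1, r)),
    subspace_iter (dft (tensorC A) i) (@cmx R n2 (k + p) (X w)) (q i) Qi /\
    dft (Err w) i = dft (tensorC A) i - Qi *m (Qi^t* *m dft (tensorC A) i).
  have [Qh hQh QE] := hQ w; have [r [Qi hQi Ei]] := hQh i.
  exists r, Qi; rewrite -(dftW w i); split => //.
  rewrite dft_sub !dft_tprod // dft_ttr // QE dft_idft // Ei.
  by rewrite pid_sandwich ?mulmxA //; exact: subspace_iter_rank hQi.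
pose b i := (1 + k%:R / (p%:R - 1) * tau i ^+ (4 * q i)) * tail_energy n1 n2 k (sigma i).
have BdE : Bd = n3%:R^-1 * \sum_i b i by [].
have tail0 i : 0 <= tail_energy n1 n2 k (sigma i) by apply: sumr_ge0 => j _; exact: sqr_ge0.
have tau0 i : 0 <= tau i.
  by have [s0 _ _ _] := hsigma i; rewrite divr_ge0.
have b0 i : 0 <= b i.
  rewrite mulr_ge0 // addr_ge0 // mulr_ge0 ?exprn_ge0 // divr_ge0 //.
  by rewrite subr_ge0 ltW.
have Bd0 : 0 <= Bd by rewrite BdE mulr_ge0 ?invr_ge0 ?(ltW n3R) // sumr_ge0.
(* [phi] depends on the Gaussian matrix alone, not on the chosen factors; it varies with the slack
   [gam] through [lam] and [dl]. *)
have slice gam i : 0 < gam -> exists phi : 'M[R]_(n2, k + p) -> R,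
    [/\ good phi, forall w, fsq (dft (Err w) i) <= phi (X w) & ex P X phi <= b i + gam].
  move=> gam0; have [V1 [H2 [lam0 [V1u adm trH bound]]]] := slice_bound (k + p) (q i) (hsigma i) hk (hsigmak i).
  have hkl : (k + 2 <= k + p)%N by rewrite leq_add2l.
  have [lam [dl [lamge lam1 dl0 hres]]] := core_bound gX V1u hkl lam0 adm gam0.
  have gr : good (fun M : 'M[R]_(n2, k + p) =>
      rtr (resid (lam%:C *: (V1 *m V1^t* ) + H2) dl (@cmx R n2 (k + p) M))).
    exact: good_resid_tr adm.
  exists (fun M => (tail_energy n1 n2 k (sigma i) - rtr H2) +
     rtr (resid (lam%:C *: (V1 *m V1^t* ) + H2) dl (@cmx R n2 (k + p) M))).
  split.
  - by apply: goodD => //; exact: good_cst.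
  - by move=> w; have [r [Qi [hQi ->]]] := dftErr w i; exact: bound hQi.
  - rewrite (exD gX (good_cst _ _ _) gr) ex_cst.
    apply: le_trans (lerD (lexx _) hres) _; rewrite addrA lerD2r natrD.
    exact: ratio_arith.
apply/lee_addgt0Pr => eta eta0.
have gam0 : 0 < eta ^+ 2 by rewrite exprn_gt0.
have [phi hphi] := choice (fun i => slice _ i gam0).
(* The linearization point lies slightly above [sqrt Bd] so as to be positive even if [Bd = 0]; the
   slack [eta ^+ 2] under the root costs at most [eta]. *)
pose c := Num.sqrt (Bd + eta ^+ 2).
have Bg0 : 0 < Bd + eta ^+ 2 by rewrite ltr_wpDl.
have c0 : 0 < c by rewrite sqrtr_gt0.
pose Phi M := n3%:R^-1 * \sum_i phi i M.
have gsum : good (fun M => \sum_i phi i M).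
  by apply: good_sum => i; case: (hphi i).
have gPhi : good Phi by exact: goodZ.
pose G M := 2^-1 * (c^-1 * Phi M + c).
have gcP : good (fun M => c^-1 * Phi M + c).
  by apply: goodD; [exact: goodZ|exact: good_cst].
have gG : good G by exact: goodZ.
have frobG w : frobenius (Err w) <= G (X w).
  apply: le_half_square => //.
  rewrite -(ler_pM2l n3R) parseval // /Phi mulrA mulfV ?gt_eqF // mul1r.
  by apply: ler_sum => i _; case: (hphi i).
apply: (@le_trans _ _ (\int[P]_w (G (X w))%:E)%E).
  by apply: ge0_le_integral_any => w; rewrite lee_fin; [exact: sqrtr_ge0|exact: frobG].
rewrite (exE gX gG) -EFinD lee_fin.
have exPhi : ex P X Phi <= Bd + eta ^+ 2.
  rewrite /Phi (exZ gX _ gsum) (ex_sum gX) => [|i]; last by case: (hphi i).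
  have : \sum_i ex P X (phi i) <= \sum_(i < n3) (b i + eta ^+ 2).
    by apply: ler_sum => i _; case: (hphi i).
  rewrite big_split /= sumr_const card_ord => h.
  rewrite BdE mulrC ler_pdivrMr // mulrDl mulrAC mulVf ?gt_eqF // mul1r.
  by rewrite mulr_natr.
have exG : ex P X G <= c.
  rewrite /G (exZ gX _ gcP) (exD gX (goodZ _ gPhi) (good_cst _ _ _)) (exZ gX _ gPhi) ex_cst.
  have h : c^-1 * ex P X Phi <= c.
    rewrite ler_pdivrMl // -expr2 sqr_sqrtr //; exact: ltW.
  by lra.
apply: le_trans exG _.
have e1 : c <= Num.sqrt Bd + eta.
  rewrite -(ler_pXn2r (n := 2)) ?nnegrE ?addr_ge0 ?sqrtr_ge0 ?(ltW eta0) //.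
  rewrite sqr_sqrtr ?(ltW Bg0) // sqrrD sqr_sqrtr // lerD2r lerDl.
  by rewrite mulrn_wge0 // mulr_ge0 ?sqrtr_ge0 // ltW.
exact: e1.
Qed.
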